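(* The Clifford torus is the only compact minimal surface in $S^3$ with contact angle $\beta$ satisfying $0\le\beta<\frac{\pi}{2}$ (or $-\frac{\pi}{2}<\beta\le 0$). That is, the Clifford torus is such a surface, and if $S$ is a compact (immersed, orientable) minimal surface in $S^3$ whose contact angle satisfies $0\le\beta<\frac{\pi}{2}$ everywhere on $S$, or $-\frac{\pi}{2}<\beta\le 0$ everywhere on $S$, then $S$ is the Clifford torus.
   Context: Equip $\mathbb{C}^2$ with the Hermitian product $(z,w)=z^1\bar w^1+z^2\bar w^2$ and the inner product $\langle z,w\rangle=\mathrm{Re}\,(z,w)$, and let $S^3=\{z\in\mathbb{C}^2 : (z,z)=1\}$ be the unit sphere. The Reeb vector field on $S^3$ is $\xi(z)=iz$, and the contact distribution is $\delta_z=\{v\in T_zS^3 : \langle \xi(z),v\rangle=0\}$, which is invariant under multiplication by $i$. Let $S$ be an immersed orientable surface in $S^3$, with the induced metric. The contact angle $\beta$ of $S$ is the complementary angle between the contact distribution $\delta$ and the tangent space $TS$. Concretely, let $(e_1,e_2)$ be a local orthonormal frame of $TS$ with $e_1\in TS\cap\delta$ a unit vector field ($e_1$ is called the characteristic vector field). Then $e_2=\sin(\beta)\,i e_1+\cos(\beta)\,\xi$; in particular $\cos\beta=\langle \xi,e_2\rangle$. The Clifford torus is $T^2=\{(z_1,z_2)\in\mathbb{C}^2 : z_1\bar z_1=\tfrac12,\ z_2\bar z_2=\tfrac12\}\subset S^3$.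
   Formalization: ''S is the Clifford torus'' means that the image of S is the image of the Clifford torus under a unitary map of C^2 (such maps preserve all hypotheses but move the torus), and the compact surface S is assumed nonempty and connected (two different unitary copies would otherwise be a counterexample). *)

(* Defs.v *)
(* C^2 is the space 'rV[R[i]]_2 of row vectors. *)
From HB Require Import structures.
From mathcomp Require Export all_boot all_order all_algebra.
From mathcomp Require Export all_classical all_reals all_analysis.
From mathcomp Require Export complex.

Set Implicit Arguments.
Unset Strict Implicit.
Unset Printing Implicit Defensive.

Export Order.TTheory GRing.Theory Num.Theory numFieldNormedType.Exports.

Local Open Scope classical_set_scope.
Local Open Scope ring_scope.
Local Open Scope complex_scope.

Section Smooth.
Context {R : realType}.
Implicit Types (U : set (R * R)) (f : R * R -> R).

Definition du f (q : R * R) : R := 'D_((1 : R), (0 : R)) f q.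
Definition dv f (q : R * R) : R := 'D_((0 : R), (1 : R)) f q.

(* For open U. *)
Fixpoint Ck_on (k : nat) U f : Prop :=
  match k with
  | 0 => forall q, U q -> {for q, continuous f}
  | k'.+1 =>
      [/\ forall q, U q -> derivable f q (1, 0) /\ derivable f q (0, 1),
          Ck_on k' U (du f) & Ck_on k' U (dv f)]
  end.

Definition smooth_on U f : Prop := forall k, Ck_on k U f.

Definition smooth_pair_on U (y : R * R -> R * R) : Prop :=
  smooth_on U (fun q => (y q).1) /\ smooth_on U (fun q => (y q).2).

Definition jacobian (y : R * R -> R * R) (q : R * R) : R :=
  du (fun q => (y q).1) q * dv (fun q => (y q).2) q
  - dv (fun q => (y q).1) q * du (fun q => (y q).2) q.

End Smooth.

Section ComplexPlane.
Context {R : realType}.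
Implicit Types z w v : 'rV[R[i]]_2.

Definition herm z w : R[i] := \sum_(k < 2) z 0 k * (w 0 k)^*.

Definition inner z w : R := complex.Re (herm z w).

Definition sphere3 : set 'rV[R[i]]_2 := [set z | herm z z = 1].

Definition tangent3 z : set 'rV[R[i]]_2 := [set v | inner z v = 0].

Definition reeb z : 'rV[R[i]]_2 := 'i *: z.

Definition contact z : set 'rV[R[i]]_2 :=
  [set v | tangent3 z v /\ inner (reeb z) v = 0].

Definition clifford_torus : set 'rV[R[i]]_2 :=
  [set z | z 0 0 * (z 0 0)^* = 2^-1 /\ z 0 1 * (z 0 1)^* = 2^-1].

Definition rcomb (a b : R) v w : 'rV[R[i]]_2 := a%:C *: v + b%:C *: w.

Definition smooth_map_on (U : set (R * R)) (X : R * R -> 'rV[R[i]]_2) : Prop :=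
  forall k, smooth_on U (fun q => complex.Re (X q 0 k)) /\
            smooth_on U (fun q => complex.Im (X q 0 k)).

Definition Du (X : R * R -> 'rV[R[i]]_2) (q : R * R) : 'rV[R[i]]_2 :=
  \row_k (du (fun q => complex.Re (X q 0 k)) q
          +i* du (fun q => complex.Im (X q 0 k)) q).
Definition Dv (X : R * R -> 'rV[R[i]]_2) (q : R * R) : 'rV[R[i]]_2 :=
  \row_k (dv (fun q => complex.Re (X q 0 k)) q
          +i* dv (fun q => complex.Im (X q 0 k)) q).

Definition immersion_at (X : R * R -> 'rV[R[i]]_2) (q : R * R) : Prop :=
  forall a b : R, rcomb a b (Du X q) (Dv X q) = 0 -> a = 0 /\ b = 0.

Definition unit_normal (X : R * R -> 'rV[R[i]]_2) (q : R * R) : set 'rV[R[i]]_2 :=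
  [set N | [/\ tangent3 (X q) N, inner (Du X q) N = 0,
               inner (Dv X q) N = 0 & inner N N = 1]].

(* Half the trace of the second fundamental form in the direction N with
   respect to the induced metric E du^2 + 2 F du dv + G dv^2. *)
Definition mean_curvature (X : R * R -> 'rV[R[i]]_2) (N : 'rV[R[i]]_2)
    (q : R * R) : R :=
  let E := inner (Du X q) (Du X q) in
  let F := inner (Du X q) (Dv X q) in
  let G := inner (Dv X q) (Dv X q) in
  let l := inner (Du (Du X) q) N in
  let m := inner (Dv (Du X) q) N in
  let n := inner (Dv (Dv X) q) N in
  (E * n - 2 * F * m + G * l) / (2 * (E * G - F ^+ 2)).

(* (e1, e2) is a positively oriented orthonormal frame of the plane spanned by
   the oriented basis (Du X q, Dv X q), with e1 characteristic. *)
Definition characteristic_frame (X : R * R -> 'rV[R[i]]_2) (q : R * R)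
    (e1 e2 : 'rV[R[i]]_2) : Prop :=
  (exists a b c d : R,
     [/\ e1 = rcomb a b (Du X q) (Dv X q), e2 = rcomb c d (Du X q) (Dv X q)
       & 0 < a * d - b * c]) /\
  [/\ inner e1 e1 = 1, inner e2 e2 = 1, inner e1 e2 = 0 & contact (X q) e1].

End ComplexPlane.

(* coord and param are total functions; only their values on chart_dom and on
   its image under coord are meaningful. *)
Record chart (R : realType) (M : topologicalType) := Chart {
  chart_dom : set M;
  coord : M -> R * R;
  param : R * R -> M;
  chart_dom_open : open chart_dom;
  chart_cod_open : open (coord @` chart_dom);
  coordK : forall p, chart_dom p -> param (coord p) = p;
  coord_continuous : forall p, chart_dom p -> {for p, continuous coord};
  param_continuous :
    forall q, (coord @` chart_dom) q -> {for q, continuous param}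
}.

Record oriented_surface (R : realType) := OrientedSurface {
  surface_space :> topologicalType;
  surface_hausdorff : hausdorff_space surface_space;
  surface_second_countable : @second_countable surface_space;
  atlas : set (chart R surface_space);
  atlas_cover : forall p : surface_space, exists2 c, atlas c & chart_dom c p;
  transition_smooth : forall c d, atlas c -> atlas d ->
    smooth_pair_on (coord c @` (chart_dom c `&` chart_dom d))
      (fun q => coord d (param c q));
  transition_oriented : forall c d, atlas c -> atlas d ->
    forall q, (coord c @` (chart_dom c `&` chart_dom d)) q ->
      0 < jacobian (fun q => coord d (param c q)) q
}.

Record immersed_surface (R : realType) := ImmersedSurface {
  source :> oriented_surface R;
  immersion : source -> 'rV[R[i]]_2;
  immersion_sphere : forall p, sphere3 (immersion p);
  immersion_smooth : forall c, atlas c ->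
    smooth_map_on (coord c @` chart_dom c) (fun q => immersion (param c q));
  immersion_rank : forall c, atlas c -> forall q, (coord c @` chart_dom c) q ->
    immersion_at (fun q => immersion (param c q)) q
}.

Section ImmersedSurface.
Context {R : realType}.
Variable S : immersed_surface R.

Definition local_immersion (c : chart R S) : R * R -> 'rV[R[i]]_2 :=
  fun q => @immersion R S (param c q).

Definition minimal : Prop :=
  forall c : chart R S, atlas c -> forall q, (coord c @` chart_dom c) q ->
  forall N, unit_normal (local_immersion c) q N ->
    mean_curvature (local_immersion c) N q = 0.

(* The orientation of S fixes the sign of beta, since (- e1, e2) is negatively
   oriented. The bounds discard the frame (- e1, - e2), which would turn beta
   into pi - beta, so that beta is unique. *)
Definition contact_angle (beta : S -> R) : Prop :=
  forall p, [/\ - (pi / 2) <= beta p, beta p <= pi / 2 &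
    forall c : chart R S, atlas c -> chart_dom c p ->
    exists e1 e2, characteristic_frame (local_immersion c) (coord c p) e1 e2 /\
      e2 = rcomb (sin (beta p)) (cos (beta p))
                 ('i *: e1) (reeb (@immersion R S p))].

(* Closed surfaces are nonempty and connected. *)
Definition closed_surface : Prop :=
  [/\ [set: S] !=set0, compact [set: S] & connected [set: S]].

End ImmersedSurface.

(* Main.v *)
(* Let N be a unit normal of a minimal surface X in S^3. The support function
   f = <iX, N> of the Reeb field is sin beta up to sign, and, since multiplication
   by i is an infinitesimal isometry of S^3, it satisfies the Jacobi equation
   (Laplacian + |A|^2 + 2) f = 0. If f >= 0, the equation gives f <= 0 where f is
   minimal over the compact surface, so that f vanishes somewhere; being
   superharmonic, f is then 0 everywhere by the strong minimum principle. The
   Reeb field is therefore tangent to the surface, and X + N and X - N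
   move along two fixed orthogonal complex lines, so that the image lies in the
   image of the Clifford torus under a unitary map. It is all of it: the point of
   the image maximizing <X, y>, for y on the torus, is y itself as soon as some
   <X, y> is positive, and from any point of the torus one reaches every other in
   finitely many such steps. Conversely, the Clifford torus is a quotient of the
   plane, with charts the local inverses of (s, t) |-> (e^(is), e^(it)) / sqrt 2. *)
From HB Require Import structures.
Require Import Defs.
From mathcomp Require Import ring lra.
Set Implicit Arguments.
Unset Strict Implicit.
Unset Printing Implicit Defensive.

Local Open Scope classical_set_scope.
Local Open Scope ring_scope.
Local Open Scope complex_scope.

(** * Functions of two real variables *)

(** The geometry is done in arbitrary charts, without isothermal coordinates or Christoffel symbols.
    The Laplacian occurs multiplied by EG - F^2, as G d_uu - 2F d_uv + E d_vv - P d_u - Q d_v, where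
    P and Q are read off from the tangential part of the same second-order expression in X.
    Minimality then gives Delta X = -2 X and Delta N = -|A|^2 N, and pairing the first with iN and
    the second with iX produces the Jacobi equation as an identity of linear algebra at one point.

    A sign [tau] treats the two ranges of the angle at once. No global normal field is constructed:
    every chart has its own normal, on the side fixed by the orientation, so that all local support
    functions are restrictions of the single function [tau * sin beta], to which compactness and
    connectedness apply. For the last part the normal matters only up to sign: the two complex lines
    are recorded by squared moduli of Hermitian products with two fixed vectors, which do not see
    the phase of X + N and X - N and are locally constant. *)

Section Calculus.
Context {R : realType}.
Implicit Types (U : set (R * R)) (f g : R * R -> R) (q w : R * R).

Definition box q (e : R) : set (R * R) :=
  [set x | `|x.1 - q.1| < e /\ `|x.2 - q.2| < e].

Lemma nbhs_boxP q (A : set (R * R)) :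
  nbhs q A <-> exists2 e, 0 < e & box q e `<=` A.
Proof.
split.
  move/nbhs_ballP => [e /= e0 eA]; exists e => // x [x1 x2]; apply: eA.
  by split; rewrite /= /ball /= distrC.
move=> [e e0 eA]; apply/nbhs_ballP; exists e => //= x [x1 x2]; apply: eA.
by split; rewrite /= distrC.
Qed.

Lemma cont_box g q (e : R) : {for q, continuous g} -> 0 < e ->
  exists2 d, 0 < d & forall x, box q d x -> `|g x - g q| < e.
Proof.
move=> /(@cvgr_distC_lt _ R^o) cg e0.
by have /nbhs_boxP := cg e e0.
Qed.

Lemma is_derive_line f q w (s : R) : derivable f (q + s *: w) w ->
  is_derive s 1 (fun t : R => f (q + t *: w)) ('D_w f (q + s *: w)).
Proof.
move=> df.
have E : (fun h : R => h^-1 *: (f (q + (h *: 1 + s) *: w) - f (q + s *: w))) =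
         (fun h : R => h^-1 *: (f (h *: w + (q + s *: w)) - f (q + s *: w))).
  apply/funext => h; congr (_ *: (f _ - _)).
  by rewrite [_ *: 1]mulr1 scalerDl addrCA.
apply: DeriveDef; first by rewrite /derivable /= E.
by rewrite /derive /= E.
Qed.

Lemma mvt_line_lt f q w (a b : R) : a < b ->
  (forall s, a <= s <= b -> derivable f (q + s *: w) w) ->
  exists2 c, a < c < b &
    f (q + b *: w) - f (q + a *: w) = 'D_w f (q + c *: w) * (b - a).
Proof.
move=> ab df.
have dl s : s \in `]a, b[ -> is_derive s 1 (fun t => f (q + t *: w)) ('D_w f (q + s *: w)).
  rewrite in_itv /= => /andP[/ltW sa /ltW sb].
  by apply/is_derive_line/df; rewrite sa.
have [|c cab ->] := MVT ab dl; last by exists c; rewrite // -in_itv.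
apply: derivable_within_continuous => s; rewrite in_itv /= => sab.
by have [] := is_derive_line (df s sab).
Qed.

Lemma mvt_line f q w (a b : R) : a <= b ->
  (forall s, a <= s <= b -> derivable f (q + s *: w) w) ->
  exists2 c, a <= c <= b &
    f (q + b *: w) - f (q + a *: w) = 'D_w f (q + c *: w) * (b - a).
Proof.
rewrite le_eqVlt => /predU1P[<- _|ab df].
  by exists a; rewrite ?lexx // !subrr mulr0.
by have [c /andP[/ltW ac /ltW cb] ->] := mvt_line_lt ab df; exists c; rewrite ?ac.
Qed.

Lemma mvt_du f (x1 x2 y : R) :
  (forall t, Num.min x1 x2 <= t <= Num.max x1 x2 -> derivable f (t, y) (1, 0)) ->
  exists2 c, Num.min x1 x2 <= c <= Num.max x1 x2 &
    f (x2, y) - f (x1, y) = du f (c, y) * (x2 - x1).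
Proof.
have E t : (t, y) = (0, y) + t *: ((1 : R), (0 : R)) :> R * R.
  by congr (_, _); rewrite /= ?add0r ?[_ *: _]mulr1 // [_ *: _]mulr0 addr0.
have [x12|x21] := leP x1 x2 => df.
  have [|c cab] := @mvt_line f (0, y) (1, 0) x1 x2 x12.
    by move=> s sab; rewrite -E; apply: df.
  by rewrite -!E => ->; exists c.
have [|c cab] := @mvt_line f (0, y) (1, 0) x2 x1 (ltW x21).
  by move=> s sab; rewrite -E; apply: df.
rewrite -!E => fE; exists c => //.
by rewrite -opprB fE /du; ring.
Qed.

Lemma mvt_dv f (x y1 y2 : R) :
  (forall t, Num.min y1 y2 <= t <= Num.max y1 y2 -> derivable f (x, t) (0, 1)) ->
  exists2 c, Num.min y1 y2 <= c <= Num.max y1 y2 &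
    f (x, y2) - f (x, y1) = dv f (x, c) * (y2 - y1).
Proof.
have E t : (x, t) = (x, 0) + t *: ((0 : R), (1 : R)) :> R * R.
  by congr (_, _); rewrite /= ?add0r ?[_ *: _]mulr1 // [_ *: _]mulr0 addr0.
have [y12|y21] := leP y1 y2 => df.
  have [|c cab] := @mvt_line f (x, 0) (0, 1) y1 y2 y12.
    by move=> s sab; rewrite -E; apply: df.
  by rewrite -!E => ->; exists c.
have [|c cab] := @mvt_line f (x, 0) (0, 1) y2 y1 (ltW y21).
  by move=> s sab; rewrite -E; apply: df.
rewrite -!E => fE; exists c => //.
by rewrite -opprB fE /dv; ring.
Qed.

Lemma between_ball (x a b t e : R) : `|a - x| < e -> `|b - x| < e ->
  Num.min a b <= t <= Num.max a b -> `|t - x| < e.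
Proof.
rewrite !ltr_norml => /andP[a1 a2] /andP[b1 b2].
by case: (leP a b) => _ /andP[? ?]; apply/andP; split; lra.
Qed.

Section lin.
Variables a b : R.
Definition lin2 (h : R * R) : R := a * h.1 + b * h.2.
Fact lin2_is_linear : linear lin2.
Proof.
move=> k x y; rewrite /lin2 /= /GRing.scale /=; ring.
Qed.
HB.instance Definition _ :=
  GRing.isLinear.Build R (R * R)%type R _ lin2 lin2_is_linear.
End lin.

Lemma lin2_continuous (a b : R) : continuous (lin2 a b).
Proof.
move=> x; rewrite /lin2; apply: cvgD; apply: cvgM; try exact: cvg_cst.
  exact: cvg_fst.
exact: cvg_snd.
Qed.

(** The increment is split into a horizontal and a vertical step. The mean value theorem turns each
    into a partial derivative at an intermediate point, and continuity of the partials at [q] makes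
    the error small compared with the increment. *)
Lemma C1_differentiable U f q : open U -> U q ->
  (forall x, U x -> derivable f x (1, 0) /\ derivable f x (0, 1)) ->
  {for q, continuous (du f)} -> {for q, continuous (dv f)} ->
  differentiable f q /\ forall w, 'D_w f q = du f q * w.1 + dv f q * w.2.
Proof.
move=> oU Uq df cu cv.
pose L : {linear (R * R)%type -> R} := lin2 (du f q) (dv f q).
have Lc : continuous L by exact: lin2_continuous.
(* The first-order expansion to be proved is extracted from the type of [diff_unique], where it is
   the second premise. *)
pose fo_stmt := ltac:(let T := type of (@diff_unique R (R * R)%type R f L q) in
    match T with _ -> ?P -> _ => exact P end).
have fo : fo_stmt.
  rewrite /fo_stmt; clear fo_stmt.
  apply/eqaddoP => _/posnumP[e].
  have half0 (x : {posnum R}) : 0 < x%:num / 2 by [].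
  have /nbhs_boxP[d1 d10 d1U] : nbhs q U by exact: open_nbhs_nbhs.
  have [d2 d20 d2U] := cont_box cu (half0 e).
  have [d3 d30 d3U] := cont_box cv (half0 e).
  pose d := Num.min d1 (Num.min d2 d3).
  have d0 : 0 < d by rewrite !lt_min d10 d20.
  apply/nbhs_boxP; exists d => // -[h1 h2] /=; rewrite /box /= !subr0 => -[].
  rewrite !lt_min => /and3P[h11 h12 h13] /and3P[h21 h22 h23].
  rewrite !fctE /= /lin2 /=.
  case: q Uq L Lc cu cv d1U d2U d3U => x y Uq L Lc cu cv d1U d2U d3U.
  have ball0 (t : R) d' : 0 < d' -> `|t - t| < d' by rewrite subrr normr0.
  have [|c cab Ec] := @mvt_du f x (h1 + x) (h2 + y).
    move=> t tab; apply: (df _ _).1; apply: d1U; split => /=; rewrite ?addrK //.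
    by apply: between_ball tab; rewrite ?addrK // ball0.
  have [|c' cab' Ec'] := @mvt_dv f x y (h2 + y).
    move=> t tab; apply: (df _ _).2; apply: d1U; split => /=; rewrite ?ball0 //.
    by apply: between_ball tab; rewrite ?addrK // ball0.
  have fE : f (h1 + x, h2 + y) = f (x, y) + du f (c, h2 + y) * h1 + dv f (x, c') * h2.
    by move: Ec Ec'; rewrite !addrK => Ec Ec'; rewrite -Ec -Ec'; ring.
  have cx d' : `|h1| < d' -> `|c - x| < d'.
    move=> hd; apply: between_ball cab; rewrite ?addrK // ball0 //.
    exact: le_lt_trans hd.
  have cy d' : `|h2| < d' -> `|c' - y| < d'.
    move=> hd; apply: between_ball cab'; rewrite ?addrK // ball0 //.
    exact: le_lt_trans hd.
  have D1 : `|du f (c, h2 + y) - du f (x, y)| <= e%:num / 2.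
    by apply/ltW/d2U; split => /=; rewrite ?addrK ?cx.
  have D2 : `|dv f (x, c') - dv f (x, y)| <= e%:num / 2.
    by apply/ltW/d3U; split => /=; rewrite ?cy ?ball0.
  suff: `|f (h1 + x, h2 + y) - (f (x, y) + (du f (x, y) * h1 + dv f (x, y) * h2))|
    <= e%:num * `|((h1, h2) : (R * R)%type)| by [].
  rewrite fE.
  set M := `|(h1, h2)|.
  have h1M : `|h1| <= M by rewrite /M prod_normE /= le_max lexx.
  have h2M : `|h2| <= M by rewrite /M prod_normE /= le_max lexx orbT.
  have -> : f (x, y) + du f (c, h2 + y) * h1 + dv f (x, c') * h2 -
    (f (x, y) + (du f (x, y) * h1 + dv f (x, y) * h2)) =
    (du f (c, h2 + y) - du f (x, y)) * h1 + (dv f (x, c') - dv f (x, y)) * h2 by ring.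
  apply: le_trans (ler_normD _ _) _; rewrite !normrM.
  rewrite [e%:num]splitr mulrDl; apply: lerD.
    by apply: ler_pM.
  by apply: ler_pM.
have dE := diff_unique Lc fo.
have diff : differentiable f q.
  by apply/diff_locallyP; rewrite dE; split.
split => // w; rewrite deriveE // dE //.
Qed.
End Calculus.

(** * Functions of class C^k, symmetry of second derivatives, local minima *)

Section CkFunctions.
Context {R : realType}.
Implicit Types (U : set (R * R)) (f g : R * R -> R) (q w : R * R).

Lemma Ck1_differentiable U f q : open U -> Ck_on 1 U f -> U q -> differentiable f q.
Proof. by move=> oU [df cu cv] Uq; case: (C1_differentiable oU Uq df (cu q Uq) (cv q Uq)). Qed.

Lemma Ck1_derive U f q w : open U -> Ck_on 1 U f -> U q ->
  'D_w f q = du f q * w.1 + dv f q * w.2.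
Proof. by move=> oU [df cu cv] Uq; case: (C1_differentiable oU Uq df (cu q Uq) (cv q Uq)). Qed.

(** For positive [k], [Ck_on] does not mention continuity of [f] itself; it has to be recovered from
    the differentiability of functions with continuous partials. *)
Lemma Ck_onW k U f : open U -> Ck_on k.+1 U f -> Ck_on k U f.
Proof.
move=> oU; elim: k f => [|k IH] f.
  by move=> fC q Uq; apply/differentiable_continuous/(Ck1_differentiable oU fC Uq).
move=> [df fu fv]; split; [exact: df|exact: (IH _ fu)|exact: (IH _ fv)].
Qed.

Lemma Ck_on1 k U f : open U -> Ck_on k.+1 U f -> Ck_on 1 U f.
Proof. move=> oU; elim: k => [|k IH] fC; [exact: fC|exact/IH/(Ck_onW oU)]. Qed.

Lemma Ck_on0 k U f : open U -> Ck_on k U f -> Ck_on 0 U f.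
Proof. move=> oU; case: k => [|k] fC; [exact: fC|exact/(Ck_onW oU)/(Ck_on1 oU fC)]. Qed.

Lemma near_open U q f g : open U -> U q -> (forall x, U x -> f x = g x) ->
  \forall x \near q, f x = g x.
Proof. by move=> oU Uq fg; apply: filterS fg _; apply: open_nbhs_nbhs. Qed.

Lemma derivable_ext U q w f g : open U -> U q -> (forall x, U x -> f x = g x) ->
  derivable f q w -> derivable g q w.
Proof. by move=> oU Uq fg; apply/near_eq_derivable/(near_open oU). Qed.

Lemma derive_ext U q w f g : open U -> U q -> (forall x, U x -> f x = g x) ->
  'D_w f q = 'D_w g q.
Proof. by move=> oU Uq fg; apply/near_eq_derive/(near_open oU). Qed.

Lemma du_ext U q f g : open U -> U q -> (forall x, U x -> f x = g x) ->
  du f q = du g q.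
Proof. exact: derive_ext. Qed.

Lemma dv_ext U q f g : open U -> U q -> (forall x, U x -> f x = g x) ->
  dv f q = dv g q.
Proof. exact: derive_ext. Qed.

Lemma Ck_on_ext k U f g : open U -> (forall x, U x -> f x = g x) ->
  Ck_on k U f -> Ck_on k U g.
Proof.
move=> oU; elim: k f g => [|k IH] f g fg.
  move=> fc q Uq; have fq : f @ q --> f q := fc q Uq.
  suff : g @ q --> g q by [].
  rewrite -(fg q Uq); apply: cvg_trans fq.
  by apply: near_eq_cvg; exact: (near_open oU Uq fg).
move=> [df fu fv]; split.
- by move=> q Uq; have [] := df q Uq; split; apply: (derivable_ext oU Uq fg).
- by apply: IH fu => q Uq; exact: (du_ext oU Uq fg).
- by apply: IH fv => q Uq; exact: (dv_ext oU Uq fg).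
Qed.

Lemma du_cst (c : R) q : du (fun=> c) q = 0. Proof. exact: derive_cst. Qed.
Lemma dv_cst (c : R) q : dv (fun=> c) q = 0. Proof. exact: derive_cst. Qed.

Lemma Ck_on_cst k U (c : R) : Ck_on k U (fun=> c).
Proof.
elim: k c => [|k IH] c; first by move=> q _; exact: cst_continuous.
split; first by split; exact: derivable_cst.
  have -> : du (fun=> c) = fun=> 0 by apply/funext => q; rewrite du_cst.
  exact: IH.
have -> : dv (fun=> c) = fun=> 0 by apply/funext => q; rewrite dv_cst.
exact: IH.
Qed.

Lemma duM f g q : derivable f q (1, 0) -> derivable g q (1, 0) ->
  du (fun x => f x * g x) q = du f q * g q + f q * du g q.
Proof. by move=> df dg; rewrite /du [LHS](deriveM df dg) addrC; congr (_ + _); exact: mulrC. Qed.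

Lemma dvM f g q : derivable f q (0, 1) -> derivable g q (0, 1) ->
  dv (fun x => f x * g x) q = dv f q * g q + f q * dv g q.
Proof. by move=> df dg; rewrite /dv [LHS](deriveM df dg) addrC; congr (_ + _); exact: mulrC. Qed.

Lemma duD f g q : derivable f q (1, 0) -> derivable g q (1, 0) ->
  du (fun x => f x + g x) q = du f q + du g q.
Proof. by move=> df dg; rewrite /du [LHS](@deriveD _ _ R^o _ _ _ _ df dg). Qed.

Lemma dvD f g q : derivable f q (0, 1) -> derivable g q (0, 1) ->
  dv (fun x => f x + g x) q = dv f q + dv g q.
Proof. by move=> df dg; rewrite /dv [LHS](@deriveD _ _ R^o _ _ _ _ df dg). Qed.

Lemma derivableZ' c f q w : derivable f q w -> derivable (fun x => c * f x) q w.
Proof. by move=> df; exact: (derivableM (derivable_cst _ _ _) df). Qed.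

Lemma duZ c f q : derivable f q (1, 0) -> du (fun x => c * f x) q = c * du f q.
Proof.
move=> df; apply: etrans (duM (derivable_cst _ _ _) df) _.
by rewrite du_cst mul0r add0r.
Qed.

Lemma dvZ c f q : derivable f q (0, 1) -> dv (fun x => c * f x) q = c * dv f q.
Proof.
move=> df; apply: etrans (dvM (derivable_cst _ _ _) df) _.
by rewrite dv_cst mul0r add0r.
Qed.

Lemma Ck_on_add k U f g : open U -> Ck_on k U f -> Ck_on k U g ->
  Ck_on k U (fun q => f q + g q).
Proof.
move=> oU; elim: k f g => [|k IH] f g.
  by move=> fc gc q Uq; apply: (@continuousD _ R^o); [exact: fc|exact: gc].
move=> [df fu fv] [dg gu gv]; split.
- move=> q Uq; have [f1 f2] := df q Uq; have [g1 g2] := dg q Uq.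
  by split; [exact: (@derivableD _ _ R^o _ _ _ _ f1 g1)|exact: (@derivableD _ _ R^o _ _ _ _ f2 g2)].
- apply: (Ck_on_ext oU _ (IH _ _ fu gu)) => q Uq; symmetry.
  exact: (duD (df q Uq).1 (dg q Uq).1).
- apply: (Ck_on_ext oU _ (IH _ _ fv gv)) => q Uq; symmetry.
  exact: (dvD (df q Uq).2 (dg q Uq).2).
Qed.

Lemma Ck_on_mul k U f g : open U -> Ck_on k U f -> Ck_on k U g ->
  Ck_on k U (fun q => f q * g q).
Proof.
move=> oU; elim: k f g => [|k IH] f g.
  by move=> fc gc q Uq; apply: continuousM; [exact: fc|exact: gc].
move=> fC gC; have [df fu fv] := fC; have [dg gu gv] := gC.
have {}fC := Ck_onW oU fC; have {}gC := Ck_onW oU gC; split.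
- move=> q Uq; have [f1 f2] := df q Uq; have [g1 g2] := dg q Uq.
  by split; [exact: (derivableM f1 g1)|exact: (derivableM f2 g2)].
- apply: (Ck_on_ext oU _ (Ck_on_add oU (IH _ _ fu gC) (IH _ _ fC gu))) => q Uq.
  symmetry; exact: (duM (df q Uq).1 (dg q Uq).1).
- apply: (Ck_on_ext oU _ (Ck_on_add oU (IH _ _ fv gC) (IH _ _ fC gv))) => q Uq.
  symmetry; exact: (dvM (df q Uq).2 (dg q Uq).2).
Qed.

Lemma Ck_on_opp k U f : open U -> Ck_on k U f -> Ck_on k U (fun q => - f q).
Proof.
move=> oU fC; apply: (Ck_on_ext oU _ (Ck_on_mul oU (Ck_on_cst k U (-1)) fC)).
by move=> q _; rewrite mulN1r.
Qed.

Lemma derive_comp1 (h : R -> R) f q w (dh : R) :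
  differentiable f q -> is_derive (f q) 1 h dh ->
  derivable (h \o f) q w /\ 'D_w (h \o f) q = dh * 'D_w f q.
Proof.
move=> df [dhd dhE].
have dh' : differentiable h (f q) by apply/derivable1_diffP.
have dhf : differentiable (h \o f) q by exact: differentiable_comp.
split; first exact: diff_derivable.
rewrite !deriveE // diff_comp //= deriv1E //= derive1E dhE.
by rewrite [LHS]mulrC.
Qed.

Lemma is_derive_rsqrt (x : R) : 0 < x ->
  is_derive x 1 (fun y : R => (Num.sqrt y)^-1) (- 2^-1 * (Num.sqrt x)^-1 ^+ 3).
Proof.
move=> x0; have s0 : Num.sqrt x != 0 by rewrite gt_eqF // sqrtr_gt0.
have [ds dsE] := is_derive1_sqrt x0.
apply: DeriveDef; first exact: derivableV.
rewrite [LHS]deriveV // dsE [LHS]mulrC; field.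
by rewrite s0.
Qed.

(** The derivative of g^(-1/2) is -1/2 (g^(-1/2))^3 dg, a polynomial in the function itself and dg,
    so the induction on [k] closes. This one function serves both to normalise the normal and to
    divide by EG - F^2. *)
Lemma Ck_on_rsqrt k U g : open U -> (forall q, U q -> 0 < g q) ->
  Ck_on k U g -> Ck_on k U (fun q => (Num.sqrt (g q))^-1).
Proof.
move=> oU g0; elim: k => [|k IH].
  move=> gc q Uq; apply: (@continuousV _ _ (fun q => Num.sqrt (g q))).
    by rewrite gt_eqF // sqrtr_gt0 g0.
  by apply: continuous_comp; [exact: gc|exact: sqrt_continuous].
move=> gC; have [dg gu gv] := gC.
have {}IH := IH (Ck_onW oU gC).
have dgq q w (Uq : U q) := derive_comp1 w (Ck1_differentiable oU (Ck_on1 oU gC) Uq) (is_derive_rsqrt (g0 q Uq)).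
have P3 : Ck_on k U (fun q => - 2^-1 * ((Num.sqrt (g q))^-1 * ((Num.sqrt (g q))^-1 * (Num.sqrt (g q))^-1))).
  exact: (Ck_on_mul oU (Ck_on_cst _ _ _) (Ck_on_mul oU IH (Ck_on_mul oU IH IH))).
split.
- by move=> q Uq; split; [exact: (dgq q (1, 0) Uq).1|exact: (dgq q (0, 1) Uq).1].
- apply: (Ck_on_ext oU _ (Ck_on_mul oU P3 gu)) => q Uq.
  by rewrite [RHS](dgq q (1, 0) Uq).2.
- apply: (Ck_on_ext oU _ (Ck_on_mul oU P3 gv)) => q Uq.
  by rewrite [RHS](dgq q (0, 1) Uq).2.
Qed.

Lemma box_open q e : open (box q e).
Proof.
rewrite openE => x [x1 x2]; apply/nbhs_boxP.
exists (Num.min (e - `|x.1 - q.1|) (e - `|x.2 - q.2|)).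
  by rewrite lt_min !subr_gt0 x1.
move=> y []; rewrite !lt_min => /andP[y1 _] /andP[_ y2]; split.
  have -> : y.1 - q.1 = (y.1 - x.1) + (x.1 - q.1) by ring.
  by apply: le_lt_trans (ler_normD _ _) _; rewrite -ltrBrDr.
have -> : y.2 - q.2 = (y.2 - x.2) + (x.2 - q.2) by ring.
by apply: le_lt_trans (ler_normD _ _) _; rewrite -ltrBrDr.
Qed.

Lemma box_center q e : 0 < e -> box q e q.
Proof. by move=> e0; split; rewrite subrr normr0. Qed.

Lemma open_box U q : open U -> U q -> exists2 e, 0 < e & box q e `<=` U.
Proof. by move=> oU Uq; apply/nbhs_boxP; apply: open_nbhs_nbhs. Qed.

Lemma line_box q w (e : R) : 0 < e ->
  exists2 d, 0 < d & forall t, `|t| < d -> box q e (q + t *: w).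
Proof.
move=> e0; pose M := `|w.1| + `|w.2| + 1.
have M0 : 0 < M by rewrite /M ltr_wpDl // addr_ge0.
exists (e / M); first by rewrite divr_gt0.
move=> t; rewrite ltr_pdivlMr // => tM.
split; rewrite /= addrAC subrr add0r [_ *: _]/(_ * _) normrM;
  apply: le_lt_trans tM; apply: ler_wpM2l => //; rewrite /M.
  by rewrite -addrA lerDl addr_ge0.
by rewrite [`|w.1| + _]addrC -addrA lerDl addr_ge0.
Qed.

(** The second difference over a small square, divided by the area, is a value of each of the two
    mixed derivatives inside the square. If these differed at [q], continuity would keep their
    values on the square apart. *)
Lemma Schwarz U f q : open U -> Ck_on 2 U f -> U q -> du (dv f) q = dv (du f) q.
Proof.
case: q => x y oU fC Uq.
have [df [dfu fuu fvu] [dfv fuv fvv]] := fC.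
apply/eqP; rewrite -subr_eq0; apply/negPn/negP => ne0.
set A := _ - _ in ne0; have A0 : 0 < `|A| / 2 by rewrite divr_gt0 ?normr_gt0.
have [e e0 eU] := open_box oU Uq.
have [d1 d10 d1P] := cont_box (fuv _ Uq) A0.
have [d2 d20 d2P] := cont_box (fvu _ Uq) A0.
pose d := Num.min e (Num.min d1 d2) / 2.
have d0 : 0 < d by rewrite divr_gt0 // !lt_min e0 d10.
have dE : d < Num.min e (Num.min d1 d2) by rewrite ltr_pdivrMr // mulr2n mulrDr mulr1 ltrDl !lt_min e0 d10.
move: (dE); rewrite !lt_min => /and3P[de dd1 dd2].
have inb (s t : R) r : d < r -> 0 <= s <= d -> 0 <= t <= d -> box (x, y) r (x + s, y + t).
  move=> dr /andP[s0 sd] /andP[t0 td]; split; rewrite /= addrAC subrr add0r ger0_norm //.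
    exact: le_lt_trans dr.
  exact: le_lt_trans dr.
have e1 (a b t : R) : (a, b) + t *: ((1 : R), (0 : R)) = (a + t, b) :> R * R.
  by congr (_, _); rewrite /= ?[_ *: _]mulr1 // [_ *: _]mulr0 addr0.
have e2 (a b t : R) : (a, b) + t *: ((0 : R), (1 : R)) = (a, b + t) :> R * R.
  by congr (_, _); rewrite /= ?[_ *: _]mulr1 // [_ *: _]mulr0 addr0.
have dd : 0 <= d <= d by rewrite ltW //=.
have d00 : 0 <= (0 : R) <= d by rewrite lexx ltW.
have lt_le (c : R) : 0 < c < d -> 0 <= c <= d by move=> /andP[/ltW-> /ltW->].
(* the second difference of f, computed in both orders *)
pose D := f (x + d, y + d) - f (x + d, y) - (f (x, y + d) - f (x, y)).
have D1 : exists c c', [/\ 0 <= c <= d, 0 <= c' <= d & D = d * d * dv (du f) (x + c, y + c')].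
  pose phi (t : R) := f ((x, y + d) + t *: ((1 : R), (0 : R))) - f ((x, y) + t *: ((1 : R), (0 : R))).
  have dl1 t : 0 <= t <= d -> derivable f ((x, y + d) + t *: ((1 : R), (0 : R))) (1, 0).
    by move=> td; rewrite e1; apply: (df _ _).1; apply: eU; exact: inb.
  have dl2 t : 0 <= t <= d -> derivable f ((x, y) + t *: ((1 : R), (0 : R))) (1, 0).
    by move=> td; rewrite e1 -[y]addr0; apply: (df _ _).1; apply: eU; exact: inb.
  have dphi t : 0 <= t <= d -> is_derive t 1 phi (du f (x + t, y + d) - du f (x + t, y)).
    move=> td; rewrite -!e1.
    exact: (@is_deriveB _ _ R^o _ _ _ _ _ _ (is_derive_line (dl1 t td)) (is_derive_line (dl2 t td))).
  have [t||c] := @MVT _ phi (fun t => du f (x + t, y + d) - du f (x + t, y)) 0 d d0.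
  - by rewrite in_itv /= => /lt_le /dphi.
  - apply: derivable_within_continuous => t; rewrite in_itv /= => td.
    by have [] := dphi t td.
  rewrite in_itv /= => /lt_le cd; rewrite /phi !e1 !addr0 subr0 => DE.
  have [|c' /lt_le cd'] := @mvt_line_lt _ (du f) (x + c, y) (0, 1) 0 d d0.
    by move=> s sd; rewrite e2; apply: (dfu _ _).2; apply: eU; exact: inb.
  rewrite !e2 addr0 subr0 => DE'; exists c, c'; split=> //.
  by rewrite /D DE DE' /dv; ring.
have D2 : exists c c', [/\ 0 <= c <= d, 0 <= c' <= d & D = d * d * du (dv f) (x + c, y + c')].
  pose phi (t : R) := f ((x + d, y) + t *: ((0 : R), (1 : R))) - f ((x, y) + t *: ((0 : R), (1 : R))).
  have dl1 t : 0 <= t <= d -> derivable f ((x + d, y) + t *: ((0 : R), (1 : R))) (0, 1).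
    by move=> td; rewrite e2; apply: (df _ _).2; apply: eU; exact: inb.
  have dl2 t : 0 <= t <= d -> derivable f ((x, y) + t *: ((0 : R), (1 : R))) (0, 1).
    by move=> td; rewrite e2 -[x]addr0; apply: (df _ _).2; apply: eU; exact: inb.
  have dphi t : 0 <= t <= d -> is_derive t 1 phi (dv f (x + d, y + t) - dv f (x, y + t)).
    move=> td; rewrite -!e2.
    exact: (@is_deriveB _ _ R^o _ _ _ _ _ _ (is_derive_line (dl1 t td)) (is_derive_line (dl2 t td))).
  have [t||c] := @MVT _ phi (fun t => dv f (x + d, y + t) - dv f (x, y + t)) 0 d d0.
  - by rewrite in_itv /= => /lt_le /dphi.
  - apply: derivable_within_continuous => t; rewrite in_itv /= => td.
    by have [] := dphi t td.
  rewrite in_itv /= => /lt_le cd; rewrite /phi !e2 !addr0 subr0 => DE.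
  have [|c' /lt_le cd'] := @mvt_line_lt _ (dv f) (x, y + c) (1, 0) 0 d d0.
    by move=> s sd; rewrite e1; apply: (dfv _ _).1; apply: eU; exact: inb.
  rewrite !e1 addr0 subr0 => DE'; exists c', c; split=> //.
  have -> : D = f (x + d, y + d) - f (x, y + d) - (f (x + d, y) - f (x, y)) by rewrite /D; ring.
  by rewrite DE DE' /du; ring.
have [c1 [c1' [c1d c1d' DE1]]] := D1; have [c2 [c2' [c2d c2d' DE2]]] := D2.
have E : dv (du f) (x + c1, y + c1') = du (dv f) (x + c2, y + c2').
  have dd0 : d * d != 0 by rewrite mulf_neq0 // gt_eqF.
  exact: (mulfI dd0 (etrans (esym DE1) DE2)).
have B1 := d1P _ (inb c2 c2' _ dd1 c2d c2d'); have B2 := d2P _ (inb c1 c1' _ dd2 c1d c1d').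
have tri (p p' r : R) : `|r - p| < `|p - p'| / 2 -> `|r - p'| < `|p - p'| / 2 -> `|p - p'| < `|p - p'|.
  move=> rp rp'; rewrite [ltRHS]splitr; apply: le_lt_trans (ltrD rp rp').
  by rewrite [X in _ <= X + _]distrC -[X in `|X|](subrKA r); exact: ler_normD.
have := tri _ _ _ B1; rewrite -E => /(_ B2).
by rewrite ltxx.
Qed.

Definition local_min f q := exists2 e, 0 < e & forall x, box q e x -> f q <= f x.

Lemma local_min_derive f q w : local_min f q ->
  (exists2 e, 0 < e & forall x, box q e x -> derivable f x w) -> 'D_w f q = 0.
Proof.
move=> [e e0 fmin] [e' e'0 df].
have ee0 : 0 < Num.min e e' by rewrite lt_min e0.
have [d d0 dP] := line_box q w ee0.
have sb : box q (Num.min e e') `<=` box q e `&` box q e'.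
  by move=> x []; rewrite !lt_min => /andP[? ?] /andP[? ?].
have tP t : t \in `]-d, d[ -> (box q e `&` box q e') (q + t *: w).
  rewrite in_itv /= => td; apply/sb/dP; by rewrite ltr_norml.
have dt t : t \in `]-d, d[ -> is_derive t 1 (fun t => f (q + t *: w)) ('D_w f (q + t *: w)).
  by move=> /tP[_ td]; exact: (is_derive_line (df _ td)).
have dd : - d <= d by lra.
have d00 : 0 \in `]-d, d[ by rewrite in_itv /= oppr_lt0 d0.
have [_ dm] : is_derive (0 : R) 1 (fun t : R => f (q + t *: w)) 0.
  apply: (derive1_at_min dd _ d00).
    by move=> t td; have [] := dt t td.
  by move=> t /tP[td _]; rewrite scale0r addr0; exact: fmin.
by have [_ dE] := dt 0 d00; move: dE; rewrite dm scale0r addr0.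
Qed.

(** Here [psi] is the derivative of [f] along [w], which vanishes at [q]. If the second derivative
    along [w] were negative at [q], it would be so on a short segment, and two uses of the mean
    value theorem would put [f] strictly below [f q] there. *)
Lemma local_min_hessian U f q w : open U -> Ck_on 2 U f -> U q -> local_min f q ->
  0 <= du (du f) q * w.1 ^+ 2 + 2 * dv (du f) q * w.1 * w.2 + dv (dv f) q * w.2 ^+ 2.
Proof.
move=> oU fC Uq fmin; have fC1 := Ck_onW oU fC; have [df fu fv] := fC.
have [e e0 eU] := open_box oU Uq.
pose psi x := w.1 * du f x + w.2 * dv f x.
have psiC : Ck_on 1 U psi.
  have fu1 : Ck_on 1 U (du f) := fu; have fv1 : Ck_on 1 U (dv f) := fv.
  exact: (Ck_on_add oU (Ck_on_mul oU (Ck_on_cst 1 U w.1) fu1) (Ck_on_mul oU (Ck_on_cst 1 U w.2) fv1)).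
have psiE x : U x -> 'D_w f x = psi x.
  move=> Ux; rewrite (Ck1_derive _ oU fC1 Ux) /psi.
  by congr (_ + _); exact: mulrC.
have dpsi x : U x -> derivable psi x w by move=> Ux; apply: diff_derivable; exact: (Ck1_differentiable oU psiC Ux).
have DD x : U x -> 'D_w psi x = du (du f) x * w.1 ^+ 2 +
    (dv (du f) x + du (dv f) x) * w.1 * w.2 + dv (dv f) x * w.2 ^+ 2.
  move=> Ux; rewrite (Ck1_derive _ oU psiC Ux).
  have [c1 c2] : (derivable (du f) x (1, 0) /\ derivable (du f) x (0, 1)) /\
    (derivable (dv f) x (1, 0) /\ derivable (dv f) x (0, 1)).
    by case: fu => + _ _ => /(_ x Ux); case: fv => + _ _ => /(_ x Ux).
  have -> : du psi x = w.1 * du (du f) x + w.2 * du (dv f) x.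
    have E1 := duD (@derivableZ' w.1 _ _ _ c1.1) (@derivableZ' w.2 _ _ _ c2.1).
    rewrite [LHS]E1.
    by congr (_ + _); [exact: (duZ w.1 c1.1)|exact: (duZ w.2 c2.1)].
  have -> : dv psi x = w.1 * dv (du f) x + w.2 * dv (dv f) x.
    have E1 := dvD (@derivableZ' w.1 _ _ _ c1.2) (@derivableZ' w.2 _ _ _ c2.2).
    rewrite [LHS]E1.
    by congr (_ + _); [exact: (dvZ w.1 c1.2)|exact: (dvZ w.2 c2.2)].
  by move: (du (du f) x) (du (dv f) x) (dv (du f) x) (dv (dv f) x) => X Y Z T; ring. 
have psi0 : psi q = 0.
  rewrite -(psiE q Uq); apply: (local_min_derive fmin); exists e; first exact: e0.
  by move=> x /eU Ux; apply: diff_derivable; exact: (Ck1_differentiable oU fC1 Ux).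
suff : 0 <= 'D_w psi q.
  rewrite (DD q Uq) (Schwarz oU fC Uq); move: (du (du f) q) (dv (du f) q) (dv (dv f) q) => X Z T.
  by congr (0 <= _); ring.
rewrite leNgt; apply/negP => neg.
have neg' : 0 < - 'D_w psi q by rewrite oppr_gt0.
have Dc : {for q, continuous (fun x => 'D_w psi x)}.
  have [_ pu' pv'] := psiC.
  have pu : Ck_on 0 U (du psi) := pu'; have pv : Ck_on 0 U (dv psi) := pv'.
  have Dc0 := Ck_on_add oU (Ck_on_mul oU pu (Ck_on_cst 0 U w.1)) (Ck_on_mul oU pv (Ck_on_cst 0 U w.2)).
  have Dc1 : Ck_on 0 U (fun x => 'D_w psi x).
    by apply: (Ck_on_ext oU _ Dc0) => x Ux; rewrite (Ck1_derive _ oU psiC Ux).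
  exact: Dc1.
have [e1 e10 e1P] := cont_box Dc neg'.
have [e2 e20 e2P] := fmin.
have ee0 : 0 < Num.min e (Num.min e1 e2) by rewrite !lt_min e0 e10.
have [d d0 dP] := line_box q w ee0.
have tP t : 0 <= t <= d / 2 -> [/\ U (q + t *: w), 'D_w psi (q + t *: w) < 0 & f q <= f (q + t *: w)].
  move=> /andP[t0 td].
  have [|] := dP t; first by rewrite ger0_norm //; apply: le_lt_trans td _; rewrite ltr_pdivrMr // mulr2n mulrDr mulr1 ltrDl.
  rewrite !lt_min => /and3P[a1 a2 a3] /and3P[b1 b2 b3].
  split; [exact: eU|have := e1P _ (conj a2 b2)|exact: e2P].
  by rewrite ltr_norml => /andP[_]; rewrite ltrBlDr addNr.
have dh : 0 < d / 2 by rewrite divr_gt0.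
have [|c /andP[c0 cd]] := @mvt_line_lt _ f q w 0 (d / 2) dh.
  by move=> s /tP[Us _ _]; apply: diff_derivable; exact: (Ck1_differentiable oU fC1 Us).
have cP : 0 <= c <= d / 2 by rewrite !ltW.
have [Uc _ _] := tP c cP.
rewrite (psiE _ Uc) scale0r addr0 subr0 => fE.
have [|c' /andP[c'0 c'c]] := @mvt_line_lt _ psi q w 0 c c0.
  by move=> s /andP[s0 sc]; apply: dpsi; have [|] := tP s; rewrite // s0 (le_trans sc) // ltW.
rewrite scale0r addr0 psi0 !subr0 => psiEc.
have [_ n _] : [/\ U (q + c' *: w), 'D_w psi (q + c' *: w) < 0 & f q <= f (q + c' *: w)].
  by apply: tP; rewrite ltW //= (le_trans (ltW c'c)) // ltW.
have [_ _] := tP (d / 2) ltac:(by rewrite lexx ltW).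
rewrite leNgt => /negP; apply.
by rewrite -subr_lt0 fE psiEc pmulr_llt0 // pmulr_llt0.
Qed.

Lemma du0_cst q e f :
  (forall x, box q e x -> derivable f x (1, 0) /\ derivable f x (0, 1)) ->
  (forall x, box q e x -> du f x = 0 /\ dv f x = 0) ->
  forall x, box q e x -> f x = f q.
Proof.
case: q => a b df d0 [x y] [/= xa yb].
have e0 : 0 < e by exact: le_lt_trans xa.
have z0 (t : R) : `|t - t| < e by rewrite subrr normr0.
have P (t : R) : Num.min a x <= t <= Num.max a x -> `|t - a| < e.
  exact: between_ball.
have Q (t : R) : Num.min b y <= t <= Num.max b y -> `|t - b| < e.
  exact: between_ball.
have [|c /P cP] := @mvt_du _ f a x y.
  by move=> t /P tP; apply: (df _ _).1.
rewrite (d0 (c, y) _).1 // mul0r => /eqP; rewrite subr_eq0 => /eqP ->.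
have [|c' /Q cQ] := @mvt_dv _ f a b y.
  by move=> t /Q tP; apply: (df _ _).2; split => /=.
have -> : dv f (a, c') = 0 by apply: (d0 _ _).2; split => //=; exact: z0.
by rewrite mul0r => /eqP; rewrite subr_eq0 => /eqP.
Qed.
End CkFunctions.

(** * The strong minimum principle *)

Section StrongMinimum.
Context {R : realType}.
Implicit Types (U : set (R * R)) (f g h : R * R -> R) (q w : R * R).

Lemma du_lin2 (a b : R) q : du (lin2 a b) q = a.
Proof.
rewrite /du deriveE; last exact/linear_differentiable/lin2_continuous.
rewrite diff_lin; last exact: lin2_continuous.
by rewrite /= /lin2 /= mulr1 mulr0 addr0.
Qed.

Lemma dv_lin2 (a b : R) q : dv (lin2 a b) q = b.
Proof.
rewrite /dv deriveE; last exact/linear_differentiable/lin2_continuous.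
rewrite diff_lin; last exact: lin2_continuous.
by rewrite /= /lin2 /= mulr1 mulr0 add0r.
Qed.

Lemma Ck_on_lin2 k U (a b : R) : Ck_on k U (lin2 a b).
Proof.
case: k => [|k]; first by move=> q _; exact: lin2_continuous.
split.
- by move=> q _; split; exact/diff_derivable/linear_differentiable/lin2_continuous.
- have -> : du (lin2 a b) = fun=> a by apply/funext => q; exact: du_lin2.
  exact: Ck_on_cst.
- have -> : dv (lin2 a b) = fun=> b by apply/funext => q; exact: dv_lin2.
  exact: Ck_on_cst.
Qed.

Lemma Ck_on_pow k U g n : open U -> Ck_on k U g -> Ck_on k U (fun q => g q ^+ n).
Proof.
move=> oU gC; elim: n => [|n IH].
  by apply: (Ck_on_ext oU _ (Ck_on_cst k U 1)) => q _; rewrite expr0.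
by apply: (Ck_on_ext oU _ (Ck_on_mul oU gC IH)) => q _; rewrite exprS.
Qed.

(** Derivability and the values of the partials are kept together, so that the gradient of a
    composite expression is obtained by applying lemmas to each other instead of rewriting under
    [du] and [dv]. *)
Definition has_grad f q (a b : R) : Prop :=
  [/\ derivable f q (1, 0), derivable f q (0, 1), du f q = a & dv f q = b].

Lemma has_grad_cst (c : R) q : has_grad (fun=> c) q 0 0.
Proof. by split; [exact: derivable_cst|exact: derivable_cst|exact: du_cst|exact: dv_cst]. Qed.

Lemma has_grad_lin2 (a b : R) q : has_grad (lin2 a b) q a b.
Proof.
have d : differentiable (lin2 a b) q by exact/linear_differentiable/lin2_continuous.
by split; [exact: diff_derivable|exact: diff_derivable|exact: du_lin2|exact: dv_lin2].
Qed.

Lemma has_gradD f g q (a b c d : R) : has_grad f q a b -> has_grad g q c d ->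
  has_grad (fun x => f x + g x) q (a + c) (b + d).
Proof.
move=> [f1 f2 <- <-] [g1 g2 <- <-]; split.
- exact: (@derivableD _ _ R^o _ _ _ _ f1 g1).
- exact: (@derivableD _ _ R^o _ _ _ _ f2 g2).
- exact: (duD f1 g1).
- exact: (dvD f2 g2).
Qed.

Lemma has_gradM f g q (a b c d : R) : has_grad f q a b -> has_grad g q c d ->
  has_grad (fun x => f x * g x) q (a * g q + f q * c) (b * g q + f q * d).
Proof.
move=> [f1 f2 <- <-] [g1 g2 <- <-]; split.
- exact: (derivableM f1 g1).
- exact: (derivableM f2 g2).
- exact: (duM f1 g1).
- exact: (dvM f2 g2).
Qed.

Lemma has_grad_pow g q (a b : R) n : has_grad g q a b ->
  has_grad (fun x => g x ^+ n.+1) q (n.+1%:R * g q ^+ n * a) (n.+1%:R * g q ^+ n * b).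
Proof.
move=> gg; elim: n => [|n IH]; first by rewrite expr0 !mul1r.
have E : (fun x => g x ^+ n.+2) = (fun x => g x * g x ^+ n.+1).
  by apply/funext => x; rewrite exprS.
rewrite E; have := has_gradM gg IH.
move: (g q) => t; congr has_grad; rewrite -[n.+2]addn1 natrD exprS; ring.
Qed.

Lemma has_grad_C1 U f q : open U -> Ck_on 1 U f -> U q -> has_grad f q (du f q) (dv f q).
Proof. by move=> oU [df _ _] Uq; have [? ?] := df q Uq; split. Qed.

Lemma has_grad_ext U f g q (a b : R) : open U -> U q -> (forall x, U x -> f x = g x) ->
  has_grad f q a b -> has_grad g q a b.
Proof.
move=> oU Uq fg [f1 f2 <- <-]; split.
- exact: (derivable_ext oU Uq fg f1).
- exact: (derivable_ext oU Uq fg f2).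
- by symmetry; exact: (du_ext oU Uq fg).
- by symmetry; exact: (dv_ext oU Uq fg).
Qed.

(** The coefficients are numbers, those of a differential operator frozen at the point [q]; the
    matrix of its leading part is ((A, B), (B, C)). *)
Definition op2 (A B C P Q : R) f q : R :=
  A * du (du f) q + 2 * B * dv (du f) q + C * dv (dv f) q + P * du f q + Q * dv f q.

Lemma op2_lincomb U f g q (A B C P Q c : R) : open U -> Ck_on 2 U f -> Ck_on 2 U g -> U q ->
  op2 A B C P Q (fun x => f x + c * g x) q = op2 A B C P Q f q + c * op2 A B C P Q g q.
Proof.
move=> oU fC gC Uq.
have fC1 := Ck_onW oU fC; have gC1 := Ck_onW oU gC.
have lin h1 h2 x : Ck_on 1 U h1 -> Ck_on 1 U h2 -> U x ->
    has_grad (fun x => h1 x + c * h2 x) x (du h1 x + c * du h2 x) (dv h1 x + c * dv h2 x).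
  move=> c1 c2 Ux.
  have := has_gradD (has_grad_C1 oU c1 Ux) (has_gradM (has_grad_cst c x) (has_grad_C1 oU c2 Ux)).
  by rewrite !mul0r !add0r.
have [_ fu' fv'] := fC; have [_ gu' gv'] := gC.
have fu : Ck_on 1 U (du f) := fu'; have fv : Ck_on 1 U (dv f) := fv'.
have gu : Ck_on 1 U (du g) := gu'; have gv : Ck_on 1 U (dv g) := gv'.
have [_ _ Eu Ev] := lin _ _ _ fC1 gC1 Uq.
have Hu x : U x -> du f x + c * du g x = du (fun x => f x + c * g x) x.
  by move=> Ux; have [_ _ -> _] := lin _ _ _ fC1 gC1 Ux.
have Hv x : U x -> dv f x + c * dv g x = dv (fun x => f x + c * g x) x.
  by move=> Ux; have [_ _ _ ->] := lin _ _ _ fC1 gC1 Ux.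
have [_ _ Euu Euv] := has_grad_ext oU Uq Hu (lin _ _ _ fu gu Uq).
have [_ _ _ Evv] := has_grad_ext oU Uq Hv (lin _ _ _ fv gv Uq).
rewrite /op2 Eu Ev Euu Euv Evv.
move: (du (du f) q) (dv (du f) q) (dv (dv f) q) (du f q) (dv f q)
 (du (du g) q) (dv (du g) q) (dv (dv g) q) (du g q) (dv g q) => *; ring.
Qed.

(** At a minimum the gradient vanishes, and A times what remains is the Hessian along (A, B) plus
    (AC - B^2) f_vv. Two directions of the Hessian test are therefore enough. *)
Lemma op2_local_min U f q (A B C P Q : R) : open U -> Ck_on 2 U f -> U q -> local_min f q ->
  0 < A -> 0 <= A * C - B ^+ 2 -> 0 <= op2 A B C P Q f q.
Proof.
move=> oU fC Uq fmin A0 D0; have fC1 := Ck_onW oU fC.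
have [e e0 eU] := open_box oU Uq.
have d w : 'D_w f q = 0.
  apply: (local_min_derive fmin); exists e => // x /eU Ux.
  by apply: diff_derivable; exact: (Ck1_differentiable oU fC1 Ux).
have H1 := local_min_hessian (A, B) oU fC Uq fmin.
have H2 := local_min_hessian (0, 1) oU fC Uq fmin.
have du0 : du f q = 0 by exact: d.
have dv0 : dv f q = 0 by exact: d.
rewrite /op2 du0 dv0; move: H1 H2.
move: (du (du f) q) (dv (du f) q) (dv (dv f) q) => a b c /= H1 H2.
have c0 : 0 <= c by move: H2; rewrite !expr2; lra.
have E : A * (A * a + 2 * B * b + C * c + P * 0 + Q * 0) =
  (a * A ^+ 2 + 2 * b * A * B + c * B ^+ 2) + (A * C - B ^+ 2) * c by ring.
by rewrite -(pmulr_rge0 _ A0) E addr_ge0 // mulr_ge0.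
Qed.

(** A lower bound for the bracket in [op2_barrier], where y is the displacement from the centre and
    m = r^2 - |y|^2. The first term grows with [n] as long as |y| >= r', because the quadratic form
    is then at least mu / La * r'^2; the other terms have a bound independent of [n]. *)
Lemma barrier_pos (A B C P Q y1 y2 m mu La Bd r r' n : R) :
  0 < mu -> mu <= A * C - B ^+ 2 -> A + C <= La -> 0 < A -> 0 < La ->
  `|P| <= Bd -> `|Q| <= Bd -> 0 < r -> r' ^+ 2 <= y1 ^+ 2 + y2 ^+ 2 ->
  y1 ^+ 2 + y2 ^+ 2 = r ^+ 2 - m -> 0 < m -> 0 <= n ->
  2 * r ^+ 2 * (La + 2 * Bd * r) < 4 * n * (mu / La * r' ^+ 2) ->
  0 < 4 * n * (A * y1 ^+ 2 + 2 * B * y1 * y2 + C * y2 ^+ 2) - 2 * m * (A + C)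
     + m * -2 * (P * y1 + Q * y2).
Proof.
move=> mu0 muD AC A0 La0 PB QB r0 r's ys m0 n0 big.
have Bd0 : 0 <= Bd by exact: le_trans PB.
set s := y1 ^+ 2 + y2 ^+ 2 in r's ys.
set a := A * y1 ^+ 2 + 2 * B * y1 * y2 + C * y2 ^+ 2.
have s0 : 0 <= s by rewrite addr_ge0 // sqr_ge0.
(* Cayley-Hamilton for the matrix M = ((A, B), (B, C)): trace(M) <My, y> = det(M) |y|^2 + |My|^2.
   Hence <My, y> is at least det / trace times |y|^2. *)
have aE : (A + C) * a = (A * C - B ^+ 2) * s + ((A * y1 + B * y2) ^+ 2 + (B * y1 + C * y2) ^+ 2).
  by rewrite /a /s; ring.
have C0 : 0 < C.
  have : 0 < A * C by apply: lt_le_trans mu0 (le_trans muD _); rewrite gerBl sqr_ge0.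
  by rewrite pmulr_rgt0.
have a0 : 0 <= a.
  have : 0 <= (A + C) * a.
    rewrite aE addr_ge0 //; last by rewrite addr_ge0 // sqr_ge0.
    by rewrite mulr_ge0 // (le_trans _ muD) // ltW.
  by rewrite pmulr_rge0 // addr_gt0.
have aLa : mu * s <= La * a.
  apply: (@le_trans _ _ ((A + C) * a)); last exact: ler_wpM2r.
  rewrite aE; apply: (@le_trans _ _ ((A * C - B ^+ 2) * s)); first exact: ler_wpM2r.
  by rewrite lerDl addr_ge0 // sqr_ge0.
have a_ge : mu / La * r' ^+ 2 <= a.
  rewrite mulrAC ler_pdivrMr // [a * _]mulrC; apply: le_trans aLa.
  by apply: ler_wpM2l => //; exact: ltW.
have mr : m <= r ^+ 2 by rewrite -subr_ge0 -ys.
have yr (y : R) : y ^+ 2 <= s -> `|y| <= r.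
  move=> ysq; rewrite -(ler_pXn2r (n := 2)) ?nnegrE //; last exact: ltW.
  by rewrite real_normK ?num_real //; apply: le_trans ysq _; rewrite ys gerBl ltW.
have y1r : `|y1| <= r by apply: yr; rewrite /s lerDl sqr_ge0.
have y2r : `|y2| <= r by apply: yr; rewrite /s lerDr sqr_ge0.
have Py : `|P * y1 + Q * y2| <= 2 * Bd * r.
  apply: le_trans (ler_normD _ _) _; rewrite !normrM.
  have -> : 2 * Bd * r = Bd * r + Bd * r by ring.
  by apply: lerD; exact: ler_pM.
have Py' : P * y1 + Q * y2 <= 2 * Bd * r by apply: le_trans Py; exact: ler_norm.
have t : m * (A + C + (P * y1 + Q * y2)) <= r ^+ 2 * (La + 2 * Bd * r).
  apply: (@le_trans _ _ (m * (La + 2 * Bd * r))).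
    by apply: ler_wpM2l; [exact: ltW|exact: lerD].
  by apply: ler_wpM2r => //; rewrite addr_ge0 ?(ltW La0) // mulr_ge0 ?(ltW r0) // mulr_ge0.
have na : 4 * n * (mu / La * r' ^+ 2) <= 4 * n * a by apply: ler_wpM2l => //; rewrite mulr_ge0.
move: t na big; set t1 := mu / La * _; set t2 := P * y1 + Q * y2; set t3 := La + _.
move: (4 * n * a) (4 * n * t1) => X Y t na big.
have -> : X - 2 * m * (A + C) + m * -2 * t2 = X - 2 * (m * (A + C + t2)) by ring.
rewrite subr_gt0; apply: lt_le_trans na; apply: le_lt_trans big.
by rewrite -mulrA ler_wpM2l.
Qed.

Section barrier.
Variables (c : R * R) (r : R) (n : nat).
Let g (x : R * R) : R := r ^+ 2 - (x.1 - c.1) ^+ 2 - (x.2 - c.2) ^+ 2.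
(** A polynomial substitute for the barrier exp(-a |y|^2) - exp(-a r^2) of Hopf, with [n] in the
    role of a. The exponent is shifted by 2 so that the natural power [n] is left after two
    derivatives. *)
Definition barrier (x : R * R) : R := g x ^+ n.+2.

Let g_grad x : has_grad g x (-2 * (x.1 - c.1)) (-2 * (x.2 - c.2)).
Proof.
have x1 := has_gradD (has_grad_lin2 1 0 x) (has_grad_cst (- c.1) x).
have x2 := has_gradD (has_grad_lin2 0 1 x) (has_grad_cst (- c.2) x).
have G := has_gradD (has_grad_cst (r ^+ 2) x)
 (has_gradM (has_grad_cst (-1) x) (has_gradD (has_gradM x1 x1) (has_gradM x2 x2))).
have E : (fun x : R * R => r ^+ 2 + -1 * ((lin2 1 0 x - c.1) * (lin2 1 0 x - c.1) + (lin2 0 1 x - c.2) * (lin2 0 1 x - c.2))) = g.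
  by apply/funext => y; rewrite /g /lin2; ring.
move: G; rewrite E; congr has_grad; rewrite /lin2; ring.
Qed.

Let g_Ck k U : open U -> Ck_on k U g.
Proof.
move=> oU.
have x1 := Ck_on_add oU (Ck_on_lin2 k U 1 0) (Ck_on_cst k U (- c.1)).
have x2 := Ck_on_add oU (Ck_on_lin2 k U 0 1) (Ck_on_cst k U (- c.2)).
apply: (Ck_on_ext oU _ (Ck_on_add oU (Ck_on_cst k U (r ^+ 2)) (Ck_on_mul oU (Ck_on_cst k U (-1))
  (Ck_on_add oU (Ck_on_mul oU x1 x1) (Ck_on_mul oU x2 x2))))) => y _.
by rewrite /g /lin2; ring.
Qed.

Lemma barrier_Ck k U : open U -> Ck_on k U barrier.
Proof. by move=> oU; exact: (Ck_on_pow _ oU (g_Ck k oU)). Qed.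

Lemma op2_barrier (A B C P Q : R) x :
  op2 A B C P Q barrier x = n.+2%:R * g x ^+ n *
   (4 * n.+1%:R * (A * (x.1 - c.1) ^+ 2 + 2 * B * (x.1 - c.1) * (x.2 - c.2) + C * (x.2 - c.2) ^+ 2)
    - 2 * g x * (A + C) + g x * -2 * (P * (x.1 - c.1) + Q * (x.2 - c.2))).
Proof.
have bu y := has_grad_pow n.+1 (g_grad y).
have Eu : du barrier = fun y => n.+2%:R * (g y ^+ n.+1 * (-2 * (lin2 1 0 y - c.1))).
  apply/funext => y; have [_ _ E _] := bu y; rewrite [LHS]E /lin2; ring.
have Ev : dv barrier = fun y => n.+2%:R * (g y ^+ n.+1 * (-2 * (lin2 0 1 y - c.2))).
  apply/funext => y; have [_ _ _ E] := bu y; rewrite [LHS]E /lin2; ring.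
have gn := has_grad_pow n (g_grad x).
have x1 := has_gradM (has_grad_cst (-2) x) (has_gradD (has_grad_lin2 1 0 x) (has_grad_cst (- c.1) x)).
have x2 := has_gradM (has_grad_cst (-2) x) (has_gradD (has_grad_lin2 0 1 x) (has_grad_cst (- c.2) x)).
have [_ _ Euu Euv] := has_gradM (has_grad_cst n.+2%:R x) (has_gradM gn x1).
have [_ _ _ Evv] := has_gradM (has_grad_cst n.+2%:R x) (has_gradM gn x2).
rewrite /op2 Eu Ev Euu Euv Evv /lin2.
rewrite exprS; move: (g x ^+ n) (g x) (x.1) (x.2) (c.1) (c.2) => *.
move: (n.+1%:R : R) (n.+2%:R : R) => *; ring.
Qed.
End barrier.

Lemma norm_lt_sqr (t s : R) : 0 <= s -> t ^+ 2 < s ^+ 2 -> `|t| < s.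
Proof.
move=> s0; rewrite -[t ^+ 2]real_normK ?num_real // => ts.
by rewrite -(ltr_pXn2r (n := 2)) // nnegrE.
Qed.

Lemma sqr_le_norm (t s : R) : `|t| < s -> t ^+ 2 <= s ^+ 2.
Proof.
move=> ts; rewrite -[t ^+ 2]real_normK ?num_real //.
by rewrite lerXn2r ?nnegrE ?(ltW ts) // (le_trans _ (ltW ts)).
Qed.

Lemma closed_box_compact q (r : R) :
  compact [set x : R * R | `|x.1 - q.1| <= r /\ `|x.2 - q.2| <= r].
Proof.
have -> : [set x : R * R | `|x.1 - q.1| <= r /\ `|x.2 - q.2| <= r] =
    `[q.1 - r, q.1 + r]%classic `*` `[q.2 - r, q.2 + r]%classic.
  apply/seteqP; split => -[x1 x2] /=; rewrite !ler_norml !in_itv /=.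
    by move=> [/andP[? ?] /andP[? ?]]; split; apply/andP; split; lra.
  by move=> [/andP[? ?] /andP[? ?]]; split; apply/andP; split; lra.
by apply: compact_setX; exact: segment_compact.
Qed.

(** Suppose [f q > 0] for some [q] near the zero [q0], and subtract a small multiple of the barrier
    on a disc about [q] having [q0] in its interior. The difference [h] is negative at [q0],
    nonnegative off the disc, and nonnegative near [q]. Its minimum thus lies in an annulus on which
    the barrier is a strict subsolution, against [op2_local_min]. Since [q0] is interior to the
    disc, no boundary point lemma is involved. *)
Lemma strong_min U f (A B C P Q : R * R -> R) q0 : open U -> Ck_on 2 U f ->
  (forall x, U x -> 0 <= f x) ->
  Ck_on 0 U A -> Ck_on 0 U B -> Ck_on 0 U C -> Ck_on 0 U P -> Ck_on 0 U Q ->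
  (forall x, U x -> 0 < A x) -> (forall x, U x -> 0 < A x * C x - B x ^+ 2) ->
  (forall x, U x -> op2 (A x) (B x) (C x) (P x) (Q x) f x <= 0) ->
  U q0 -> f q0 = 0 -> exists2 e, 0 < e & forall x, box q0 e x -> f x = 0.
Proof.
move=> oU fC f0 cA cB cC cP cQ A0 D0 Lf Uq fq0.
have cD : Ck_on 0 U (fun x => A x * C x - B x ^+ 2).
  exact: (Ck_on_add oU (Ck_on_mul oU cA cC) (Ck_on_opp oU (Ck_on_pow 2 oU cB))).
have D0q := D0 q0 Uq.
have Dh : 0 < (A q0 * C q0 - B q0 ^+ 2) / 2 by rewrite divr_gt0.
pose mu := (A q0 * C q0 - B q0 ^+ 2) / 2.
have [e1 e10 e1P] := open_box oU Uq.
have [e2 e20 e2P] := cont_box (cA q0 Uq) ltr01.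
have [e3 e30 e3P] := cont_box (cC q0 Uq) ltr01.
have [e4 e40 e4P] := cont_box (cP q0 Uq) ltr01.
have [e5 e50 e5P] := cont_box (cQ q0 Uq) ltr01.
have [e6 e60 e6P] := cont_box (cD q0 Uq) Dh.
pose e := Num.min e1 (Num.min e2 (Num.min e3 (Num.min e4 (Num.min e5 e6)))).
have e0 : 0 < e by rewrite !lt_min e10 e20 e30 e40 e50.
pose La := `|A q0| + `|C q0| + 2.
pose Bd := `|P q0| + `|Q q0| + 1.
have La0 : 0 < La by rewrite ltr_wpDl // addr_ge0.
have bnd x : box q0 e x -> [/\ U x, mu <= A x * C x - B x ^+ 2, A x + C x <= La,
   `|P x| <= Bd & `|Q x| <= Bd].
  move=> [/=]; rewrite !lt_min => /and5P[a1 a2 a3 a4 /andP[a5 a6]].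
  move=> /and5P[b1 b2 b3 b4 /andP[b5 b6]].
  split; first exact: e1P.
  - have := e6P x (conj a6 b6); rewrite -/mu ltr_norml => /andP[+ _].
    have -> : A q0 * C q0 - B q0 ^+ 2 = mu + mu by rewrite /mu -splitr.
    by set t := A x * C x - _; lra.
  - have := e2P x (conj a2 b2); have := e3P x (conj a3 b3).
    rewrite !ltr_norml => /andP[_ c1] /andP[_ c2].
    have := ler_norm (A q0); have := ler_norm (C q0); rewrite /La; lra.
  - have c1 := e4P x (conj a4 b4); have := ler_normD (P x - P q0) (P q0).
    rewrite subrK => c2; have := normr_ge0 (Q q0); rewrite /Bd; lra.
  - have c1 := e5P x (conj a5 b5); have := ler_normD (Q x - Q q0) (Q q0).
    rewrite subrK => c2; have := normr_ge0 (P q0); rewrite /Bd; lra.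
(* For [q] within e / 4 of [q0], the disc of radius e / 2 about [q] contains [q0], and its bounding
   square stays inside [box q0 e], where the coefficient bounds hold. *)
exists (e / 4); first by rewrite divr_gt0.
move=> q qq0; apply/eqP; rewrite eq_le; apply/andP; split; last first.
  apply: f0; have [|//] := bnd q.
  by case: qq0 => s1 s2; split; lra.
rewrite leNgt; apply/negP => fq.
have q0q : box q (e / 4) q0 by case: qq0 => s1 s2; split; rewrite distrC.
pose r := e / 2; have r0 : 0 < r by rewrite divr_gt0.
have inK x : `|x.1 - q.1| <= r -> `|x.2 - q.2| <= r -> box q0 e x.
  move=> s1 s2; case: qq0 => s3 s4; split.
    have := ler_normD (x.1 - q.1) (q.1 - q0.1); rewrite subrKA /r in s1 * => s5; lra.
  have := ler_normD (x.2 - q.2) (q.2 - q0.2); rewrite subrKA /r in s2 * => s5; lra.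
have Uq' : U q by have [|//] := bnd q; apply: inK; rewrite subrr normr0 ltW.
have fc0 := Ck_on0 oU fC.
have fq2 : 0 < f q / 2 by rewrite divr_gt0.
have [r' r'0 r'P] := cont_box (fc0 q Uq') fq2.
(* the exponent makes the barrier a strict subsolution off the disc of radius r' *)
have [n nodd nbig] : exists2 n : nat, odd n & 2 * r ^+ 2 * (La + 2 * Bd * r) < 4 * n.+1%:R * (mu / La * r' ^+ 2).
  pose t := mu / La * r' ^+ 2.
  have t0 : 0 < t by rewrite mulr_gt0 // ?divr_gt0 // exprn_gt0.
  pose b := 2 * r ^+ 2 * (La + 2 * Bd * r).
  have b0 : 0 <= b / t.
    have Bd0 : 0 <= Bd by rewrite /Bd !addr_ge0.
    have s1 : 0 <= La + 2 * Bd * r by apply: addr_ge0; [exact: ltW|apply: mulr_ge0; [exact: mulr_ge0|exact: ltW]].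
    have s2 : 0 <= 2 * r ^+ 2 by apply: mulr_ge0; rewrite ?sqr_ge0.
    by apply: divr_ge0; [exact: mulr_ge0|exact: ltW].
  pose N := Num.Def.archi_bound (b / t).
  exists (N.*2.+1); first by rewrite /= odd_double.
  have := archi_boundP b0; rewrite -/N ltr_pdivrMr // => bN.
  apply: lt_le_trans bN _; rewrite -/t; apply: ler_wpM2r; first exact: ltW.
  rewrite -natrM ler_nat; apply: (@leq_trans N.*2.+2); last exact: leq_pmull.
  by rewrite -addnn -!addnS leq_addr.
pose w := barrier q r n.
(* With this constant [ep * w] is at most f q / 2 on the disc, a value above which [f] stays within
   distance [r'] of [q]. *)
pose ep := f q / 2 / (r ^+ 2) ^+ n.+2.
have rn0 : 0 < (r ^+ 2) ^+ n.+2 by rewrite !exprn_gt0.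
have ep0 : 0 < ep by rewrite !divr_gt0.
pose h x := f x + - ep * w x.
have wC k := @barrier_Ck q r n k U oU.
have hC : Ck_on 2 U h.
  exact: (Ck_on_add oU fC (Ck_on_mul oU (Ck_on_cst 2 U (- ep)) (wC 2%N))).
pose K := [set x : R * R | `|x.1 - q.1| <= r /\ `|x.2 - q.2| <= r].
have Kc : compact K by exact: closed_box_compact.
have KU x : K x -> U x by move=> [s1 s2]; have [|//] := bnd x; exact: inK.
have Kq0 : K q0 by case: q0q => s1 s2; split; rewrite /r; lra.
have hc : {within K, continuous h}.
  apply: continuous_in_subspaceT => x; rewrite inE => /KU Ux.
  exact: (Ck_on0 oU hC).
have [x /set_mem Kx xmin] := compact_EVT_min (ex_intro _ q0 Kq0) Kc hc.
have hq0 : h q0 < 0.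
  rewrite /h fq0 add0r mulNr oppr_lt0 mulr_gt0 // /w /barrier exprn_gt0 //.
  have [/sqr_le_norm a1 /sqr_le_norm a2] := q0q.
  have a3 : r ^+ 2 = 4 * (e / 4) ^+ 2 by rewrite /r; field.
  have a4 : 0 < (e / 4) ^+ 2 by rewrite exprn_gt0 // divr_gt0.
  rewrite a3; lra.
have hx : h x < 0 by apply: le_lt_trans hq0; apply: xmin; rewrite inE.
have Ux := KU x Kx.
pose m := r ^+ 2 - (x.1 - q.1) ^+ 2 - (x.2 - q.2) ^+ 2.
(* The square sticks out of the disc; there [w] is an odd power of a nonpositive number, so that [h]
   is at least [f] and cannot be negative. *)
have m0 : 0 < m.
  rewrite ltNge; apply/negP => m0; move: hx; rewrite ltNge => /negP; apply.
  rewrite /h addr_ge0 ?f0 // mulNr oppr_ge0 pmulr_rle0 // /w /barrier.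
  by rewrite exprn_odd_le0 //= negbK.
have farx : r' ^+ 2 <= (x.1 - q.1) ^+ 2 + (x.2 - q.2) ^+ 2.
  rewrite leNgt; apply/negP => near; move: hx; rewrite ltNge => /negP; apply.
  have near1 (t s : R) : t ^+ 2 + s ^+ 2 < r' ^+ 2 -> `|t| < r'.
    move=> ts; apply: norm_lt_sqr; first exact: ltW.
    by apply: le_lt_trans ts; rewrite lerDl sqr_ge0.
  have near' : (x.2 - q.2) ^+ 2 + (x.1 - q.1) ^+ 2 < r' ^+ 2 by rewrite addrC.
  have := r'P x (conj (near1 _ _ near) (near1 _ _ near')).
  rewrite ltr_norml => /andP[fx _].
  have wx : w x <= (r ^+ 2) ^+ n.+2.
    have mr : m <= r ^+ 2 by rewrite /m -addrA -opprD gerBl; apply: addr_ge0; exact: sqr_ge0.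
    by apply: lerXn2r; rewrite ?nnegrE ?sqr_ge0 // ltW.
  have epw : ep * w x <= f q / 2.
    rewrite /ep -mulrA ler_piMr ?(ltW fq2) // mulrC ler_pdivrMr // mul1r //.
  rewrite /h mulNr; lra.
have hmin : local_min h x.
  exists (Num.min (r - `|x.1 - q.1|) (r - `|x.2 - q.2|)).
    have lt_r (t s : R) : 0 < r ^+ 2 - t ^+ 2 - s ^+ 2 -> `|t| < r.
      move=> ts; apply: norm_lt_sqr; first exact: ltW.
      by rewrite -subr_gt0; apply: lt_le_trans ts _; rewrite gerBl sqr_ge0.
    rewrite lt_min !subr_gt0 (lt_r _ _ m0) /=; apply: (lt_r _ (x.1 - q.1)).
    by rewrite addrAC.
  move=> y [/=]; rewrite !lt_min => /andP[y1 _] /andP[_ y2].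
  apply: xmin; rewrite inE; split.
    have := ler_normD (y.1 - x.1) (x.1 - q.1); rewrite subrKA => s5; lra.
  have := ler_normD (y.2 - x.2) (x.2 - q.2); rewrite subrKA => s5; lra.
have [_ muD AC PB QB] := bnd x (inK x Kx.1 Kx.2).
have := op2_local_min (P x) (Q x) oU hC Ux hmin (A0 x Ux) (ltW (D0 x Ux)).
rewrite (op2_lincomb _ _ _ _ _ _ oU fC (wC 2%N) Ux) leNgt => /negP; apply.
apply: le_lt_trans (lerD (Lf x Ux) (lexx _)) _.
rewrite add0r mulNr oppr_lt0 mulr_gt0 // op2_barrier -/m.
apply: mulr_gt0; first by rewrite mulr_gt0 ?exprn_gt0.
apply: (barrier_pos Dh muD AC (A0 x Ux) La0 PB QB r0 farx _ m0 _ nbig) => //.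
by rewrite /m; ring.
Qed.
End StrongMinimum.

(** * Real coordinates on C^2 *)

Section Coordinates.
Context {R : realType}.
Implicit Types (z w v a b c : 'rV[R[i]]_2) (t s : R).

Definition c0 z : R := complex.Re (z 0 0).
Definition c1 z : R := complex.Im (z 0 0).
Definition c2 z : R := complex.Re (z 0 1).
Definition c3 z : R := complex.Im (z 0 1).

Definition vec4 (x y s t : R) : 'rV[R[i]]_2 :=
  \row_k (if k == 0 then x +i* y else s +i* t).

Lemma vec4_c0 x y s t : c0 (vec4 x y s t) = x. Proof. by rewrite /c0 mxE. Qed.
Lemma vec4_c1 x y s t : c1 (vec4 x y s t) = y. Proof. by rewrite /c1 mxE. Qed.
Lemma vec4_c2 x y s t : c2 (vec4 x y s t) = s. Proof. by rewrite /c2 mxE. Qed.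
Lemma vec4_c3 x y s t : c3 (vec4 x y s t) = t. Proof. by rewrite /c3 mxE. Qed.

Lemma coP z w : c0 z = c0 w -> c1 z = c1 w -> c2 z = c2 w -> c3 z = c3 w -> z = w.
Proof.
rewrite /c0 /c1 /c2 /c3 => e0 e1 e2 e3; apply/rowP => k; rewrite [z]lock [w]lock -!lock.
have [->|->] : k = 0 \/ k = 1.
  by case: k => -[|[|]] //= ?; [left|right]; apply/val_inj.
- by case: (z 0 0) (w 0 0) e0 e1 => ? ? [? ?] /= -> ->.
- by case: (z 0 1) (w 0 1) e2 e3 => ? ? [? ?] /= -> ->.
Qed.

Lemma c0D z w : c0 (z + w) = c0 z + c0 w. Proof. by rewrite /c0 mxE raddfD. Qed.
Lemma c1D z w : c1 (z + w) = c1 z + c1 w. Proof. by rewrite /c1 mxE raddfD. Qed.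
Lemma c2D z w : c2 (z + w) = c2 z + c2 w. Proof. by rewrite /c2 mxE raddfD. Qed.
Lemma c3D z w : c3 (z + w) = c3 z + c3 w. Proof. by rewrite /c3 mxE raddfD. Qed.
Lemma c0N z : c0 (- z) = - c0 z. Proof. by rewrite /c0 mxE raddfN. Qed.
Lemma c1N z : c1 (- z) = - c1 z. Proof. by rewrite /c1 mxE raddfN. Qed.
Lemma c2N z : c2 (- z) = - c2 z. Proof. by rewrite /c2 mxE raddfN. Qed.
Lemma c3N z : c3 (- z) = - c3 z. Proof. by rewrite /c3 mxE raddfN. Qed.
Lemma c0_0 : c0 0 = 0. Proof. by rewrite /c0 mxE. Qed.
Lemma c1_0 : c1 0 = 0. Proof. by rewrite /c1 mxE. Qed.
Lemma c2_0 : c2 0 = 0. Proof. by rewrite /c2 mxE. Qed.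
Lemma c3_0 : c3 0 = 0. Proof. by rewrite /c3 mxE. Qed.
Lemma c0Z t z : c0 (t%:C *: z) = t * c0 z.
Proof. by rewrite /c0 mxE; case: (z 0 0) => x y /=; rewrite mul0r subr0. Qed.
Lemma c1Z t z : c1 (t%:C *: z) = t * c1 z.
Proof. by rewrite /c1 mxE; case: (z 0 0) => x y /=; rewrite mul0r addr0. Qed.
Lemma c2Z t z : c2 (t%:C *: z) = t * c2 z.
Proof. by rewrite /c2 mxE; case: (z 0 1) => x y /=; rewrite mul0r subr0. Qed.
Lemma c3Z t z : c3 (t%:C *: z) = t * c3 z.
Proof. by rewrite /c3 mxE; case: (z 0 1) => x y /=; rewrite mul0r addr0. Qed.
Lemma c0i z : c0 ('i *: z) = - c1 z.
Proof. by rewrite /c0 /c1 mxE; case: (z 0 0) => x y /=; rewrite mul0r add0r mul1r. Qed.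
Lemma c1i z : c1 ('i *: z) = c0 z.
Proof. by rewrite /c0 /c1 mxE; case: (z 0 0) => x y /=; rewrite mul0r add0r mul1r. Qed.
Lemma c2i z : c2 ('i *: z) = - c3 z.
Proof. by rewrite /c2 /c3 mxE; case: (z 0 1) => x y /=; rewrite mul0r add0r mul1r. Qed.
Lemma c3i z : c3 ('i *: z) = c2 z.
Proof. by rewrite /c2 /c3 mxE; case: (z 0 1) => x y /=; rewrite mul0r add0r mul1r. Qed.

Definition coE := (vec4_c0, vec4_c1, vec4_c2, vec4_c3, c0D, c1D, c2D, c3D, c0N, c1N, c2N, c3N,
  c0_0, c1_0, c2_0, c3_0, c0Z, c1Z, c2Z, c3Z, c0i, c1i, c2i, c3i).

Lemma rcomb_c0 t s z w : c0 (rcomb t s z w) = t * c0 z + s * c0 w.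
Proof. by rewrite /rcomb c0D !c0Z. Qed.
Lemma rcomb_c1 t s z w : c1 (rcomb t s z w) = t * c1 z + s * c1 w.
Proof. by rewrite /rcomb c1D !c1Z. Qed.
Lemma rcomb_c2 t s z w : c2 (rcomb t s z w) = t * c2 z + s * c2 w.
Proof. by rewrite /rcomb c2D !c2Z. Qed.
Lemma rcomb_c3 t s z w : c3 (rcomb t s z w) = t * c3 z + s * c3 w.
Proof. by rewrite /rcomb c3D !c3Z. Qed.
Definition rcombE := (rcomb_c0, rcomb_c1, rcomb_c2, rcomb_c3).
Definition coiE := (@c0i, @c1i, @c2i, @c3i).

Lemma innerE z w : inner z w = c0 z * c0 w + c1 z * c1 w + c2 z * c2 w + c3 z * c3 w.
Proof.
rewrite /inner /herm !big_ord_recl big_ord0 addr0 /c0 /c1 /c2 /c3.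
have -> : lift (0 : 'I_2) ord0 = 1 by apply/val_inj.
case: (z 0 0) (w 0 0) (z 0 1) (w 0 1) => [x0 x1] [y0 y1] [x2 x3] [y2 y3] /=.
by rewrite !mulrN !opprK addrA.
Qed.

Lemma innerC z w : inner z w = inner w z.
Proof. by rewrite !innerE [c0 z * _]mulrC [c1 z * _]mulrC [c2 z * _]mulrC [c3 z * _]mulrC. Qed.
Lemma innerDl z w v : inner (z + w) v = inner z v + inner w v.
Proof. rewrite !innerE !coE; ring. Qed.
Lemma innerDr z w v : inner v (z + w) = inner v z + inner v w.
Proof. by rewrite innerC innerDl ![inner _ v]innerC. Qed.
Lemma innerNl z v : inner (- z) v = - inner z v.
Proof. rewrite !innerE !coE; ring. Qed.
Lemma innerNr z v : inner v (- z) = - inner v z.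
Proof. by rewrite innerC innerNl innerC. Qed.
Lemma innerZl t z v : inner (t%:C *: z) v = t * inner z v.
Proof. rewrite !innerE !coE; ring. Qed.
Lemma innerZr t z v : inner v (t%:C *: z) = t * inner v z.
Proof. by rewrite innerC innerZl innerC. Qed.
Lemma inner0l v : inner 0 v = 0.
Proof. rewrite !innerE !coE; ring. Qed.
Lemma inner0r v : inner v 0 = 0.
Proof. by rewrite innerC inner0l. Qed.
Lemma inneriN z w : inner z ('i *: w) = - inner ('i *: z) w.
Proof. rewrite !innerE !coE; ring. Qed.
Lemma innerii z w : inner ('i *: z) ('i *: w) = inner z w.
Proof. rewrite !innerE !coE; ring. Qed.
Lemma inneriz z : inner ('i *: z) z = 0.
Proof. rewrite !innerE !coE; ring. Qed.

Definition lin_inner := (innerDl, innerDr, innerNl, innerNr, innerZl, innerZr, inner0l, inner0r).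

Lemma inner_ge0 z : 0 <= inner z z.
Proof. by rewrite innerE -!expr2 !addr_ge0 // sqr_ge0. Qed.

Lemma inner_eq0 z : inner z z = 0 -> z = 0.
Proof.
rewrite innerE -!expr2 => e.
have h0 := sqr_ge0 (c0 z); have h1 := sqr_ge0 (c1 z).
have h2 := sqr_ge0 (c2 z); have h3 := sqr_ge0 (c3 z).
by apply: coP; rewrite coE; apply/eqP; rewrite -sqrf_eq0; apply/eqP; lra.
Qed.

Lemma inner_gt0 z : z != 0 -> 0 < inner z z.
Proof.
by move=> z0; rewrite lt_neqAle inner_ge0 andbT eq_sym; apply: contra z0 => /eqP /inner_eq0 ->.
Qed.

Lemma hermE z w : herm z w = inner z w +i* inner z ('i *: w).
Proof.
rewrite !innerE !coE /herm !big_ord_recl big_ord0 addr0 /c0 /c1 /c2 /c3.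
have -> : lift (0 : 'I_2) ord0 = 1 by apply/val_inj.
case: (z 0 0) (w 0 0) (z 0 1) (w 0 1) => [x0 x1] [y0 y1] [x2 x3] [y2 y3] /=.
by apply/eqP; rewrite eq_complex /=; apply/andP; split; apply/eqP; ring.
Qed.

Definition det3 (a1 a2 a3 b1 b2 b3 d1 d2 d3 : R) :=
  a1 * (b2 * d3 - b3 * d2) - a2 * (b1 * d3 - b3 * d1) + a3 * (b1 * d2 - b2 * d1).

(* [inner (cross a b c) w] is the determinant of the real 4-vectors a, b, c, w. *)
Definition cross a b c : 'rV[R[i]]_2 := vec4
  (- det3 (c1 a) (c2 a) (c3 a) (c1 b) (c2 b) (c3 b) (c1 c) (c2 c) (c3 c))
  (det3 (c0 a) (c2 a) (c3 a) (c0 b) (c2 b) (c3 b) (c0 c) (c2 c) (c3 c))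
  (- det3 (c0 a) (c1 a) (c3 a) (c0 b) (c1 b) (c3 b) (c0 c) (c1 c) (c3 c))
  (det3 (c0 a) (c1 a) (c2 a) (c0 b) (c1 b) (c2 b) (c0 c) (c1 c) (c2 c)).

Lemma cross_c0 a b c : c0 (cross a b c) =
  - det3 (c1 a) (c2 a) (c3 a) (c1 b) (c2 b) (c3 b) (c1 c) (c2 c) (c3 c).
Proof. exact: vec4_c0. Qed.
Lemma cross_c1 a b c : c1 (cross a b c) =
  det3 (c0 a) (c2 a) (c3 a) (c0 b) (c2 b) (c3 b) (c0 c) (c2 c) (c3 c).
Proof. exact: vec4_c1. Qed.
Lemma cross_c2 a b c : c2 (cross a b c) =
  - det3 (c0 a) (c1 a) (c3 a) (c0 b) (c1 b) (c3 b) (c0 c) (c1 c) (c3 c).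
Proof. exact: vec4_c2. Qed.
Lemma cross_c3 a b c : c3 (cross a b c) =
  det3 (c0 a) (c1 a) (c2 a) (c0 b) (c1 b) (c2 b) (c0 c) (c1 c) (c2 c).
Proof. exact: vec4_c3. Qed.
Definition crossE := (cross_c0, cross_c1, cross_c2, cross_c3).

Ltac cogen z := move: (c0 z) (c1 z) (c2 z) (c3 z).

Lemma cross1 a b c : inner (cross a b c) a = 0.
Proof. rewrite innerE !crossE /det3; cogen a; cogen b; cogen c => *; ring. Qed.
Lemma cross2 a b c : inner (cross a b c) b = 0.
Proof. rewrite innerE !crossE /det3; cogen a; cogen b; cogen c => *; ring. Qed.
Lemma cross3 a b c : inner (cross a b c) c = 0.
Proof. rewrite innerE !crossE /det3; cogen a; cogen b; cogen c => *; ring. Qed.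

Lemma cross_norm a b c : inner (cross a b c) (cross a b c) =
  det3 (inner a a) (inner a b) (inner a c) (inner a b) (inner b b) (inner b c)
       (inner a c) (inner b c) (inner c c).
Proof.
rewrite [in RHS]/det3 innerE !crossE !innerE /det3.
cogen a; cogen b; cogen c => *; ring.
Qed.

(** The cross product is alternating and multilinear. The lemma compares the orientation of a
    characteristic frame with that of the coordinate basis. *)
Lemma cross_comb x b c (p q r s : R) w :
  inner (cross x (rcomb p q b c) (rcomb r s b c)) w = (p * s - q * r) * inner (cross x b c) w.
Proof.
have := (rcomb_c0 p q b c, rcomb_c1 p q b c, rcomb_c2 p q b c, rcomb_c3 p q b c).
have := (rcomb_c0 r s b c, rcomb_c1 r s b c, rcomb_c2 r s b c, rcomb_c3 r s b c).
move: (rcomb p q b c) (rcomb r s b c) => B C CE BE.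
rewrite !innerE !crossE !BE !CE /det3.
cogen x; cogen b; cogen c; cogen w => *; ring.
Qed.

(** Under the hypotheses (x, e, ie, ix) is a real orthonormal basis of determinant +1. The part of
    the third vector along ix drops out by alternation, which leaves the coefficient of ie: in the
    application, the sine of the contact angle. *)
Lemma cross_contact x e (s t : R) : inner x x = 1 -> inner e e = 1 -> inner x e = 0 ->
  inner ('i *: x) e = 0 ->
  inner (cross x e (rcomb s t ('i *: e) ('i *: x))) ('i *: x) = s.
Proof.
move=> xx ee xe ixe.
have -> : inner (cross x e (rcomb s t ('i *: e) ('i *: x))) ('i *: x) =
  s * (inner x x * inner e e - inner x e ^+ 2 - inner ('i *: x) e ^+ 2).
  rewrite !innerE !crossE !rcombE !coiE /det3.
  cogen x; cogen e => *; ring.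
by rewrite xx ee xe ixe !expr0n /=; ring.
Qed.

End Coordinates.

(** * Calculus of vector-valued functions and the unit normal field *)

Section VectorFields.
Context {R : realType}.
Implicit Types (U : set (R * R)) (X Y Z N : R * R -> 'rV[R[i]]_2) (q : R * R).

Definition Vk k U X : Prop :=
  [/\ Ck_on k U (fun q => c0 (X q)), Ck_on k U (fun q => c1 (X q)),
      Ck_on k U (fun q => c2 (X q)) & Ck_on k U (fun q => c3 (X q))].

Lemma smooth_Vk k U X : smooth_map_on U X -> Vk k U X.
Proof.
move=> sX; split; [exact: ((sX 0).1 k)|exact: ((sX 0).2 k)|exact: ((sX 1).1 k)|exact: ((sX 1).2 k)].
Qed.

Lemma VkW k U X : open U -> Vk k.+1 U X -> Vk k U X.
Proof.
move=> oU [x0 x1 x2 x3].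
split; [exact: (Ck_onW oU x0)|exact: (Ck_onW oU x1)|exact: (Ck_onW oU x2)|exact: (Ck_onW oU x3)].
Qed.

Lemma Du_c0 X q : c0 (Du X q) = du (fun q => c0 (X q)) q. Proof. by rewrite /c0 /Du mxE. Qed.
Lemma Du_c1 X q : c1 (Du X q) = du (fun q => c1 (X q)) q. Proof. by rewrite /c1 /Du mxE. Qed.
Lemma Du_c2 X q : c2 (Du X q) = du (fun q => c2 (X q)) q. Proof. by rewrite /c2 /Du mxE. Qed.
Lemma Du_c3 X q : c3 (Du X q) = du (fun q => c3 (X q)) q. Proof. by rewrite /c3 /Du mxE. Qed.
Lemma Dv_c0 X q : c0 (Dv X q) = dv (fun q => c0 (X q)) q. Proof. by rewrite /c0 /Dv mxE. Qed.
Lemma Dv_c1 X q : c1 (Dv X q) = dv (fun q => c1 (X q)) q. Proof. by rewrite /c1 /Dv mxE. Qed.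
Lemma Dv_c2 X q : c2 (Dv X q) = dv (fun q => c2 (X q)) q. Proof. by rewrite /c2 /Dv mxE. Qed.
Lemma Dv_c3 X q : c3 (Dv X q) = dv (fun q => c3 (X q)) q. Proof. by rewrite /c3 /Dv mxE. Qed.

Lemma funDu_c0 X : (fun q => c0 (Du X q)) = du (fun q => c0 (X q)).
Proof. by apply/funext => q; exact: Du_c0. Qed.
Lemma funDu_c1 X : (fun q => c1 (Du X q)) = du (fun q => c1 (X q)).
Proof. by apply/funext => q; exact: Du_c1. Qed.
Lemma funDu_c2 X : (fun q => c2 (Du X q)) = du (fun q => c2 (X q)).
Proof. by apply/funext => q; exact: Du_c2. Qed.
Lemma funDu_c3 X : (fun q => c3 (Du X q)) = du (fun q => c3 (X q)).
Proof. by apply/funext => q; exact: Du_c3. Qed.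
Lemma funDv_c0 X : (fun q => c0 (Dv X q)) = dv (fun q => c0 (X q)).
Proof. by apply/funext => q; exact: Dv_c0. Qed.
Lemma funDv_c1 X : (fun q => c1 (Dv X q)) = dv (fun q => c1 (X q)).
Proof. by apply/funext => q; exact: Dv_c1. Qed.
Lemma funDv_c2 X : (fun q => c2 (Dv X q)) = dv (fun q => c2 (X q)).
Proof. by apply/funext => q; exact: Dv_c2. Qed.
Lemma funDv_c3 X : (fun q => c3 (Dv X q)) = dv (fun q => c3 (X q)).
Proof. by apply/funext => q; exact: Dv_c3. Qed.

Lemma Vk_Du k U X : Vk k.+1 U X -> Vk k U (Du X).
Proof.
move=> [[_ x0 _] [_ x1 _] [_ x2 _] [_ x3 _]].
by split; [rewrite funDu_c0|rewrite funDu_c1|rewrite funDu_c2|rewrite funDu_c3].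
Qed.

Lemma Vk_Dv k U X : Vk k.+1 U X -> Vk k U (Dv X).
Proof.
move=> [[_ _ x0] [_ _ x1] [_ _ x2] [_ _ x3]].
by split; [rewrite funDv_c0|rewrite funDv_c1|rewrite funDv_c2|rewrite funDv_c3].
Qed.

Lemma DuDv_comm U X q : open U -> Vk 2 U X -> U q -> Du (Dv X) q = Dv (Du X) q.
Proof.
move=> oU [x0 x1 x2 x3] Uq; apply: coP.
- exact: (etrans (etrans (Du_c0 (Dv X) q) (congr1 (fun h => du h q) (funDv_c0 X)))
    (etrans (Schwarz oU x0 Uq) (esym (etrans (Dv_c0 (Du X) q) (congr1 (fun h => dv h q) (funDu_c0 X)))))).
- exact: (etrans (etrans (Du_c1 (Dv X) q) (congr1 (fun h => du h q) (funDv_c1 X)))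
    (etrans (Schwarz oU x1 Uq) (esym (etrans (Dv_c1 (Du X) q) (congr1 (fun h => dv h q) (funDu_c1 X)))))).
- exact: (etrans (etrans (Du_c2 (Dv X) q) (congr1 (fun h => du h q) (funDv_c2 X)))
    (etrans (Schwarz oU x2 Uq) (esym (etrans (Dv_c2 (Du X) q) (congr1 (fun h => dv h q) (funDu_c2 X)))))).
- exact: (etrans (etrans (Du_c3 (Dv X) q) (congr1 (fun h => du h q) (funDv_c3 X)))
    (etrans (Schwarz oU x3 Uq) (esym (etrans (Dv_c3 (Du X) q) (congr1 (fun h => dv h q) (funDu_c3 X)))))).
Qed.

Lemma Ck_inner k U X Y : open U -> Vk k U X -> Vk k U Y ->
  Ck_on k U (fun q => inner (X q) (Y q)).
Proof.
move=> oU [x0 x1 x2 x3] [y0 y1 y2 y3].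
have H := Ck_on_add oU (Ck_on_add oU (Ck_on_add oU (Ck_on_mul oU x0 y0) (Ck_on_mul oU x1 y1))
  (Ck_on_mul oU x2 y2)) (Ck_on_mul oU x3 y3).
by apply: (Ck_on_ext oU _ H) => q _; rewrite innerE.
Qed.

Lemma has_grad_eq (f : R * R -> R) q (a b a' b' : R) :
  has_grad f q a b -> a = a' -> b = b' -> has_grad f q a' b'.
Proof. by move=> + <- <-. Qed.

Lemma has_grad_c0 U X q : open U -> Ck_on 1 U (fun q => c0 (X q)) -> U q ->
  has_grad (fun q => c0 (X q)) q (c0 (Du X q)) (c0 (Dv X q)).
Proof.
move=> oU xC Uq; have [d1 d2 _ _] := has_grad_C1 oU xC Uq.
by split; [exact: d1|exact: d2|exact: (esym (Du_c0 X q))|exact: (esym (Dv_c0 X q))].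
Qed.

Lemma has_grad_c1 U X q : open U -> Ck_on 1 U (fun q => c1 (X q)) -> U q ->
  has_grad (fun q => c1 (X q)) q (c1 (Du X q)) (c1 (Dv X q)).
Proof.
move=> oU xC Uq; have [d1 d2 _ _] := has_grad_C1 oU xC Uq.
by split; [exact: d1|exact: d2|exact: (esym (Du_c1 X q))|exact: (esym (Dv_c1 X q))].
Qed.

Lemma has_grad_c2 U X q : open U -> Ck_on 1 U (fun q => c2 (X q)) -> U q ->
  has_grad (fun q => c2 (X q)) q (c2 (Du X q)) (c2 (Dv X q)).
Proof.
move=> oU xC Uq; have [d1 d2 _ _] := has_grad_C1 oU xC Uq.
by split; [exact: d1|exact: d2|exact: (esym (Du_c2 X q))|exact: (esym (Dv_c2 X q))].
Qed.

Lemma has_grad_c3 U X q : open U -> Ck_on 1 U (fun q => c3 (X q)) -> U q ->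
  has_grad (fun q => c3 (X q)) q (c3 (Du X q)) (c3 (Dv X q)).
Proof.
move=> oU xC Uq; have [d1 d2 _ _] := has_grad_C1 oU xC Uq.
by split; [exact: d1|exact: d2|exact: (esym (Du_c3 X q))|exact: (esym (Dv_c3 X q))].
Qed.

Lemma inner_leibniz (A A' B B' : 'rV[R[i]]_2) :
  c0 A' * c0 B + c0 A * c0 B' + (c1 A' * c1 B + c1 A * c1 B') +
  (c2 A' * c2 B + c2 A * c2 B') + (c3 A' * c3 B + c3 A * c3 B') =
  inner A' B + inner A B'.
Proof. rewrite !innerE; ring. Qed.

Lemma has_grad_inner U X Y q : open U -> Vk 1 U X -> Vk 1 U Y -> U q ->
  has_grad (fun q => inner (X q) (Y q)) q
   (inner (Du X q) (Y q) + inner (X q) (Du Y q)) (inner (Dv X q) (Y q) + inner (X q) (Dv Y q)).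
Proof.
move=> oU [x0 x1 x2 x3] [y0 y1 y2 y3] Uq.
have H := has_gradD (has_gradD (has_gradD
  (has_gradM (has_grad_c0 oU x0 Uq) (has_grad_c0 oU y0 Uq))
  (has_gradM (has_grad_c1 oU x1 Uq) (has_grad_c1 oU y1 Uq)))
  (has_gradM (has_grad_c2 oU x2 Uq) (has_grad_c2 oU y2 Uq)))
  (has_gradM (has_grad_c3 oU x3 Uq) (has_grad_c3 oU y3 Uq)).
have E x : U x -> c0 (X x) * c0 (Y x) + c1 (X x) * c1 (Y x) + c2 (X x) * c2 (Y x) +
   c3 (X x) * c3 (Y x) = inner (X x) (Y x) by rewrite innerE.
apply: (has_grad_ext oU Uq E); apply: (has_grad_eq H); exact: inner_leibniz.
Qed.

Lemma Vk_cst k U (w : 'rV[R[i]]_2) : Vk k U (fun=> w).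
Proof. by split; exact: Ck_on_cst. Qed.

Lemma Du_cst (w : 'rV[R[i]]_2) q : Du (fun=> w) q = 0.
Proof.
by apply: coP; rewrite coE; [rewrite Du_c0|rewrite Du_c1|rewrite Du_c2|rewrite Du_c3];
  exact: du_cst.
Qed.

Lemma Dv_cst (w : 'rV[R[i]]_2) q : Dv (fun=> w) q = 0.
Proof.
by apply: coP; rewrite coE; [rewrite Dv_c0|rewrite Dv_c1|rewrite Dv_c2|rewrite Dv_c3];
  exact: dv_cst.
Qed.

Lemma Vk_i k U X : open U -> Vk k U X -> Vk k U (fun q => 'i *: X q).
Proof.
move=> oU [x0 x1 x2 x3]; split.
- by apply: (Ck_on_ext oU _ (Ck_on_opp oU x1)) => q _; rewrite c0i.
- by apply: (Ck_on_ext oU _ x0) => q _; rewrite c1i.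
- by apply: (Ck_on_ext oU _ (Ck_on_opp oU x3)) => q _; rewrite c2i.
- by apply: (Ck_on_ext oU _ x2) => q _; rewrite c3i.
Qed.

Lemma duN (f : R * R -> R) q : derivable f q (1, 0) -> du (fun x => - f x) q = - du f q.
Proof. by move=> df; rewrite /du; exact: (@deriveN _ _ R^o _ _ _ df). Qed.

Lemma dvN (f : R * R -> R) q : derivable f q (0, 1) -> dv (fun x => - f x) q = - dv f q.
Proof. by move=> df; rewrite /dv; exact: (@deriveN _ _ R^o _ _ _ df). Qed.

Lemma D_i U X q : open U -> Vk 1 U X -> U q ->
  Du (fun q => 'i *: X q) q = 'i *: Du X q /\ Dv (fun q => 'i *: X q) q = 'i *: Dv X q.
Proof.
move=> oU [x0 x1 x2 x3] Uq.
have f0 : (fun q => c0 ('i *: X q)) = (fun q => - c1 (X q)) by apply/funext => x; rewrite c0i.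
have f1 : (fun q => c1 ('i *: X q)) = (fun q => c0 (X q)) by apply/funext => x; rewrite c1i.
have f2 : (fun q => c2 ('i *: X q)) = (fun q => - c3 (X q)) by apply/funext => x; rewrite c2i.
have f3 : (fun q => c3 ('i *: X q)) = (fun q => c2 (X q)) by apply/funext => x; rewrite c3i.
have [d1 d1' _ _] := has_grad_c1 oU x1 Uq; have [d3 d3' _ _] := has_grad_c3 oU x3 Uq.
split; apply: coP.
- by rewrite c0i Du_c0 Du_c1 f0; exact: duN.
- by rewrite c1i Du_c1 Du_c0 f1.
- by rewrite c2i Du_c2 Du_c3 f2; exact: duN.
- by rewrite c3i Du_c3 Du_c2 f3.
- by rewrite c0i Dv_c0 Dv_c1 f0; exact: dvN.
- by rewrite c1i Dv_c1 Dv_c0 f1.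
- by rewrite c2i Dv_c2 Dv_c3 f2; exact: dvN.
- by rewrite c3i Dv_c3 Dv_c2 f3.
Qed.

Lemma Vk_scale k U (r : R * R -> R) X : open U -> Ck_on k U r -> Vk k U X ->
  Vk k U (fun q => (r q)%:C *: X q).
Proof.
move=> oU rC [x0 x1 x2 x3]; split.
- by apply: (Ck_on_ext oU _ (Ck_on_mul oU rC x0)) => q _; rewrite c0Z.
- by apply: (Ck_on_ext oU _ (Ck_on_mul oU rC x1)) => q _; rewrite c1Z.
- by apply: (Ck_on_ext oU _ (Ck_on_mul oU rC x2)) => q _; rewrite c2Z.
- by apply: (Ck_on_ext oU _ (Ck_on_mul oU rC x3)) => q _; rewrite c3Z.
Qed.

Lemma Ck_det3 k U (a1 a2 a3 b1 b2 b3 d1 d2 d3 : R * R -> R) : open U ->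
  Ck_on k U a1 -> Ck_on k U a2 -> Ck_on k U a3 -> Ck_on k U b1 -> Ck_on k U b2 ->
  Ck_on k U b3 -> Ck_on k U d1 -> Ck_on k U d2 -> Ck_on k U d3 ->
  Ck_on k U (fun q => det3 (a1 q) (a2 q) (a3 q) (b1 q) (b2 q) (b3 q) (d1 q) (d2 q) (d3 q)).
Proof.
move=> oU A1 A2 A3 B1 B2 B3 D1 D2 D3.
have m f g h l (F : Ck_on k U f) (G : Ck_on k U g) (H : Ck_on k U h) (L : Ck_on k U l) :=
  Ck_on_add oU (Ck_on_mul oU F G) (Ck_on_opp oU (Ck_on_mul oU H L)).
exact: (Ck_on_add oU (Ck_on_add oU (Ck_on_mul oU A1 (m _ _ _ _ B2 D3 B3 D2))
   (Ck_on_opp oU (Ck_on_mul oU A2 (m _ _ _ _ B1 D3 B3 D1))))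
   (Ck_on_mul oU A3 (m _ _ _ _ B1 D2 B2 D1))).
Qed.

Lemma Vk_cross k U X Y Z : open U -> Vk k U X -> Vk k U Y -> Vk k U Z ->
  Vk k U (fun q => cross (X q) (Y q) (Z q)).
Proof.
move=> oU [x0 x1 x2 x3] [y0 y1 y2 y3] [z0 z1 z2 z3]; split.
- apply: (Ck_on_ext oU _ (Ck_on_opp oU (Ck_det3 oU x1 x2 x3 y1 y2 y3 z1 z2 z3))) => q _.
  by rewrite cross_c0.
- apply: (Ck_on_ext oU _ (Ck_det3 oU x0 x2 x3 y0 y2 y3 z0 z2 z3)) => q _.
  by rewrite cross_c1.
- apply: (Ck_on_ext oU _ (Ck_on_opp oU (Ck_det3 oU x0 x1 x3 y0 y1 y3 z0 z1 z3))) => q _.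
  by rewrite cross_c2.
- apply: (Ck_on_ext oU _ (Ck_det3 oU x0 x1 x2 y0 y1 y2 z0 z1 z2)) => q _.
  by rewrite cross_c3.
Qed.

Definition independent (x y : 'rV[R[i]]_2) : Prop :=
  forall a b : R, rcomb a b x y = 0 -> a = 0 /\ b = 0.

(** By independence -<x, y> x + <x, x> y is nonzero, and its squared norm is <x, x> times the Gram
    determinant. *)
Lemma gram_gt0 (x y : 'rV[R[i]]_2) : independent x y ->
  0 < inner x x /\ 0 < inner x x * inner y y - inner x y ^+ 2.
Proof.
move=> ind.
have x0 : 0 < inner x x.
  apply: inner_gt0; apply/eqP => x0; have [|/eqP] := ind 1 0.
    by rewrite x0; apply: coP; rewrite !rcombE !coE; ring.
  by rewrite oner_eq0.
split => //.
have w0 : 0 < inner (rcomb (- inner x y) (inner x x) x y) (rcomb (- inner x y) (inner x x) x y).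
  apply: inner_gt0; apply/eqP => /ind [_ /eqP]; by rewrite gt_eqF.
rewrite -(pmulr_rgt0 _ x0); suff <- : inner (rcomb (- inner x y) (inner x x) x y) (rcomb (- inner x y) (inner x x) x y) = inner x x * (inner x x * inner y y - inner x y ^+ 2) by [].
rewrite /rcomb !lin_inner [inner y x]innerC.
move: (inner x x) (inner x y) (inner y y) => a b c; ring.
Qed.

Lemma det3_diag (a b c : R) : a * c - b ^+ 2 = det3 1 0 0 0 a b 0 b c.
Proof. by rewrite /det3; ring. Qed.

Lemma cross_gt0 (x y z : 'rV[R[i]]_2) : inner x x = 1 -> inner x y = 0 -> inner x z = 0 ->
  0 < inner y y * inner z z - inner y z ^+ 2 -> 0 < inner (cross x y z) (cross x y z).
Proof. by move=> x1 xy xz; rewrite cross_norm x1 xy xz -det3_diag. Qed.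

(** The normalised cross product, multiplied by [tau]. The last clause remembers on which side of
    the oriented chart the normal lies; this is what later determines the sign of <iX, N>. *)
Lemma unit_normal_field U X (tau : R) : open U -> smooth_map_on U X -> tau ^+ 2 = 1 ->
  (forall q, U q -> inner (X q) (X q) = 1) ->
  (forall q, U q -> inner (X q) (Du X q) = 0 /\ inner (X q) (Dv X q) = 0) ->
  (forall q, U q -> independent (Du X q) (Dv X q)) ->
  exists N : R * R -> 'rV[R[i]]_2, [/\ Vk 2 U N,
    forall q, U q -> [/\ inner (N q) (X q) = 0, inner (N q) (Du X q) = 0,
      inner (N q) (Dv X q) = 0 & inner (N q) (N q) = 1] &
    forall q, U q -> exists2 r : R, 0 < r & forall w, inner (N q) w =
      tau * (r * inner (cross (X q) (Du X q) (Dv X q)) w)].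
Proof.
move=> oU sX tau2 X1 XD ind.
pose n q := cross (X q) (Du X q) (Dv X q).
have nC : Vk 2 U n.
  exact: (Vk_cross oU (smooth_Vk 2 sX) (Vk_Du (smooth_Vk 3 sX)) (Vk_Dv (smooth_Vk 3 sX))).
have nn q : U q -> 0 < inner (n q) (n q).
  move=> Uq; have [_ G] := gram_gt0 (ind q Uq); have [xu xv] := XD q Uq.
  move: (X1 q Uq) G xu xv; rewrite /n; move: (X q) (Du X q) (Dv X q) => x y z x1 G xy xz.
  rewrite cross_norm x1 xy xz /det3; apply: lt_le_trans G _.
  by move: (inner y y) (inner y z) (inner z z) => a b c; rewrite le_eqVlt; apply/orP; left; apply/eqP; ring.
pose r q := (Num.sqrt (inner (n q) (n q)))^-1.
have rC : Ck_on 2 U r := Ck_on_rsqrt oU nn (Ck_inner oU nC nC).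
have r0 q : U q -> 0 < r q by move=> Uq; rewrite /r invr_gt0 sqrtr_gt0 nn.
have r2 q : U q -> r q ^+ 2 * inner (n q) (n q) = 1.
  move=> Uq; rewrite /r exprVn sqr_sqrtr ?ltW ?nn // mulVf // gt_eqF // nn //.
exists (fun q => (tau * r q)%:C *: n q); split.
- exact: (Vk_scale oU (Ck_on_mul oU (Ck_on_cst 2 U tau) rC) nC).
- move=> q Uq; have := r2 q Uq; rewrite /n; move: (X q) (Du X q) (Dv X q) (r q) => x y z s s2.
  rewrite !innerZl innerZr cross1 cross2 cross3 !mulr0; split => //.
  by rewrite mulrA -expr2 exprMn tau2 mul1r.
- by move=> q Uq; exists (r q); [exact: r0|move=> w; rewrite innerZl mulrA].
Qed.

End VectorFields.

(** * The Jacobi equation as linear algebra at one point *)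

Section Pointwise.
Context {R : realType}.
Implicit Types x y z n w : 'rV[R[i]]_2.

(* Binet-Cauchy: the product of the determinants of (x, y, z, w) and (x, y, z, n),
   expanded along the row of w. *)
Lemma cross_cross x y z w n :
  inner (cross x y z) w * inner (cross x y z) n =
  inner w n * inner (cross x y z) (cross x y z)
  - inner w z * det3 (inner x x) (inner x y) (inner x n) (inner y x) (inner y y) (inner y n)
                     (inner z x) (inner z y) (inner z n)
  + inner w y * det3 (inner x x) (inner x z) (inner x n) (inner y x) (inner y z) (inner y n)
                     (inner z x) (inner z z) (inner z n)
  - inner w x * det3 (inner x y) (inner x z) (inner x n) (inner y y) (inner y z) (inner y n)
                     (inner z y) (inner z z) (inner z n).
Proof.
rewrite !innerE !crossE /det3.
move: (c0 x) (c1 x) (c2 x) (c3 x) (c0 y) (c1 y) (c2 y) (c3 y) (c0 z) (c1 z) (c2 z) (c3 z)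
  (c0 w) (c1 w) (c2 w) (c3 w) (c0 n) (c1 n) (c2 n) (c3 n) => *; ring.
Qed.

(** By [cross_cross] the cross product is not orthogonal to [n], and then it is orthogonal to [w]; a
    third use with [n] replaced by [w] gives |w|^2 |cross|^2 = 0. Vector identities are proved with
    this lemma by testing them against the position, the two tangent vectors and the normal. *)
Lemma orth_basis_eq0 x y z n w : 0 < inner (cross x y z) (cross x y z) ->
  inner n n = 1 -> inner n x = 0 -> inner n y = 0 -> inner n z = 0 ->
  inner w x = 0 -> inner w y = 0 -> inner w z = 0 -> inner w n = 0 -> w = 0.
Proof.
move=> D0 nn nx ny nz wx wy wz wn.
have := cross_cross x y z n n; rewrite nn nx ny nz !mul0r !subr0 addr0 mul1r => cn.
have := cross_cross x y z w n; rewrite wn wx wy wz !mul0r !subr0 addr0 => /eqP.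
have cn0 : inner (cross x y z) n != 0.
  by apply/eqP => e; move: D0; rewrite -cn e mulr0 ltxx.
rewrite mulf_eq0 (negPf cn0) orbF => /eqP cw.
have := cross_cross x y z w w; rewrite cw mulr0 wx wy wz !mul0r !subr0 addr0 => /esym /eqP.
by rewrite mulf_eq0 (gt_eqF D0) orbF => /eqP /inner_eq0.
Qed.

(** The component along X_u of the Laplacian of N vanishes: the divergence of a Codazzi tensor is
    the gradient of its trace, which is 0. In the letters, N_u = a X_u + b X_v and N_v = c X_u + d
    X_v; [uuv] stands for <X_u, X_uv> and so on; A1, A2, A3 are the products of N_uu, N_uv, N_vv
    with X_u, and B2 is <N_uv, X_v>. The third premise is the u-derivative of the minimality
    equation. *)
Lemma codazzi_alg (E F G uuu uuv uvv vuu vuv vvv a b c d p q A1 A2 A3 B2 : R) :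
  a * F + b * G = c * E + d * F -> a + d = 0 ->
  2 * uuu * (c * F + d * G) + E * (B2 + (c * uuv + d * vuv))
    - 2 * ((vuu + uuv) * (c * E + d * F) + F * (A2 + (c * uuu + d * vuu)))
    + 2 * vuv * (a * E + b * F) + G * (A1 + (a * uuu + b * vuu)) = 0 ->
  B2 + (a * uvv + b * vvv) = A3 + (c * uuv + d * vuv) ->
  p * E + q * F = G * uuu - 2 * F * uuv + E * uvv ->
  p * F + q * G = G * vuu - 2 * F * vuv + E * vvv ->
  G * A1 - 2 * F * A2 + E * A3 = p * (a * E + b * F) + q * (c * E + d * F).
Proof.
move=> sym tr th cod pe qe.
have -> : A3 = B2 + (a * uvv + b * vvv) - (c * uuv + d * vuv) by rewrite cod; ring.
have -> : d = - a by apply/eqP; rewrite -addr_eq0 addrC tr.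
have dE : d = - a by apply/eqP; rewrite -addr_eq0 addrC tr.
rewrite dE in sym th; have {}sym : b * G = c * E - 2 * a * F by lra.
apply/eqP; rewrite -subr_eq0; apply/eqP.
have -> : p * (a * E + b * F) + q * (c * E + - a * F) =
  a * (p * E + q * F) + b * (p * F + q * G) + q * (c * E - 2 * a * F - b * G) by ring.
rewrite pe qe sym subrr mulr0 addr0 -[RHS]th; apply/eqP; rewrite -subr_eq0; apply/eqP.
transitivity (2 * vuu * (c * E - 2 * a * F - b * G)); first by ring.
by rewrite sym subrr mulr0.
Qed.

(** The letters t1 to t10 are, alternately, derivatives of X paired with N through i and X paired
    through i with the same derivatives of N; t11 is <iX, N> and [om] is <iX_u, X_v>. The products
    of first derivatives contribute only multiples of [om], which cancel because the shape operator
    is symmetric. *)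
Lemma jacobi_combine (E F G p q k om a b c d t1 t2 t3 t4 t5 t6 t7 t8 t9 t10 t11 : R) :
  G * t2 + -2 * F * t4 + (E * t6 + - p * t8) + (- q * t10 + k * t11) = 0 ->
  G * - t1 + -2 * F * - t3 + (E * - t5 + - p * - t7) +
    (- q * - t9 + 2 * (E * G - F ^+ 2) * - t11) = 0 ->
  a * F + b * G = c * E + d * F ->
  G * (t1 + b * om + (b * om + t2)) + 2 * - F * (t3 + d * om + (- (a * om) + t4))
  + E * (t5 + - (c * om) + (- (c * om) + t6)) + - p * (t7 + t8) + - q * (t9 + t10)
  = - ((2 * (E * G - F ^+ 2) + k) * t11).
Proof.
move=> e1 e2 sE.
have sE' : om * (a * F + b * G - (c * E + d * F)) = 0 by rewrite sE subrr mulr0.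
lra.
Qed.

Section JacobiAtPoint.
(** The second-order jets of the surface and of its normal at a point. [th] is minimality, [thu] and
    [thv] are its derivatives; [codu] and [codv] are the derivatives of [sym], which together with
    the equality of mixed derivatives carry the Codazzi equations; [p] and [q] are the components of
    the tangential part of G xuu - 2F xuv + E xvv. *)
Variables x xu xv xuu xuv xvv n nu nv nuu nuv nvv : 'rV[R[i]]_2.
Variables E F G p q : R.
Hypothesis W0 : 0 < E * G - F ^+ 2.
Hypotheses (EE : inner xu xu = E) (FF : inner xu xv = F) (GG : inner xv xv = G).
Hypotheses (xx : inner x x = 1) (xxu : inner x xu = 0) (xxv : inner x xv = 0).
Hypotheses (nx : inner n x = 0) (nxu : inner n xu = 0) (nxv : inner n xv = 0) (nn : inner n n = 1).
Hypotheses (uux : inner xuu x = - E) (uvx : inner xuv x = - F) (vvx : inner xvv x = - G).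
Hypotheses (nux : inner nu x = 0) (nvx : inner nv x = 0) (nun : inner nu n = 0) (nvn : inner nv n = 0).
Hypotheses (nuux : inner nuu x = - inner nu xu) (nuvx : inner nuv x = - inner nv xu)
  (nvvx : inner nvv x = - inner nv xv).
Hypotheses (nuun : inner nuu n = - inner nu nu) (nuvn : inner nuv n = - inner nu nv)
  (nvvn : inner nvv n = - inner nv nv).
Hypotheses (lE : inner xuu n = - inner nu xu) (mE : inner xuv n = - inner nv xu)
  (nE : inner xvv n = - inner nv xv).
Hypothesis sym : inner nu xv = inner nv xu.
Hypothesis th : E * inner nv xv - 2 * F * inner nv xu + G * inner nu xu = 0.
Hypothesis thu : 2 * inner xu xuu * inner nv xv + E * (inner nuv xv + inner nv xuv)
   - 2 * ((inner xv xuu + inner xu xuv) * inner nv xu + F * (inner nuv xu + inner nv xuu))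
   + 2 * inner xv xuv * inner nu xu + G * (inner nuu xu + inner nu xuu) = 0.
Hypothesis thv : 2 * inner xu xuv * inner nv xv + E * (inner nvv xv + inner nv xvv)
   - 2 * ((inner xv xuv + inner xu xvv) * inner nu xv + F * (inner nuv xv + inner nu xvv))
   + 2 * inner xv xvv * inner nu xu + G * (inner nuv xu + inner nu xuv) = 0.
Hypothesis codu : inner nuu xv + inner nu xuv = inner nuv xu + inner nv xuu.
Hypothesis codv : inner nuv xv + inner nu xvv = inner nvv xu + inner nv xuv.
Hypothesis pE : p * E + q * F = G * inner xu xuu - 2 * F * inner xu xuv + E * inner xu xvv.
Hypothesis qE : p * F + q * G = G * inner xv xuu - 2 * F * inner xv xuv + E * inner xv xvv.

Let D0 : 0 < inner (cross x xu xv) (cross x xu xv).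
Proof.
rewrite cross_norm xx xxu xxv EE FF GG /det3.
by have -> : 1 * (E * G - F * F) - 0 * (0 * G - F * 0) + 0 * (0 * F - E * 0) = E * G - F ^+ 2 by ring.
Qed.

Let orth0 w : inner w x = 0 -> inner w xu = 0 -> inner w xv = 0 -> inner w n = 0 -> w = 0.
Proof. exact: orth_basis_eq0. Qed.

Let xun : inner xu n = 0. Proof. by rewrite innerC. Qed.
Let xvn : inner xv n = 0. Proof. by rewrite innerC. Qed.
Let xux : inner xu x = 0. Proof. by rewrite innerC. Qed.
Let xvx : inner xv x = 0. Proof. by rewrite innerC. Qed.
Let xvu : inner xv xu = F. Proof. by rewrite innerC. Qed.
Let Wn0 : E * G - F ^+ 2 != 0. Proof. by rewrite gt_eqF. Qed.

(** Minimality in the form Delta x = -2 x, multiplied by EG - F^2: the choice of [p] and [q] removes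
    the tangential part, and [th] the normal part. *)
Let lap_x : rcomb G (- 2 * F) xuu xuv + rcomb E (- p) xvv xu + rcomb (- q) (2 * (E * G - F ^+ 2)) xv x = 0.
Proof.
apply: orth0; rewrite /rcomb !lin_inner.
- rewrite uux uvx vvx xux xvx xx; ring.
- rewrite xxu EE xvu (innerC xuu) (innerC xuv) (innerC xvv).
  have -> : G * inner xu xuu + -2 * F * inner xu xuv + (E * inner xu xvv + - p * E) +
   (- q * F + 2 * (E * G - F ^+ 2) * 0) = G * inner xu xuu - 2 * F * inner xu xuv + E * inner xu xvv
     - (p * E + q * F) by ring.
  by rewrite pE subrr.
- rewrite xxv FF GG (innerC xuu) (innerC xuv) (innerC xvv).
  have -> : G * inner xv xuu + -2 * F * inner xv xuv + (E * inner xv xvv + - p * F) +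
   (- q * G + 2 * (E * G - F ^+ 2) * 0) = G * inner xv xuu - 2 * F * inner xv xuv + E * inner xv xvv
     - (p * F + q * G) by ring.
  by rewrite qE subrr.
- rewrite lE mE nE xun xvn (innerC x) nx -[RHS]oppr0 -[in RHS]th; ring.
Qed.

Let shape (w : 'rV[R[i]]_2) (s t : R) : inner w x = 0 -> inner w n = 0 -> inner w xu = s -> inner w xv = t ->
  w = rcomb ((s * G - t * F) / (E * G - F ^+ 2)) ((t * E - s * F) / (E * G - F ^+ 2)) xu xv.
Proof.
move=> wx wn ws wt; apply/eqP; rewrite -subr_eq0; apply/eqP.
apply: orth0; rewrite /rcomb !lin_inner.
- by rewrite wx xux xvx !mulr0 addr0 subrr.
- by rewrite ws EE xvu; field.
- by rewrite wt FF GG; field.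
- by rewrite wn xun xvn !mulr0 addr0 subrr.
Qed.

Let a := (inner nu xu * G - inner nu xv * F) / (E * G - F ^+ 2).
Let b := (inner nu xv * E - inner nu xu * F) / (E * G - F ^+ 2).
Let c := (inner nv xu * G - inner nv xv * F) / (E * G - F ^+ 2).
Let d := (inner nv xv * E - inner nv xu * F) / (E * G - F ^+ 2).
Let nuE : nu = rcomb a b xu xv. Proof. exact: shape. Qed.
Let nvE : nv = rcomb c d xu xv. Proof. exact: shape. Qed.

Let nu_in w : inner nu w = a * inner xu w + b * inner xv w.
Proof. by rewrite {1}nuE /rcomb !lin_inner. Qed.
Let nv_in w : inner nv w = c * inner xu w + d * inner xv w.
Proof. by rewrite {1}nvE /rcomb !lin_inner. Qed.

Let symE : a * F + b * G = c * E + d * F.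
Proof. by have := sym; rewrite nu_in nv_in FF GG EE xvu. Qed.

Let trE : a + d = 0.
Proof.
apply: (mulIf Wn0); rewrite mul0r /a /d mulrDl !divfK // sym -[RHS]th; ring.
Qed.

(** Delta n = -|A|^2 n, multiplied by EG - F^2, since [k] is |A|^2 (EG - F^2). The second tangential
    component comes from [codazzi_alg] with the roles of u and v exchanged. *)
Let lap_n (k : R) : k = G * inner nu nu - 2 * F * inner nu nv + E * inner nv nv ->
  rcomb G (- 2 * F) nuu nuv + rcomb E (- p) nvv nu + rcomb (- q) k nv n = 0.
Proof.
move=> kE; apply: orth0; rewrite /rcomb !lin_inner.
- rewrite nuux nuvx nvvx nux nvx nx -[RHS]oppr0 -[in RHS]th; ring.
- rewrite nxu.
  have H := @codazzi_alg E F G (inner xu xuu) (inner xu xuv) (inner xu xvv)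
    (inner xv xuu) (inner xv xuv) (inner xv xvv) a b c d p q
    (inner nuu xu) (inner nuv xu) (inner nvv xu) (inner nuv xv) symE trE.
  have tu := thu; have cv := codv.
  rewrite !nu_in !nv_in in tu cv *; rewrite EE FF GG xvu in tu *.
  transitivity (G * inner nuu xu - 2 * F * inner nuv xu + E * inner nvv xu
    - (p * (a * E + b * F) + q * (c * E + d * F))); first by ring.
  rewrite H ?subrr //.
- rewrite nxv.
  have sym' : d * F + c * E = b * G + a * F by rewrite addrC -symE addrC.
  have tr' : d + a = 0 by rewrite addrC.
  have H := @codazzi_alg G F E (inner xv xvv) (inner xv xuv) (inner xv xuu)
    (inner xu xvv) (inner xu xuv) (inner xu xuu) d c b a q p
    (inner nvv xv) (inner nuv xv) (inner nuu xv) (inner nuv xu) sym' tr'.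
  have tv := thv; have cu := codu.
  rewrite !nu_in !nv_in in tv cu *; rewrite EE FF GG xvu in tv *.
  transitivity (E * inner nvv xv - 2 * F * inner nuv xv + G * inner nuu xv
    - (q * (d * G + c * F) + p * (b * G + a * F))); first by ring.
  rewrite H ?subrr //.
  + rewrite -[RHS]tv; ring.
  + by rewrite [d * _ + _]addrC -cu [b * _ + _]addrC.
  + by rewrite addrC qE; ring.
  + by rewrite addrC pE; ring.
- rewrite nuun nuvn nvvn nun nvn nn kE; ring.
Qed.

(** The left side is the operator applied to <ix, n>, expanded by the Leibniz rule. Its pure terms
    are [lap_n] paired with ix and [lap_x] paired with in; in the mixed terms nu and nv are tangent
    and <iv, v> = 0, so that only <i xu, xv> survives. *)
Lemma jacobi_at_point (k : R) : k = G * inner nu nu - 2 * F * inner nu nv + E * inner nv nv ->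
  G * (inner ('i *: xuu) n + inner ('i *: xu) nu + (inner ('i *: xu) nu + inner ('i *: x) nuu))
  + 2 * - F * (inner ('i *: xuv) n + inner ('i *: xu) nv + (inner ('i *: xv) nu + inner ('i *: x) nuv))
  + E * (inner ('i *: xvv) n + inner ('i *: xv) nv + (inner ('i *: xv) nv + inner ('i *: x) nvv))
  + - p * (inner ('i *: xu) n + inner ('i *: x) nu) + - q * (inner ('i *: xv) n + inner ('i *: x) nv)
  = - ((2 * (E * G - F ^+ 2) + k) * inner ('i *: x) n).
Proof.
move=> /lap_n /(congr1 (inner ('i *: x))); rewrite inner0r /rcomb !innerDr !innerZr => e1.
have := congr1 (fun w => inner w ('i *: n)) lap_x; rewrite inner0l /rcomb !innerDl !innerZl.
rewrite !inneriN => e2.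
have ixu w : inner ('i *: xu) nu = b * inner ('i *: xu) xv.
  by rewrite innerC nu_in (innerC xu) inneriz mulr0 add0r (innerC xv).
have ixuv : inner ('i *: xu) nv = d * inner ('i *: xu) xv.
  by rewrite innerC nv_in (innerC xu) inneriz mulr0 add0r (innerC xv).
have s : inner ('i *: xv) xu = - inner ('i *: xu) xv by rewrite innerC inneriN.
have ixvu : inner ('i *: xv) nu = - (a * inner ('i *: xu) xv).
  by rewrite innerC nu_in (innerC xv) inneriz mulr0 addr0 (innerC xu) s mulrN.
have ixvv : inner ('i *: xv) nv = - (c * inner ('i *: xu) xv).
  by rewrite innerC nv_in (innerC xv) inneriz mulr0 addr0 (innerC xu) s mulrN.
rewrite (ixu x) ixuv ixvu ixvv; exact: jacobi_combine e1 e2 symE.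
Qed.
End JacobiAtPoint.
End Pointwise.

(** * The Jacobi equation of the Reeb support function *)

Section LocalGeometry.
Context {R : realType}.
Implicit Types (q : R * R) (Y Z : R * R -> 'rV[R[i]]_2).

Lemma has_grad_const U (h : R * R -> R) q (a b c : R) : open U -> U q ->
  (forall x, U x -> h x = c) -> has_grad h q a b -> a = 0 /\ b = 0.
Proof.
move=> oU Uq hc /(has_grad_ext oU Uq hc) [_ _ <- <-].
by split; [exact: du_cst|exact: dv_cst].
Qed.

Lemma has_grad_iinner U Y Z q : open U -> Vk 1 U Y -> Vk 1 U Z -> U q ->
  has_grad (fun q => inner ('i *: Y q) (Z q)) q
   (inner ('i *: Du Y q) (Z q) + inner ('i *: Y q) (Du Z q))
   (inner ('i *: Dv Y q) (Z q) + inner ('i *: Y q) (Dv Z q)).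
Proof.
move=> oU Y1 Z1 Uq; have [eu ev] := D_i oU Y1 Uq.
apply: (has_grad_eq (has_grad_inner oU (Vk_i oU Y1) Z1 Uq)).
  by congr (inner _ _ + _); exact: eu.
by congr (inner _ _ + _); exact: ev.
Qed.

Section algebra.
Implicit Types u v w n xu xv xuu xuv xvv nu nv nuu nuv nvv : 'rV[R[i]]_2.

Lemma op2E (A B C P Q : R) h q (hu hv huu huv hvv : R) : du h q = hu -> dv h q = hv ->
  du (du h) q = huu -> dv (du h) q = huv -> dv (dv h) q = hvv ->
  op2 A B C P Q h q = A * huu + 2 * B * huv + C * hvv + P * hu + Q * hv.
Proof. by move=> <- <- <- <- <-. Qed.

Lemma add0_opp (a b : R) : a + b = 0 -> a = - b.
Proof. by move=> /eqP; rewrite addr_eq0 => /eqP. Qed.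

Lemma sub1_eq0 (a b : R) : a = b -> a + -1 * b = 0.
Proof. by move=> ->; rewrite mulN1r subrr. Qed.

Lemma inner_sym0 u v : inner u v + inner v u = 0 -> inner u v = 0.
Proof. by rewrite (innerC v) => /eqP; rewrite -mulr2n mulrn_eq0 => /eqP. Qed.

Lemma inner_flip u v n w : inner u v = - inner n w -> inner w n = - inner u v.
Proof. by move=> ->; rewrite opprK innerC. Qed.

Lemma minimal_alg (e f g l m n a b c : R) : e * n - 2 * f * m + g * l = 0 ->
  l = - c -> m = - b -> n = - a -> e * a - 2 * f * b + g * c = 0.
Proof. by move=> h lc mb na; rewrite -[RHS]oppr0 -[in RHS]h lc mb na; ring. Qed.

Lemma theta_alg (e f g a b b' c : R) : e * a - 2 * f * b + g * c = 0 -> b' = b ->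
  e * a + -2 * (f * b') + g * c = 0.
Proof. by move=> + ->; rewrite mulNr !mulrA. Qed.

(** Primed letters are mixed derivatives taken in the other order. This and the next two lemmas
    bring what the Leibniz rule delivers into the shape expected by [jacobi_at_point]. *)
Lemma thu_alg xu xv xuu xuv xuv' nu nv nuu nuv nuv' : xuv' = xuv -> nuv' = nuv ->
  (inner xuu xu + inner xu xuu) * inner nv xv + inner xu xu * (inner nuv' xv + inner nv xuv')
  + (0 * (inner xu xv * inner nv xu) + -2 * ((inner xuu xv + inner xu xuv') * inner nv xu
     + inner xu xv * (inner nuv' xu + inner nv xuu)))
  + ((inner xuv' xv + inner xv xuv') * inner nu xu + inner xv xv * (inner nuu xu + inner nu xuu)) = 0 ->
  2 * inner xu xuu * inner nv xv + inner xu xu * (inner nuv xv + inner nv xuv)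
   - 2 * ((inner xv xuu + inner xu xuv) * inner nv xu + inner xu xv * (inner nuv xu + inner nv xuu))
   + 2 * inner xv xuv * inner nu xu + inner xv xv * (inner nuu xu + inner nu xuu) = 0.
Proof.
move=> -> -> h; rewrite -[RHS]h (innerC xuu) (innerC xuv xv) (innerC xuu xv); ring.
Qed.

Lemma thv_alg xu xv xuv xvv nu nv nuv nvv :
  (inner xuv xu + inner xu xuv) * inner nv xv + inner xu xu * (inner nvv xv + inner nv xvv)
  + (0 * (inner xu xv * inner nu xv) + -2 * ((inner xuv xv + inner xu xvv) * inner nu xv
     + inner xu xv * (inner nuv xv + inner nu xvv)))
  + ((inner xvv xv + inner xv xvv) * inner nu xu + inner xv xv * (inner nuv xu + inner nu xuv)) = 0 ->
  2 * inner xu xuv * inner nv xv + inner xu xu * (inner nvv xv + inner nv xvv)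
   - 2 * ((inner xv xuv + inner xu xvv) * inner nu xv + inner xu xv * (inner nuv xv + inner nu xvv))
   + 2 * inner xv xvv * inner nu xu + inner xv xv * (inner nuv xu + inner nu xuv) = 0.
Proof.
move=> h; rewrite -[RHS]h (innerC xuv xu) (innerC xvv xv) (innerC xuv xv); ring.
Qed.

Lemma cod_alg nu nv xu xv nuu xuv xuv' nuv nuv' xuu : xuv' = xuv -> nuv' = nuv ->
  inner nuu xv + inner nu xuv' + (0 * inner nv xu + -1 * (inner nuv' xu + inner nv xuu)) = 0 ->
  inner nuu xv + inner nu xuv = inner nuv xu + inner nv xuu.
Proof. by move=> -> ->; rewrite mul0r add0r mulN1r => /eqP; rewrite subr_eq0 => /eqP. Qed.

Lemma gram_gt0r (e f g : R) : 0 < e -> 0 < e * g - f ^+ 2 -> 0 < g.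
Proof.
move=> e0 W; have : 0 < e * g by apply: lt_le_trans W _; rewrite gerBl sqr_ge0.
by rewrite pmulr_rgt0.
Qed.

Lemma cramer_p (e f g a b w : R) : 0 < e * g - f ^+ 2 -> w = (e * g - f ^+ 2)^-1 ->
  (a * g - b * f) * w * e + (b * e - a * f) * w * f = a.
Proof. by move=> W ->; field; rewrite gt_eqF. Qed.

Lemma cramer_q (e f g a b w : R) : 0 < e * g - f ^+ 2 -> w = (e * g - f ^+ 2)^-1 ->
  (a * g - b * f) * w * f + (b * e - a * f) * w * g = b.
Proof. by move=> W ->; field; rewrite gt_eqF. Qed.

(** Multiplied by g, the expression becomes |g nu - f nv|^2 + (eg - f^2) |nv|^2. *)
Lemma shape_norm_ge0 nu nv (e f g : R) : 0 < g -> 0 < e * g - f ^+ 2 ->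
  0 <= g * inner nu nu - 2 * f * inner nu nv + e * inner nv nv.
Proof.
move=> g0 W0; rewrite -(pmulr_rge0 _ g0).
have -> : g * (g * inner nu nu - 2 * f * inner nu nv + e * inner nv nv) =
  inner (rcomb g (- f) nu nv) (rcomb g (- f) nu nv) + (e * g - f ^+ 2) * inner nv nv.
  rewrite /rcomb !lin_inner (innerC nv nu).
  by move: (inner nu nu) (inner nu nv) (inner nv nv) => *; ring.
by rewrite addr_ge0 ?inner_ge0 // mulr_ge0 ?inner_ge0 // ltW.
Qed.
End algebra.

Variables (U : set (R * R)) (X N : R * R -> 'rV[R[i]]_2).
Hypotheses (oU : open U) (sX : smooth_map_on U X) (kN : Vk 2 U N).
Hypothesis X1 : forall q, U q -> inner (X q) (X q) = 1.
Hypothesis ind : forall q, U q -> independent (Du X q) (Dv X q).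
Hypothesis NX : forall q, U q -> inner (N q) (X q) = 0.
Hypothesis NXu : forall q, U q -> inner (N q) (Du X q) = 0.
Hypothesis NXv : forall q, U q -> inner (N q) (Dv X q) = 0.
Hypothesis NN : forall q, U q -> inner (N q) (N q) = 1.
Hypothesis H0 : forall q, U q ->
  inner (Du X q) (Du X q) * inner (Dv (Dv X) q) (N q)
  - 2 * inner (Du X q) (Dv X q) * inner (Dv (Du X) q) (N q)
  + inner (Dv X q) (Dv X q) * inner (Du (Du X) q) (N q) = 0.

Local Notation E q := (inner (Du X q) (Du X q)).
Local Notation F q := (inner (Du X q) (Dv X q)).
Local Notation G q := (inner (Dv X q) (Dv X q)).

Let kX k : Vk k U X := smooth_Vk k sX.
Let kXu k : Vk k U (Du X) := Vk_Du (kX k.+1).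
Let kXv k : Vk k U (Dv X) := Vk_Dv (kX k.+1).
Let kN1 : Vk 1 U N := VkW oU kN.
Let kNu : Vk 1 U (Du N) := Vk_Du kN.
Let kNv : Vk 1 U (Dv N) := Vk_Dv kN.
Let E0 q : U q -> 0 < E q. Proof. by move=> Uq; case: (gram_gt0 (ind Uq)). Qed.
Let W0 q : U q -> 0 < E q * G q - F q ^+ 2. Proof. by move=> Uq; case: (gram_gt0 (ind Uq)). Qed.

Lemma sphere_Du q : U q -> inner (X q) (Du X q) = 0.
Proof.
move=> Uq; have [h _] := has_grad_const oU Uq X1 (has_grad_inner oU (kX 1) (kX 1) Uq).
exact: etrans (innerC _ _) (inner_sym0 h).
Qed.

Lemma sphere_Dv q : U q -> inner (X q) (Dv X q) = 0.
Proof.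
move=> Uq; have [_ h] := has_grad_const oU Uq X1 (has_grad_inner oU (kX 1) (kX 1) Uq).
exact: etrans (innerC _ _) (inner_sym0 h).
Qed.

Let XuvE q : U q -> Du (Dv X) q = Dv (Du X) q. Proof. exact: (DuDv_comm oU (kX 2)). Qed.
Let NuvE q : U q -> Du (Dv N) q = Dv (Du N) q. Proof. exact: (DuDv_comm oU kN). Qed.

Let const0 Y Z q : Vk 1 U Y -> Vk 1 U Z -> U q -> (forall x, U x -> inner (Y x) (Z x) = 0) ->
  inner (Du Y q) (Z q) = - inner (Y q) (Du Z q) /\ inner (Dv Y q) (Z q) = - inner (Y q) (Dv Z q).
Proof.
move=> kY kZ Uq c; have [hu hv] := has_grad_const oU Uq c (has_grad_inner oU kY kZ Uq).
by split; [exact: add0_opp hu|exact: add0_opp hv].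
Qed.

Lemma normal_D q : U q -> [/\ inner (Du N q) (X q) = 0, inner (Dv N q) (X q) = 0,
   inner (Du N q) (N q) = 0 & inner (Dv N q) (N q) = 0].
Proof.
move=> Uq; have [a b] := const0 kN1 (kX 1) Uq NX.
have [c d] := has_grad_const oU Uq NN (has_grad_inner oU kN1 kN1 Uq).
split.
- exact: (etrans a (etrans (congr1 -%R (NXu Uq)) (oppr0 _))).
- exact: (etrans b (etrans (congr1 -%R (NXv Uq)) (oppr0 _))).
- exact: inner_sym0 c.
- exact: inner_sym0 d.
Qed.

Lemma weingarten q : U q -> [/\ inner (Du (Du X) q) (N q) = - inner (Du N q) (Du X q),
  inner (Dv (Du X) q) (N q) = - inner (Dv N q) (Du X q),
  inner (Dv (Dv X) q) (N q) = - inner (Dv N q) (Dv X q) &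
  inner (Du N q) (Dv X q) = inner (Dv N q) (Du X q)].
Proof.
move=> Uq; have [a b] := const0 kN1 (kXu 1) Uq NXu; have [c d] := const0 kN1 (kXv 1) Uq NXv.
split; [exact: inner_flip a|exact: inner_flip b|exact: inner_flip d|].
exact: (etrans c (etrans (congr1 (fun w => - inner (N q) w) (XuvE Uq)) (esym b))).
Qed.

Lemma minimal_shape q : U q ->
  E q * inner (Dv N q) (Dv X q) - 2 * F q * inner (Dv N q) (Du X q) + G q * inner (Du N q) (Du X q) = 0.
Proof. by move=> Uq; have [l m n _] := weingarten Uq; exact: (minimal_alg (H0 Uq) l m n). Qed.

Definition reeb_support q : R := inner ('i *: X q) (N q).
Let f := reeb_support.

Let al q := G q * inner (Du X q) (Du (Du X) q) - 2 * F q * inner (Du X q) (Dv (Du X) q) + E q * inner (Du X q) (Dv (Dv X) q).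
Let be q := G q * inner (Dv X q) (Du (Du X) q) - 2 * F q * inner (Dv X q) (Dv (Du X) q) + E q * inner (Dv X q) (Dv (Dv X) q).
(** The factor 1 / (EG - F^2) of the first-order coefficients is written as a square of this
    function, whose continuity is given by [Ck_on_rsqrt]. *)
Let w q := (Num.sqrt (E q * G q - F q ^+ 2))^-1.
Let P q := (al q * G q - be q * F q) * (w q * w q).
Let Q q := (be q * E q - al q * F q) * (w q * w q).

Let wE q : U q -> w q * w q = (E q * G q - F q ^+ 2)^-1.
Proof. by move=> Uq; rewrite /w -invfM -expr2 sqr_sqrtr // ltW // W0. Qed.

Let PE q : U q -> P q * E q + Q q * F q = al q.
Proof.
move=> Uq; exact: cramer_p (W0 Uq) (wE Uq).
Qed.

Let QE q : U q -> P q * F q + Q q * G q = be q.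
Proof.
move=> Uq; exact: cramer_q (W0 Uq) (wE Uq).
Qed.

Let k q := G q * inner (Du N q) (Du N q) - 2 * F q * inner (Du N q) (Dv N q) + E q * inner (Dv N q) (Dv N q).

Let thu q : U q -> 2 * inner (Du X q) (Du (Du X) q) * inner (Dv N q) (Dv X q)
   + E q * (inner (Dv (Du N) q) (Dv X q) + inner (Dv N q) (Dv (Du X) q))
   - 2 * ((inner (Dv X q) (Du (Du X) q) + inner (Du X q) (Dv (Du X) q)) * inner (Dv N q) (Du X q)
          + F q * (inner (Dv (Du N) q) (Du X q) + inner (Dv N q) (Du (Du X) q)))
   + 2 * inner (Dv X q) (Dv (Du X) q) * inner (Du N q) (Du X q)
   + G q * (inner (Du (Du N) q) (Du X q) + inner (Du N q) (Du (Du X) q)) = 0.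
Proof.
move=> Uq.
have gE := has_grad_inner oU (kXu 1) (kXu 1) Uq.
have gF := has_grad_inner oU (kXu 1) (kXv 1) Uq.
have gG := has_grad_inner oU (kXv 1) (kXv 1) Uq.
have g1 := has_grad_inner oU kNv (kXv 1) Uq.
have g2 := has_grad_inner oU kNv (kXu 1) Uq.
have g3 := has_grad_inner oU kNu (kXu 1) Uq.
have g := has_gradD (has_gradD (has_gradM gE g1) (has_gradM (has_grad_cst (- 2) q) (has_gradM gF g2)))
  (has_gradM gG g3).
have [h _] := has_grad_const oU Uq (fun x Ux => theta_alg (minimal_shape Ux) erefl) g.
exact: (thu_alg (XuvE Uq) (NuvE Uq) h).
Qed.

Let thv q : U q -> 2 * inner (Du X q) (Dv (Du X) q) * inner (Dv N q) (Dv X q)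
   + E q * (inner (Dv (Dv N) q) (Dv X q) + inner (Dv N q) (Dv (Dv X) q))
   - 2 * ((inner (Dv X q) (Dv (Du X) q) + inner (Du X q) (Dv (Dv X) q)) * inner (Du N q) (Dv X q)
          + F q * (inner (Dv (Du N) q) (Dv X q) + inner (Du N q) (Dv (Dv X) q)))
   + 2 * inner (Dv X q) (Dv (Dv X) q) * inner (Du N q) (Du X q)
   + G q * (inner (Dv (Du N) q) (Du X q) + inner (Du N q) (Dv (Du X) q)) = 0.
Proof.
move=> Uq.
have gE := has_grad_inner oU (kXu 1) (kXu 1) Uq.
have gF := has_grad_inner oU (kXu 1) (kXv 1) Uq.
have gG := has_grad_inner oU (kXv 1) (kXv 1) Uq.
have g1 := has_grad_inner oU kNv (kXv 1) Uq.
have g2 := has_grad_inner oU kNu (kXv 1) Uq.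
have g3 := has_grad_inner oU kNu (kXu 1) Uq.
have g := has_gradD (has_gradD (has_gradM gE g1) (has_gradM (has_grad_cst (- 2) q) (has_gradM gF g2)))
  (has_gradM gG g3).
have c x : U x -> E x * inner (Dv N x) (Dv X x) + -2 * (F x * inner (Du N x) (Dv X x)) +
    G x * inner (Du N x) (Du X x) = 0.
  by move=> Ux; have [_ _ _ e] := weingarten Ux; exact: (theta_alg (minimal_shape Ux) e).
have [_ h] := has_grad_const oU Uq c g.
exact: (thv_alg h).
Qed.

Let fC : Ck_on 2 U f.
Proof. exact: (Ck_inner oU (Vk_i oU (kX 2)) kN). Qed.

(** The Jacobi equation multiplied by EG - F^2: the operator is that multiple of the Laplacian of
    the induced metric, and [k] is that multiple of |A|^2. *)
Let f_op q : U q -> op2 (G q) (- F q) (E q) (- P q) (- Q q) f q =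
  - ((2 * (E q * G q - F q ^+ 2) + k q) * f q).
Proof.
move=> Uq.
have gf x (Ux : U x) := has_grad_iinner oU (kX 1) kN1 Ux.
have gu := has_gradD (has_grad_iinner oU (kXu 1) kN1 Uq) (has_grad_iinner oU (kX 1) kNu Uq).
have gv := has_gradD (has_grad_iinner oU (kXv 1) kN1 Uq) (has_grad_iinner oU (kX 1) kNv Uq).
have eu x : U x -> inner ('i *: Du X x) (N x) + inner ('i *: X x) (Du N x) = du f x.
  by move=> Ux; have [_ _ e _] := gf x Ux; exact: (esym e).
have ev x : U x -> inner ('i *: Dv X x) (N x) + inner ('i *: X x) (Dv N x) = dv f x.
  by move=> Ux; have [_ _ _ e] := gf x Ux; exact: (esym e).
have [_ _ duu dvu] := has_grad_ext oU Uq eu gu.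
have [_ _ _ dvv] := has_grad_ext oU Uq ev gv.
apply: etrans (op2E (G q) (- F q) (E q) (- P q) (- Q q) (esym (eu q Uq)) (esym (ev q Uq)) duu dvu dvv) _.
have [nx1 nx2 nn1 nn2] := normal_D Uq.
have [l m n sym] := weingarten Uq.
have NuX x : U x -> inner (Du N x) (X x) = 0 by move=> Ux; have [] := normal_D Ux.
have NvX x : U x -> inner (Dv N x) (X x) = 0 by move=> Ux; have [] := normal_D Ux.
have NuN x : U x -> inner (Du N x) (N x) = 0 by move=> Ux; have [] := normal_D Ux.
have NvN x : U x -> inner (Dv N x) (N x) = 0 by move=> Ux; have [] := normal_D Ux.
have XuX x : U x -> inner (Du X x) (X x) = 0 by move=> Ux; rewrite innerC; exact: sphere_Du.
have XvX x : U x -> inner (Dv X x) (X x) = 0 by move=> Ux; rewrite innerC; exact: sphere_Dv.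
have [a1 a2] := const0 (kXu 1) (kX 1) Uq XuX.
have [_ a3] := const0 (kXv 1) (kX 1) Uq XvX.
have [b1 b2] := const0 kNu (kX 1) Uq NuX.
have [_ b3] := const0 kNv (kX 1) Uq NvX.
have [c1 c2] := const0 kNu kN1 Uq NuN.
have [_ c3] := const0 kNv kN1 Uq NvN.
(* Differentiating the symmetry of the second fundamental form, and exchanging mixed derivatives,
   gives the two Codazzi relations. *)
have symf x : U x -> inner (Du N x) (Dv X x) + -1 * inner (Dv N x) (Du X x) = 0.
  move=> Ux; have [_ _ _ e] := weingarten Ux; exact: sub1_eq0 e.
have [d1 d2] := has_grad_const oU Uq symf (has_gradD (has_grad_inner oU kNu (kXv 1) Uq)
  (has_gradM (has_grad_cst (-1) q) (has_grad_inner oU kNv (kXu 1) Uq))).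
have {}d1 := cod_alg (XuvE Uq) (NuvE Uq) d1.
have {}d2 := cod_alg erefl erefl d2.
have b2' := etrans b2 (congr1 -%R sym).
apply: (jacobi_at_point (W0 Uq) (erefl _) (erefl _) (erefl _) (X1 Uq) (sphere_Du Uq) (sphere_Dv Uq)
 (NX Uq) (NXu Uq) (NXv Uq) (NN Uq) a1 a2 a3 nx1 nx2 nn1 nn2 b1 b2' b3 c1 c2 c3 l m n sym
 (minimal_shape Uq) (thu Uq) (thv Uq) d1 d2 (PE Uq) (QE Uq) (erefl _)).
Qed.

Let G0 q : U q -> 0 < G q.
Proof.
by move=> Uq; exact: gram_gt0r (E0 Uq) (W0 Uq).
Qed.

Let k0 q : U q -> 0 <= k q.
Proof. by move=> Uq; exact: (shape_norm_ge0 _ _ (G0 Uq) (W0 Uq)). Qed.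

Let c0E : Ck_on 0 U (fun q => E q). Proof. exact: (Ck_inner oU (kXu 0) (kXu 0)). Qed.
Let c0F : Ck_on 0 U (fun q => F q). Proof. exact: (Ck_inner oU (kXu 0) (kXv 0)). Qed.
Let c0G : Ck_on 0 U (fun q => G q). Proof. exact: (Ck_inner oU (kXv 0) (kXv 0)). Qed.
Let c0W : Ck_on 0 U (fun q => E q * G q - F q ^+ 2).
Proof. exact: (Ck_on_add oU (Ck_on_mul oU c0E c0G) (Ck_on_opp oU (Ck_on_pow 2 oU c0F))). Qed.
Let c0w : Ck_on 0 U w. Proof. exact: (Ck_on_rsqrt oU W0 c0W). Qed.

Let c0lin Y : Vk 1 U Y -> Ck_on 0 U (fun q => G q * inner (Y q) (Du (Du X) q)
  - 2 * F q * inner (Y q) (Dv (Du X) q) + E q * inner (Y q) (Dv (Dv X) q)).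
Proof.
move=> kY; have kY0 := VkW oU kY.
have i1 := Ck_inner oU kY0 (Vk_Du (kXu 1)).
have i2 := Ck_inner oU kY0 (Vk_Dv (kXu 1)).
have i3 := Ck_inner oU kY0 (Vk_Dv (kXv 1)).
exact: (Ck_on_add oU (Ck_on_add oU (Ck_on_mul oU c0G i1)
  (Ck_on_opp oU (Ck_on_mul oU (Ck_on_mul oU (Ck_on_cst 0 U 2) c0F) i2))) (Ck_on_mul oU c0E i3)).
Qed.

Let c0al : Ck_on 0 U al. Proof. exact: c0lin (kXu 1). Qed.
Let c0be : Ck_on 0 U be. Proof. exact: c0lin (kXv 1). Qed.
Let c0P : Ck_on 0 U (fun q => - P q).
Proof.
exact: (Ck_on_opp oU (Ck_on_mul oU (Ck_on_add oU (Ck_on_mul oU c0al c0G)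
  (Ck_on_opp oU (Ck_on_mul oU c0be c0F))) (Ck_on_mul oU c0w c0w))).
Qed.
Let c0Q : Ck_on 0 U (fun q => - Q q).
Proof.
exact: (Ck_on_opp oU (Ck_on_mul oU (Ck_on_add oU (Ck_on_mul oU c0be c0E)
  (Ck_on_opp oU (Ck_on_mul oU c0al c0F))) (Ck_on_mul oU c0w c0w))).
Qed.

Let W0' q : U q -> 0 < G q * E q - (- F q) ^+ 2.
Proof. by move=> Uq; rewrite sqrrN mulrC; exact: W0. Qed.

Lemma reeb_support_strong_min q : (forall x, U x -> 0 <= f x) -> U q -> f q = 0 ->
  exists2 e, 0 < e & forall x, box q e x -> f x = 0.
Proof.
move=> f0; apply: (strong_min oU fC f0 c0G (Ck_on_opp oU c0F) c0E c0P c0Q G0 W0') => x Ux.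
rewrite f_op // oppr_le0 mulr_ge0 ?f0 // addr_ge0 ?k0 // mulr_ge0 // ltW // W0 //.
Qed.

Lemma reeb_support_local_min q : U q -> local_min f q -> f q <= 0.
Proof.
move=> Uq fmin; have := op2_local_min (- P q) (- Q q) oU fC Uq fmin (G0 Uq) (ltW (W0' Uq)).
rewrite f_op // oppr_ge0 pmulr_rle0 //.
by rewrite ltr_pwDl ?k0 // mulr_gt0 // W0.
Qed.

Lemma reeb_support_continuous : Ck_on 0 U f.
Proof. exact: Ck_on0 oU fC. Qed.

End LocalGeometry.

(** * Minimal surfaces tangent to the Reeb field *)

Section HopfInvariant.
Context {R : realType}.
Implicit Types x y n w xu xv nu nv e dx dn : 'rV[R[i]]_2.

(* The squared modulus of [herm y w]. *)
Definition herm2 y w : R := inner y w ^+ 2 + inner y ('i *: w) ^+ 2.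

(** Once ix is orthogonal to n, the vectors x, ix, n, in are orthonormal, so that the tangent plane,
    orthogonal to x and n, is spanned by ix and in. *)
Lemma reeb_frame_decomp x n w : inner x x = 1 -> inner n n = 1 -> inner n x = 0 ->
  inner ('i *: x) n = 0 -> inner w x = 0 -> inner w n = 0 ->
  w = rcomb (inner w ('i *: x)) (inner w ('i *: n)) ('i *: x) ('i *: n).
Proof.
move=> xx nn nx ixn wx wn.
have ix : inner ('i *: x) x = 0 by exact: inneriz.
have in0 : inner ('i *: n) n = 0 by exact: inneriz.
have nix : inner n ('i *: x) = 0 by rewrite innerC.
have inx : inner ('i *: n) x = 0 by rewrite innerC inneriN ixn oppr0.
have inix : inner ('i *: n) ('i *: x) = 0 by rewrite innerii.
have ixix : inner ('i *: x) ('i *: x) = 1 by rewrite innerii.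
have inin : inner ('i *: n) ('i *: n) = 1 by rewrite innerii.
apply/eqP; rewrite -subr_eq0; apply/eqP.
apply: (@orth_basis_eq0 R x ('i *: x) ('i *: n) n) => //.
- suff -> : inner (cross x ('i *: x) ('i *: n)) (cross x ('i *: x) ('i *: n)) = 1 by [].
  have ixin : inner ('i *: x) ('i *: n) = 0 by rewrite innerC.
  have xix : inner x ('i *: x) = 0 by rewrite innerC.
  have xin : inner x ('i *: n) = 0 by rewrite innerC.
  rewrite cross_norm xx xix xin ixix inin ixin /det3; ring.
- by rewrite innerC.
- by rewrite /rcomb !lin_inner wx ix inx !mulr0 addr0 subrr.
- by rewrite /rcomb !lin_inner ixix inix mulr1 mulr0 addr0 subrr.
- have ixin : inner ('i *: x) ('i *: n) = 0 by rewrite innerC.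
  by rewrite /rcomb !lin_inner ixin inin mulr1 mulr0 add0r subrr.
- by rewrite /rcomb !lin_inner wn ixn in0 !mulr0 addr0 subrr.
Qed.

(** Here a and o are the components of a derivative of X along ix and in; the same derivative of N
    has components o and h. Hence dN, in the orthonormal frame (ix, in), has first row (0, 1); being
    symmetric and trace-free it must exchange ix and in. With h = a + k both equations become linear
    and homogeneous in k, and the area form a1 o2 - a2 o1 is nonzero. *)
Lemma hopf_alg (a1 a2 o1 o2 h1 h2 : R) :
  o1 * a2 + h1 * o2 = o2 * a1 + h2 * o1 ->
  (a1 ^+ 2 + o1 ^+ 2) * (o2 * a2 + h2 * o2) - 2 * (a1 * a2 + o1 * o2) * (o2 * a1 + h2 * o1)
   + (a2 ^+ 2 + o2 ^+ 2) * (o1 * a1 + h1 * o1) = 0 ->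
  0 < (a1 ^+ 2 + o1 ^+ 2) * (a2 ^+ 2 + o2 ^+ 2) - (a1 * a2 + o1 * o2) ^+ 2 ->
  h1 = a1 /\ h2 = a2.
Proof.
move=> sym mini W.
have [k1 h1E] : exists k1, h1 = a1 + k1 by exists (h1 - a1); ring.
have [k2 h2E] : exists k2, h2 = a2 + k2 by exists (h2 - a2); ring.
subst h1 h2.
have s : k1 * o2 = k2 * o1 by lra.
have D0 : (a1 * o2 - a2 * o1) ^+ 2 != 0.
  by rewrite gt_eqF //; apply: lt_le_trans W _; rewrite le_eqVlt; apply/orP; left; apply/eqP; ring.
have m : (a1 ^+ 2 + o1 ^+ 2) * (k2 * o2) - 2 * (a1 * a2 + o1 * o2) * (k2 * o1)
   + (a2 ^+ 2 + o2 ^+ 2) * (k1 * o1) = 0 by rewrite -[RHS]mini; ring.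
have k10 : k1 = 0.
  apply: (mulIf D0); rewrite mul0r -[RHS](mulr0 o1) -m.
  have -> : o1 * ((a1 ^+ 2 + o1 ^+ 2) * (k2 * o2) - 2 * (a1 * a2 + o1 * o2) * (k2 * o1)
   + (a2 ^+ 2 + o2 ^+ 2) * (k1 * o1)) = (a1 ^+ 2 + o1 ^+ 2) * (k2 * o1 * o2) -
     2 * (a1 * a2 + o1 * o2) * (k2 * o1) * o1 + (a2 ^+ 2 + o2 ^+ 2) * k1 * o1 ^+ 2 by ring.
  rewrite -s; ring.
have k20 : k2 = 0.
  apply: (mulIf D0); rewrite mul0r -[RHS](mulr0 o2) -m.
  have -> : o2 * ((a1 ^+ 2 + o1 ^+ 2) * (k2 * o2) - 2 * (a1 * a2 + o1 * o2) * (k2 * o1)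
   + (a2 ^+ 2 + o2 ^+ 2) * (k1 * o1)) = (a1 ^+ 2 + o1 ^+ 2) * k2 * o2 ^+ 2 -
     2 * (a1 * a2 + o1 * o2) * k2 * o1 * o2 + (a2 ^+ 2 + o2 ^+ 2) * (k1 * o2) * o1 by ring.
  rewrite s; ring.
by rewrite k10 k20 !addr0.
Qed.

(* When the Reeb field is tangent to a minimal surface, d(x + n) is a multiple of
   i(x + n) and d(x - n) is a multiple of i(x - n). *)
Lemma hopf_at_point x n xu xv nu nv : inner x x = 1 -> inner n n = 1 -> inner n x = 0 ->
  inner ('i *: x) n = 0 ->
  inner xu x = 0 -> inner xu n = 0 -> inner xv x = 0 -> inner xv n = 0 ->
  inner nu x = 0 -> inner nu n = 0 -> inner nv x = 0 -> inner nv n = 0 ->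
  inner ('i *: xu) n + inner ('i *: x) nu = 0 -> inner ('i *: xv) n + inner ('i *: x) nv = 0 ->
  inner nu xv = inner nv xu ->
  inner xu xu * inner nv xv - 2 * inner xu xv * inner nv xu + inner xv xv * inner nu xu = 0 ->
  0 < inner xu xu * inner xv xv - inner xu xv ^+ 2 ->
  [/\ nu = rcomb (inner xu ('i *: n)) (inner xu ('i *: x)) ('i *: x) ('i *: n),
     nv = rcomb (inner xv ('i *: n)) (inner xv ('i *: x)) ('i *: x) ('i *: n),
     xu = rcomb (inner xu ('i *: x)) (inner xu ('i *: n)) ('i *: x) ('i *: n) &
     xv = rcomb (inner xv ('i *: x)) (inner xv ('i *: n)) ('i *: x) ('i *: n)].
Proof.
move=> xx nn nx ixn xux xun xvx xvn nux nun nvx nvn fu fv sym mini W.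
have D w := reeb_frame_decomp (w := w) xx nn nx ixn.
have xuE := D _ xux xun; have xvE := D _ xvx xvn.
have nuE := D _ nux nun; have nvE := D _ nvx nvn.
have nuix : inner nu ('i *: x) = inner xu ('i *: n).
  by rewrite innerC inneriN; apply/eqP; rewrite -addr_eq0 addrC fu.
have nvix : inner nv ('i *: x) = inner xv ('i *: n).
  by rewrite innerC inneriN; apply/eqP; rewrite -addr_eq0 addrC fv.
rewrite nuix in nuE; rewrite nvix in nvE.
have ixix : inner ('i *: x) ('i *: x) = 1 by rewrite innerii.
have inin : inner ('i *: n) ('i *: n) = 1 by rewrite innerii.
have inix : inner ('i *: n) ('i *: x) = 0 by rewrite innerii.
have ixin : inner ('i *: x) ('i *: n) = 0 by rewrite innerii innerC.
have rc (a b c d : R) : inner (rcomb a b ('i *: x) ('i *: n)) (rcomb c d ('i *: x) ('i *: n)) = a * c + b * d.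
  rewrite /rcomb !lin_inner ixix inin inix ixin; ring.
move: (inner xu ('i *: x)) (inner xu ('i *: n)) (inner xv ('i *: x)) (inner xv ('i *: n))
  (inner nu ('i *: n)) (inner nv ('i *: n)) xuE xvE nuE nvE => a1 o1 a2 o2 h1 h2 xuE xvE nuE nvE.
have nuxu : inner nu xu = o1 * a1 + h1 * o1 by rewrite nuE xuE; exact: rc.
have nuxv : inner nu xv = o1 * a2 + h1 * o2 by rewrite nuE xvE; exact: rc.
have nvxu : inner nv xu = o2 * a1 + h2 * o1 by rewrite nvE xuE; exact: rc.
have nvxv : inner nv xv = o2 * a2 + h2 * o2 by rewrite nvE xvE; exact: rc.
have xuxu : inner xu xu = a1 ^+ 2 + o1 ^+ 2 by rewrite xuE !expr2; exact: rc.
have xuxv : inner xu xv = a1 * a2 + o1 * o2 by rewrite xuE xvE; exact: rc.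
have xvxv : inner xv xv = a2 ^+ 2 + o2 ^+ 2 by rewrite xvE !expr2; exact: rc.
rewrite nuxv nvxu in sym; rewrite nuxu nvxu nvxv xuxu xuxv xvxv in mini.
rewrite xuxu xuxv xvxv in W.
have [e1 e2] : h1 = a1 /\ h2 = a2 by exact: hopf_alg sym mini W.
rewrite e1 in nuE; rewrite e2 in nvE.
split; [exact: nuE|exact: nvE|exact: xuE|exact: xvE].
Qed.

(** As s is 1 or -1, the hypotheses give dx + s dn = (a + s o) i (x + s n), an infinitesimal change
    of phase. It preserves the modulus of [herm (x + s n) w], and the left side is half the
    derivative of its square. *)
Lemma herm2_D x n dx dn w (a o s : R) : s ^+ 2 = 1 ->
  dx = rcomb a o ('i *: x) ('i *: n) -> dn = rcomb o a ('i *: x) ('i *: n) ->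
  (inner dx w + s * inner dn w) * (inner x w + s * inner n w)
  + (inner dx ('i *: w) + s * inner dn ('i *: w)) * (inner x ('i *: w) + s * inner n ('i *: w)) = 0.
Proof.
move=> s2 dxE dnE.
have dx_in v : inner dx v = a * inner ('i *: x) v + o * inner ('i *: n) v.
  by rewrite dxE /rcomb innerDl !innerZl.
have dn_in v : inner dn v = o * inner ('i *: x) v + a * inner ('i *: n) v.
  by rewrite dnE /rcomb innerDl !innerZl.
rewrite !dx_in !dn_in !innerii.
have xw y : inner ('i *: y) w = - inner y ('i *: w) by rewrite inneriN opprK.
rewrite !xw; move: (inner x w) (inner n w) (inner x ('i *: w)) (inner n ('i *: w)) => p q t u.
transitivity ((s ^+ 2 - 1) * (o * (p * u - t * q))); last by rewrite s2 subrr mul0r.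
ring.
Qed.

(** The cross products of (x, e1, e2) and of (x, xu, xv) differ by a positive factor, so n is
    [tau * rho] times the first with rho > 0. Both are unit vectors, whence rho = 1, and
    [cross_contact] evaluates the product with ix. *)
Lemma contact_sign x e1 e2 xu xv n (sb cb r tau a b c d : R) :
  inner x x = 1 -> inner x xu = 0 -> inner x xv = 0 ->
  e1 = rcomb a b xu xv -> e2 = rcomb c d xu xv -> 0 < a * d - b * c ->
  inner e1 e1 = 1 -> inner e2 e2 = 1 -> inner e1 e2 = 0 -> inner ('i *: x) e1 = 0 ->
  e2 = rcomb sb cb ('i *: e1) ('i *: x) -> 0 < r -> tau ^+ 2 = 1 -> inner n n = 1 ->
  (forall w, inner n w = tau * (r * inner (cross x xu xv) w)) ->
  inner ('i *: x) n = tau * sb.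
Proof.
move=> xx xxu xxv e1E e2E k0 e11 e22 e12 ixe e2E' r0 tau2 nn nE.
have xe1 : inner x e1 = 0 by rewrite e1E /rcomb !lin_inner xxu xxv !mulr0 addr0.
have xe2 : inner x e2 = 0 by rewrite e2E /rcomb !lin_inner xxu xxv !mulr0 addr0.
pose m := cross x e1 e2.
have mm : inner m m = 1 by rewrite /m cross_norm xx xe1 xe2 e11 e12 e22 /det3; ring.
have mE w : inner m w = (a * d - b * c) * inner (cross x xu xv) w.
  by rewrite /m e1E e2E cross_comb.
pose rho := r / (a * d - b * c).
have rho0 : 0 < rho by rewrite divr_gt0.
have nE' w : inner n w = tau * rho * inner m w.
  by rewrite nE mE mulrA /rho -!mulrA [_^-1 * _]mulrA mulVf ?mul1r // gt_eqF.
have rho1 : rho = 1.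
  have : rho ^+ 2 = 1.
    have := nn; rewrite nE' (innerC m) nE' mm mulr1 -[_ * _ * _]expr2 exprMn tau2 mul1r.
    by [].
  move=> /eqP; rewrite sqrf_eq1 => /orP[/eqP //|/eqP rE].
  by move: rho0; rewrite rE ltr0N1.
rewrite innerC nE' rho1 mulr1; congr (_ * _).
by rewrite /m e2E'; exact: cross_contact.
Qed.

Lemma unit_normal_unique x xu xv n n' : 0 < inner (cross x xu xv) (cross x xu xv) ->
  inner n n = 1 -> inner n x = 0 -> inner n xu = 0 -> inner n xv = 0 ->
  inner n' n' = 1 -> inner n' x = 0 -> inner n' xu = 0 -> inner n' xv = 0 ->
  exists2 s : R, s ^+ 2 = 1 & n' = s%:C *: n.
Proof.
move=> D0 nn nx nu nv nn' nx' nu' nv'.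
have E : n' = (inner n' n)%:C *: n.
  apply/eqP; rewrite -subr_eq0; apply/eqP; apply: (orth_basis_eq0 D0 nn nx nu nv).
  - by rewrite !lin_inner nx' nx mulr0 subr0.
  - by rewrite !lin_inner nu' nu mulr0 subr0.
  - by rewrite !lin_inner nv' nv mulr0 subr0.
  - by rewrite !lin_inner nn mulr1 subrr.
exists (inner n' n) => //.
by move: nn'; rewrite {1 2}E !lin_inner nn mulr1 expr2.
Qed.

End HopfInvariant.

(** * Local constancy of the Hermitian moduli of X + N and X - N *)

Section LocalHopf.
Context {R : realType}.
Variables (U : set (R * R)) (X N : R * R -> 'rV[R[i]]_2).
Hypotheses (oU : open U) (sX : smooth_map_on U X) (kN : Vk 2 U N).
Hypothesis X1 : forall q, U q -> inner (X q) (X q) = 1.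
Hypothesis ind : forall q, U q -> independent (Du X q) (Dv X q).
Hypothesis NX : forall q, U q -> inner (N q) (X q) = 0.
Hypothesis NXu : forall q, U q -> inner (N q) (Du X q) = 0.
Hypothesis NXv : forall q, U q -> inner (N q) (Dv X q) = 0.
Hypothesis NN : forall q, U q -> inner (N q) (N q) = 1.
Hypothesis H0 : forall q, U q ->
  inner (Du X q) (Du X q) * inner (Dv (Dv X) q) (N q)
  - 2 * inner (Du X q) (Dv X q) * inner (Dv (Du X) q) (N q)
  + inner (Dv X q) (Dv X q) * inner (Du (Du X) q) (N q) = 0.
Hypothesis f0 : forall q, U q -> inner ('i *: X q) (N q) = 0.

Let herm2_deriv (w : 'rV[R[i]]_2) (s : R) q : s ^+ 2 = 1 -> U q ->
  has_grad (fun q => herm2 (X q + s%:C *: N q) w) q 0 0.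
Proof.
move=> s2 Uq.
have kX := smooth_Vk 1 sX; have kN1 : Vk 1 U N := VkW oU kN.
have kw v : Vk 1 U (fun=> v) := Vk_cst 1 U v.
have g v : has_grad (fun q => inner (X q) v + s * inner (N q) v) q
    (inner (Du X q) v + s * inner (Du N q) v) (inner (Dv X q) v + s * inner (Dv N q) v).
  apply: (has_grad_eq (has_gradD (has_grad_inner oU kX (kw v) Uq)
     (has_gradM (has_grad_cst s q) (has_grad_inner oU kN1 (kw v) Uq)))).
    by rewrite Du_cst !inner0r !addr0 mul0r add0r.
  by rewrite Dv_cst !inner0r !addr0 mul0r add0r.
have [nux nvx nun nvn] := normal_D oU sX kN NX NXu NXv NN Uq.
have [_ _ _ sym] := weingarten oU sX kN NXu NXv Uq.
have [fu fv] := has_grad_const oU Uq f0 (has_grad_iinner oU kX kN1 Uq).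
have xun : inner (Du X q) (N q) = 0 by rewrite innerC; exact: NXu.
have xvn : inner (Dv X q) (N q) = 0 by rewrite innerC; exact: NXv.
have xux : inner (Du X q) (X q) = 0 by rewrite innerC; exact: (sphere_Du oU sX X1).
have xvx : inner (Dv X q) (X q) = 0 by rewrite innerC; exact: (sphere_Dv oU sX X1).
have [nuE nvE xuE xvE] := hopf_at_point (X1 Uq) (NN Uq) (NX Uq) (f0 Uq) xux xun xvx xvn
  nux nun nvx nvn fu fv sym (minimal_shape oU sX kN NXu NXv H0 Uq) (gram_gt0 (ind Uq)).2.
have hu := herm2_D w s2 xuE nuE.
have hv := herm2_D w s2 xvE nvE.
have G := has_gradD (has_gradM (g w) (g w)) (has_gradM (g ('i *: w)) (g ('i *: w))).
have E x : U x -> (inner (X x) w + s * inner (N x) w) * (inner (X x) w + s * inner (N x) w) +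
   (inner (X x) ('i *: w) + s * inner (N x) ('i *: w)) * (inner (X x) ('i *: w) + s * inner (N x) ('i *: w)) =
   herm2 (X x + s%:C *: N x) w.
  by move=> _; rewrite /herm2 !innerDl !innerZl !expr2.
have dbl (a b c d : R) : a * b + c * d = 0 -> a * b + b * a + (c * d + d * c) = 0.
  by rewrite (mulrC b) (mulrC d) addrACA => ->; rewrite addr0.
by apply: (has_grad_ext oU Uq E); apply: (has_grad_eq G); [exact: dbl hu|exact: dbl hv].
Qed.

Lemma herm2_locally_constant (w : 'rV[R[i]]_2) (s : R) q e q' : s ^+ 2 = 1 ->
  box q e `<=` U -> box q e q' ->
  herm2 (X q' + s%:C *: N q') w = herm2 (X q + s%:C *: N q) w.
Proof.
move=> s2 eU q'b.
have g x (bx : box q e x) := herm2_deriv w s2 (eU x bx).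
by apply: (@du0_cst _ q e (fun q => herm2 (X q + s%:C *: N q) w)) q'b => x /g [].
Qed.
End LocalHopf.

(** * From charts to the whole surface *)

Section Global.
Context {R : realType}.
Variables (S : immersed_surface R) (beta : S -> R) (tau : R).
Hypotheses (hmin : minimal S) (hca : contact_angle beta).
Hypothesis (tau2 : tau ^+ 2 = 1).
Implicit Types (c d : chart R S) (p : S) (q : R * R) (n : 'rV[R[i]]_2).

Local Notation cod c := (coord c @` chart_dom c).
Local Notation X c := (@local_immersion R S c).
Local Notation imm := (@immersion R S).

Lemma cod_coord c p : chart_dom c p -> cod c (coord c p). Proof. by move=> cp; exists p. Qed.

Lemma local_immersion_coord c p : chart_dom c p -> X c (coord c p) = imm p.
Proof. by move=> cp; rewrite /local_immersion coordK. Qed.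

Lemma imm_unit p : inner (imm p) (imm p) = 1.
Proof.
have := @immersion_sphere R S p; rewrite /sphere3 /= hermE => /eqP.
by rewrite eq_complex /= => /andP[/eqP].
Qed.

(** The third clause is minimality cleared of its denominator. The last one fixes the sign of the
    normal in each chart, so that the local support functions agree on overlaps. *)
Definition adapted_normal c (N : R * R -> 'rV[R[i]]_2) : Prop :=
  [/\ Vk 2 (cod c) N,
    forall q, cod c q -> [/\ inner (N q) (X c q) = 0, inner (N q) (Du (X c) q) = 0,
      inner (N q) (Dv (X c) q) = 0 & inner (N q) (N q) = 1],
    forall q, cod c q ->
      inner (Du (X c) q) (Du (X c) q) * inner (Dv (Dv (X c)) q) (N q)
      - 2 * inner (Du (X c) q) (Dv (X c) q) * inner (Dv (Du (X c)) q) (N q)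
      + inner (Dv (X c) q) (Dv (X c) q) * inner (Du (Du (X c)) q) (N q) = 0 &
    forall q, cod c q -> reeb_support (X c) N q = tau * sin (beta (param c q))].

Lemma X1 c q : cod c q -> inner (X c q) (X c q) = 1.
Proof. by move=> _; exact: imm_unit. Qed.

Lemma X_independent c q : atlas c -> cod c q -> independent (Du (X c) q) (Dv (X c) q).
Proof. by move=> ac Uq; exact: (immersion_rank ac Uq). Qed.

Lemma X_smooth c : atlas c -> smooth_map_on (cod c) (X c).
Proof. exact: immersion_smooth. Qed.

Lemma adapted_normal_exists c : atlas c -> exists N, adapted_normal c N.
Proof.
move=> ac; have oU := @chart_cod_open R S c; have sX := X_smooth ac.
have XD q : cod c q -> inner (X c q) (Du (X c) q) = 0 /\ inner (X c q) (Dv (X c) q) = 0.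
  by move=> Uq; split; [exact: (sphere_Du oU sX (@X1 c))|exact: (sphere_Dv oU sX (@X1 c))].
have [N [kN Np Nr]] := unit_normal_field oU sX tau2 (@X1 c) XD (fun q => X_independent ac).
exists N; split; [exact: kN|exact: Np| |].
- move=> q Uq; have [a1 a2 a3 a4] := Np q Uq.
  have un : unit_normal (X c) q (N q).
    split; [exact: etrans (innerC _ _) a1|exact: etrans (innerC _ _) a2|exact: etrans (innerC _ _) a3|exact: a4].
  have := hmin ac Uq un; rewrite /mean_curvature => /eqP.
  have [_ W] := gram_gt0 (X_independent ac Uq).
  rewrite mulf_eq0 invr_eq0 mulf_eq0 pnatr_eq0 (gt_eqF W) !orbF => /eqP; exact.
- move=> q Uq; have [r r0 Nw] := Nr q Uq; have [a1 a2 a3 a4] := Np q Uq.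
  have [p cp pq] := Uq; have [_ _ /(_ c ac cp) [e1 [e2 [[[a [b [c' [d [e1E e2E k0]]]]] [e11 e22 e12 [_ ct]]] e2E']]]] := hca p.
  have paq : param c q = p by rewrite -pq coordK.
  have Xq : X c q = imm p by rewrite /local_immersion paq.
  rewrite /reeb_support paq; rewrite pq in e1E e2E ct.
  move: e2E'; rewrite -Xq /reeb => e2E'.
  exact: (contact_sign (X1 Uq) (XD q Uq).1 (XD q Uq).2 e1E e2E k0 e11 e22 e12 ct e2E' r0 tau2 a4 Nw).
Qed.

Let g p : R := tau * sin (beta p).

Let g_chart c N p : adapted_normal c N -> chart_dom c p -> g p = reeb_support (X c) N (coord c p).
Proof. by move=> [_ _ _ fE] cp; rewrite fE ?coordK //; exact: cod_coord. Qed.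

(** The predicate [contact_angle] says nothing about the regularity of [beta]; the continuity of its
    sine comes from the support functions in the charts. *)
Let g_continuous : continuous g.
Proof.
move=> p; have [c ac cp] := atlas_cover p.
have [N aN] := adapted_normal_exists ac; have [kN Np _ _] := aN.
have fc := reeb_support_continuous (@chart_cod_open R S c) (X_smooth ac) kN.
have near_g : \forall p' \near p, reeb_support (X c) N (coord c p') = g p'.
  have := open_nbhs_nbhs (conj (@chart_dom_open R S c) cp).
  by apply: filterS => p' cp'; rewrite (g_chart aN cp').
have h : (fun p' => reeb_support (X c) N (coord c p')) @ p --> g p.
  rewrite (g_chart aN cp); apply: continuous_comp; first exact: (coord_continuous cp).
  exact: (fc _ (cod_coord cp)).
by apply: cvg_trans h; apply: near_eq_cvg; exact: near_g.
Qed.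

Hypothesis (hcl : closed_surface S).
Hypothesis (g0 : forall p, 0 <= tau * sin (beta p)).

Let g_zero_exists : exists p, g p = 0.
Proof.
have [S0 cS _] := hcl.
have [p0 _ p0min] := compact_EVT_min S0 cS (continuous_subspaceT g_continuous).
exists p0; apply/eqP; rewrite eq_le g0 andbT.
have [c ac cp] := atlas_cover p0.
have [N aN] := adapted_normal_exists ac; have [kN Np Nm fE] := aN.
have Uq := cod_coord cp.
rewrite (g_chart aN cp).
apply: (reeb_support_local_min (@chart_cod_open R S c) (X_smooth ac) kN (@X1 c) (fun q => X_independent ac)
  _ _ _ _ Nm Uq) => //.
- by move=> q /Np[].
- by move=> q /Np[].
- by move=> q /Np[].
- by move=> q /Np[].
have [e e0 eU] := open_box (@chart_cod_open R S c) Uq.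
exists e => // x /eU Ux; rewrite -(g_chart aN cp) fE //; apply: p0min; rewrite inE.
by [].
Qed.

Lemma sin_contact_angle0 p : tau * sin (beta p) = 0.
Proof.
have [_ _ conS] := hcl.
suff : [set p | g p = 0] = [set: S] by move=> /seteqP[_ /(_ p I)].
apply: conS.
- by have [p0 ?] := g_zero_exists; exists p0.
- exists [set p | g p = 0]; last by rewrite setTI.
  rewrite openE => p1 gp1; have [c ac cp] := atlas_cover p1.
  have [N aN] := adapted_normal_exists ac; have [kN Np Nm fE] := aN.
  have Uq := cod_coord cp.
  have fq : reeb_support (X c) N (coord c p1) = 0 by rewrite -(g_chart aN cp).
  have [||||//|e e0 eP] := reeb_support_strong_min (@chart_cod_open R S c) (X_smooth ac) kN (@X1 c)
    (fun q => X_independent ac) _ _ _ _ Nm _ Uq fq.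
  + by move=> q /Np[].
  + by move=> q /Np[].
  + by move=> q /Np[].
  + by move=> q /Np[].
  + by move=> q Uq'; rewrite fE.
  have nb : nbhs (coord c p1) (box (coord c p1) e).
    by apply: open_nbhs_nbhs; split; [exact: box_open|exact: box_center].
  have := coord_continuous cp nb.
  have := open_nbhs_nbhs (conj (@chart_dom_open R S c) cp).
  apply: filterS2 => p2 cp2 bp2 /=; rewrite (g_chart aN cp2); exact: eP.
- exists [set p | g p = 0]; last by rewrite setTI.
  have -> : [set p | g p = 0] = g @^-1` [set 0] by [].
  apply: (@closed_comp _ _ g [set 0]) => [x _|]; [exact: g_continuous|exact: closed_eq].
Qed.

Lemma coord_overlap_open c d : open (coord c @` (chart_dom c `&` chart_dom d)).
Proof.
rewrite openE => q [p [cp dp] <-]; have Uq := cod_coord cp.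
have n1 : nbhs (coord c p) (cod c) by exact: (open_nbhs_nbhs (conj (@chart_cod_open R S c) Uq)).
have nd : nbhs (param c (coord c p)) (chart_dom d).
  by rewrite coordK //; exact: (open_nbhs_nbhs (conj (@chart_dom_open R S d) dp)).
have n2 := param_continuous Uq nd.
apply: filterS2 n1 n2 => q' [p' cp' <-] dq'; exists p' => //; split => //.
by move: dq'; rewrite /preimage /= coordK.
Qed.

(** The linear function <X, n> has zero differential in the chart [d], hence also in the chart [c]
    by the chain rule along the transition map. Being normal to the surface thus does not depend on
    the chart. *)
Lemma inner_chart_change c d p n : atlas c -> atlas d -> chart_dom c p -> chart_dom d p ->
  inner (Du (X d) (coord d p)) n = 0 -> inner (Dv (X d) (coord d p)) n = 0 ->
  inner (Du (X c) (coord c p)) n = 0 /\ inner (Dv (X c) (coord c p)) n = 0.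
Proof.
move=> ac ad cp dp du0 dv0.
pose O := coord c @` (chart_dom c `&` chart_dom d).
have oO : open O by exact: coord_overlap_open.
pose t q := coord d (param c q).
have [t1 t2] := transition_smooth ac ad.
have Oq : O (coord c p) by exists p.
have dt : differentiable t (coord c p).
  have -> : t = fun q => ((t q).1, (t q).2) by apply/funext => q; case: (t q).
  apply: differentiable_pair; [exact: (Ck1_differentiable oO (t1 1%N) Oq)|exact: (Ck1_differentiable oO (t2 1%N) Oq)].
have tp : t (coord c p) = coord d p by rewrite /t coordK.
pose G q := inner (X d q) n.
have kG : Ck_on 1 (cod d) G := Ck_inner (@chart_cod_open R S d) (smooth_Vk 1 (X_smooth ad)) (Vk_cst 1 _ n).
have gG k (ak : atlas k) (kp : chart_dom k p) := has_grad_inner (@chart_cod_open R S k) (smooth_Vk 1 (X_smooth ak)) (Vk_cst 1 _ n) (cod_coord kp).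
have dG : differentiable G (t (coord c p)).
  by rewrite tp; exact: (Ck1_differentiable (@chart_cod_open R S d) kG (cod_coord dp)).
have dG0 w' : 'd G (t (coord c p)) w' = 0.
  rewrite -deriveE // tp (Ck1_derive w' (@chart_cod_open R S d) kG (cod_coord dp)).
  have [_ _ -> ->] := gG d ad dp.
  by rewrite Du_cst Dv_cst !inner0r !addr0 du0 dv0 !mul0r addr0.
have E q : O q -> (G \o t) q = inner (X c q) n.
  move=> [p' [cp' dp'] <-]; rewrite /G /= /t coordK // /local_immersion.
  by rewrite !coordK.
have D0 w' : 'D_w' (G \o t) (coord c p) = 0.
  rewrite deriveE; last exact: differentiable_comp.
  by rewrite diff_comp //= dG0.
have [_ _ eu ev] := gG c ac cp.
have hu := du_ext oO Oq E; have hv := dv_ext oO Oq E.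
split.
- move: hu; rewrite eu Du_cst inner0r addr0 => <-; exact: D0.
- move: hv; rewrite ev Dv_cst inner0r addr0 => <-; exact: D0.
Qed.

Lemma adapted_normal_line c N d p n : atlas c -> atlas d -> adapted_normal c N ->
  chart_dom c p -> chart_dom d p -> unit_normal (X d) (coord d p) n ->
  exists2 s : R, s ^+ 2 = 1 & n = s%:C *: N (coord c p).
Proof.
move=> ac ad [_ Np _ _] cp dp [n1 n2 n3 n4].
have [m1 m2] := inner_chart_change ac ad cp dp n2 n3.
have [a1 a2 a3 a4] := Np _ (cod_coord cp).
have Uq := cod_coord cp.
have D0 : 0 < inner (cross (X c (coord c p)) (Du (X c) (coord c p)) (Dv (X c) (coord c p)))
    (cross (X c (coord c p)) (Du (X c) (coord c p)) (Dv (X c) (coord c p))).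
  have [_ W] := gram_gt0 (X_independent ac Uq).
  have xu := sphere_Du (@chart_cod_open R S c) (X_smooth ac) (@X1 c) Uq.
  have xv := sphere_Dv (@chart_cod_open R S c) (X_smooth ac) (@X1 c) Uq.
  exact: cross_gt0 (X1 Uq) xu xv W.
have n1' : inner n (X c (coord c p)) = 0.
  by rewrite innerC (local_immersion_coord cp) -(local_immersion_coord dp).
exact: (unit_normal_unique D0 a4 a1 a2 a3 n4 n1' (etrans (innerC _ _) m1) (etrans (innerC _ _) m2)).
Qed.

Lemma adapted_unit_normal c N p : adapted_normal c N -> chart_dom c p ->
  unit_normal (X c) (coord c p) (N (coord c p)).
Proof.
move=> [_ Np _ _] cp; have [a1 a2 a3 a4] := Np _ (cod_coord cp).
split; [exact: etrans (innerC _ _) a1|exact: etrans (innerC _ _) a2|exact: etrans (innerC _ _) a3|exact: a4].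
Qed.

(* The two Hopf fibres through [imm p + n] and [imm p - n] are those of [P] and [Q]. *)
Definition splits (P Q : 'rV[R[i]]_2) p : Prop :=
  exists c n, [/\ atlas c, chart_dom c p, unit_normal (X c) (coord c p) n &
   [/\ herm2 (imm p + n) P = 4, herm2 (imm p - n) Q = 4, herm2 (imm p + n) Q = 0 &
       herm2 (imm p - n) P = 0]].

(** The normal witnessing the splitting at p1 may come from another chart; it is s N for a sign s,
    and s N is continued to p2, along which the four moduli are constant. As p1 and p2 are
    interchangeable, the set of splitting points is both open and closed. *)
Lemma splits_locally P Q p : exists2 V : set S, open_nbhs p V &
  forall p1 p2, V p1 -> V p2 -> splits P Q p1 -> splits P Q p2.
Proof.
have [c ac cp] := atlas_cover p; have [N aN] := adapted_normal_exists ac.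
have Uq := cod_coord cp.
have [e e0 eU] := open_box (@chart_cod_open R S c) Uq.
have [kN Np Nm fE] := aN.
have cst w s q := @herm2_locally_constant R (cod c) (X c) N (@chart_cod_open R S c) (X_smooth ac) kN
  (@X1 c) (fun q => X_independent ac) (fun q Uq => let: And4 h _ _ _ := Np q Uq in h)
  (fun q Uq => let: And4 _ h _ _ := Np q Uq in h) (fun q Uq => let: And4 _ _ h _ := Np q Uq in h)
  (fun q Uq => let: And4 _ _ _ h := Np q Uq in h) Nm
  (fun q Uq => etrans (fE q Uq) (sin_contact_angle0 _)) w s q.
have n2 : nbhs p (chart_dom c `&` coord c @^-1` box (coord c p) e).
  apply: filterI; first exact: (open_nbhs_nbhs (conj (@chart_dom_open R S c) cp)).
  apply: (coord_continuous cp); apply: open_nbhs_nbhs; split; [exact: box_open|exact: box_center].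
move: n2; rewrite nbhsE => -[V oV VP]; exists V => // p1 p2 /VP[cp1 b1] /VP[cp2 b2].
move=> [d [n [ad dp1 un [h1 h2 h3 h4]]]].
have [s s2 nE] := adapted_normal_line ac ad aN cp1 dp1 un.
have ms2 : (- s) ^+ 2 = 1 by rewrite sqrrN.
have mE (y : 'rV[R[i]]_2) : - (s%:C *: y) = (- s)%:C *: y.
  by apply: coP; rewrite !coE mulNr.
have T w s' : s' ^+ 2 = 1 -> herm2 (imm p2 + s'%:C *: N (coord c p2)) w =
    herm2 (imm p1 + s'%:C *: N (coord c p1)) w.
  move=> s'2; rewrite -(local_immersion_coord cp1) -(local_immersion_coord cp2).
  by rewrite (cst w s' _ e _ s'2 eU b2) (cst w s' _ e _ s'2 eU b1).
exists c, (s%:C *: N (coord c p2)); split => //.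
- have [u1 u2 u3 u4] := adapted_unit_normal aN cp2.
  by split; rewrite /tangent3 /= !lin_inner ?u1 ?u2 ?u3 ?u4 ?mulr0 // mulr1 -expr2.
- subst n; split; [exact: etrans (T P s s2) h1| |exact: etrans (T Q s s2) h3|].
  + exact: (etrans (congr1 (fun v => herm2 (imm p2 + v) Q) (mE (N (coord c p2))))
      (etrans (T Q (- s) ms2) (etrans (congr1 (fun v => herm2 (imm p1 + v) Q) (esym (mE (N (coord c p1))))) h2))).
  + exact: (etrans (congr1 (fun v => herm2 (imm p2 + v) P) (mE (N (coord c p2))))
      (etrans (T P (- s) ms2) (etrans (congr1 (fun v => herm2 (imm p1 + v) P) (esym (mE (N (coord c p1))))) h4))).
Qed.

Lemma splits_everywhere P Q p0 : splits P Q p0 -> forall p, splits P Q p.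
Proof.
move=> sp0; have [_ _ conS] := hcl.
have loc p : exists2 V : set S, open_nbhs p V &
  forall p1 p2, V p1 -> V p2 -> splits P Q p1 -> splits P Q p2 by exact: splits_locally.
suff : [set p | splits P Q p] = [set: S] by move=> /seteqP[_ h] p; exact: (h p I).
apply: conS; first by exists p0.
- exists [set p | splits P Q p]; last by rewrite setTI.
  rewrite openE => p sp; have [V oV VP] := loc p; have [_ Vp] := oV.
  apply: filterS (open_nbhs_nbhs oV) => p' Vp'; exact: VP Vp Vp' sp.
- exists [set p | splits P Q p]; last by rewrite setTI.
  have -> : [set p | splits P Q p] = ~` (~` [set p | splits P Q p]) by rewrite setCK.
  apply: open_closedC; rewrite openE => p nsp.
  have [V oV VP] := loc p; have [_ Vp] := oV.
  apply: filterS (open_nbhs_nbhs oV) => p' Vp' sp'; apply: nsp; exact: VP Vp' Vp sp'.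
Qed.

(** Since <ix, n> = 0, the vectors x + n and x - n are Hermitian-orthogonal of squared norm 2,
    whence the squared moduli 4 and 0. *)
Lemma splits_self c N p : atlas c -> adapted_normal c N -> chart_dom c p ->
  splits (imm p + N (coord c p)) (imm p - N (coord c p)) p.
Proof.
move=> ac aN cp; exists c, (N (coord c p)); split => //; first exact: adapted_unit_normal.
have [_ Np _ fE] := aN; have Uq := cod_coord cp; have [nx _ _ nn] := Np _ Uq.
have ixn : inner ('i *: imm p) (N (coord c p)) = 0.
  rewrite -(local_immersion_coord cp); exact: (etrans (fE _ Uq) (sin_contact_angle0 _)).
rewrite (local_immersion_coord cp) in nx.
move: (N (coord c p)) nx nn ixn (imm_unit p) => n nx nn ixn xx.
have xn : inner (imm p) n = 0 by rewrite innerC.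
have xin : inner (imm p) ('i *: n) = 0 by rewrite inneriN ixn oppr0.
have nix : inner n ('i *: imm p) = 0 by rewrite innerC.
have xix : inner (imm p) ('i *: imm p) = 0 by rewrite innerC inneriz.
have nin : inner n ('i *: n) = 0 by rewrite innerC inneriz.
rewrite /herm2 !scalerDr !scalerN !lin_inner xx nn xn nx xin nix xix nin.
by split; ring.
Qed.

End Global.

(** * Covering the torus *)

Section TorusAlgebra.
Context {R : realType}.
Implicit Types x y z w n P Q : 'rV[R[i]]_2.

Lemma mul_conjc (z : R[i]) : z * z^* = (complex.Re z ^+ 2 + complex.Im z ^+ 2)%:C.
Proof. by case: z => a b; apply/eqP; rewrite eq_complex /=; apply/andP; split; apply/eqP; ring. Qed.

Lemma half_complex : (2^-1 : R[i]) = (2^-1)%:C.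
Proof. by rewrite fmorphV rmorph_nat. Qed.

Lemma clifford_torusP z : clifford_torus z <->
  c0 z ^+ 2 + c1 z ^+ 2 = 2^-1 /\ c2 z ^+ 2 + c3 z ^+ 2 = 2^-1.
Proof.
rewrite /clifford_torus /= !mul_conjc half_complex /c0 /c1 /c2 /c3.
by split=> [] [h1 h2]; [split; [case: h1|case: h2]|rewrite h1 h2].
Qed.

Lemma herm2E y w : (complex.Re (herm y w)) ^+ 2 + (complex.Im (herm y w)) ^+ 2 = herm2 y w.
Proof. by rewrite hermE. Qed.

Lemma herm2_eq0 y w : herm2 y w = 0 -> inner y w = 0 /\ inner y ('i *: w) = 0.
Proof.
rewrite /herm2 => e; have h0 := sqr_ge0 (inner y w); have h1 := sqr_ge0 (inner y ('i *: w)).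
by split; apply/eqP; rewrite -sqrf_eq0; apply/eqP; lra.
Qed.

(** The two vanishing moduli say that n and x have the same Hermitian product with P and opposite
    ones with Q. So a x + g n has products (a + g) and (a - g) times those of x. *)
Lemma splits_alg x n P Q (a g : R) : inner x x = 1 -> inner n n = 1 -> inner n x = 0 ->
  herm2 (x + n) P = 4 -> herm2 (x - n) Q = 4 -> herm2 (x + n) Q = 0 -> herm2 (x - n) P = 0 ->
  [/\ herm2 x P = 1, herm2 x Q = 1, herm2 (a%:C *: x + g%:C *: n) P = (a + g) ^+ 2 &
      herm2 (a%:C *: x + g%:C *: n) Q = (a - g) ^+ 2].
Proof.
move=> xx nn nx h1 h2 /herm2_eq0[h3 h4] /herm2_eq0[h5 h6].
rewrite !lin_inner in h3 h4 h5 h6.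
have nP : inner n P = inner x P by lra.
have niP : inner n ('i *: P) = inner x ('i *: P) by lra.
have nQ : inner n Q = - inner x Q by lra.
have niQ : inner n ('i *: Q) = - inner x ('i *: Q) by lra.
move: h1 h2; rewrite /herm2 !lin_inner nP niP nQ niQ.
move: (inner x P) (inner x Q) (inner x ('i *: P)) (inner x ('i *: Q)) => p q ip iq h1 h2.
have e1 : p ^+ 2 + ip ^+ 2 = 1 by lra.
have e2 : q ^+ 2 + iq ^+ 2 = 1 by lra.
split => //.
- by rewrite -[RHS]mulr1 -e1; ring.
- by rewrite -[RHS]mulr1 -e2; ring.
Qed.

Lemma torus_critical (a g : R) : 0 < a -> (a + g) ^+ 2 = 1 -> (a - g) ^+ 2 = 1 -> a = 1 /\ g = 0.
Proof.
move=> a0 e1 e2.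
have ag : a * g = 0 by lra.
have g0 : g = 0 by move/eqP: ag; rewrite mulf_eq0 gt_eqF //= => /eqP.
split => //; move: e1; rewrite g0 addr0 => /eqP; rewrite sqrf_eq1 => /orP[/eqP //|/eqP a1].
by move: a0; rewrite a1 ltr0N1.
Qed.

Section Matrix.
Variables P Q : 'rV[R[i]]_2.
Hypotheses (PP : inner P P = 2) (QQ : inner Q Q = 2).
Hypotheses (PQ : inner P Q = 0) (PiQ : inner P ('i *: Q) = 0).

Let r : R := (Num.sqrt 2)^-1.
Let r2 : r * r = 2^-1. Proof. by rewrite /r -invfM -expr2 sqr_sqrtr. Qed.

(** The rows are P and Q divided by sqrt 2, a unitary basis. The coordinate of x along the first is
    [herm x P] / sqrt 2, so that [herm2 x P = 1] means a squared modulus of 1/2, as on the Clifford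
    torus; likewise for Q. *)
Definition hopfmx : 'M[R[i]]_2 :=
  \matrix_(k, j) (if k == 0 then r%:C * P 0 j else r%:C * Q 0 j).

Lemma row_hopfmx0 : row 0 hopfmx = r%:C *: P.
Proof. by apply/rowP => j; rewrite !mxE. Qed.

Lemma row_hopfmx1 : row 1 hopfmx = r%:C *: Q.
Proof. by apply/rowP => j; rewrite !mxE. Qed.

Lemma mul_adj_herm m k (A : 'M[R[i]]_(m, 2)) (B : 'M[R[i]]_(k, 2)) i j :
  (A *m (map_mx Num.conj (trmx B))) i j = herm (row i A) (row j B).
Proof. by rewrite mxE /herm; apply: eq_bigr => l _; rewrite !mxE. Qed.

Lemma ord2P (k : 'I_2) : k = 0 \/ k = 1.
Proof. by case: k => -[|[|]] //= ?; [left|right]; apply/val_inj. Qed.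

Lemma hopfmx_unitary : hopfmx \is unitarymx.
Proof.
apply/unitarymxP/matrixP => i j; rewrite mul_adj_herm hermE.
have ii (s : R) y : 'i *: (s%:C *: y) = s%:C *: ('i *: y) by rewrite !scalerA mulrC.
have iP : inner P ('i *: P) = 0 by rewrite innerC inneriz.
have iQ : inner Q ('i *: Q) = 0 by rewrite innerC inneriz.
have QP : inner Q P = 0 by rewrite innerC.
have QiP : inner Q ('i *: P) = 0 by rewrite inneriN innerC PiQ oppr0.
have r22 : r * (r * 2) = 1 by rewrite mulrA r2 mulVf.
by case: (ord2P i) (ord2P j) => [->|->] [->|->]; rewrite ?row_hopfmx0 ?row_hopfmx1 ii !lin_inner
  ?PP ?QQ ?PQ ?QP ?PiQ ?QiP ?iP ?iQ ?mulr0 ?r22 !mxE.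
Qed.

Lemma clifford_hopfmx x : herm2 x P = 1 -> herm2 x Q = 1 ->
  exists2 z, clifford_torus z & z *m hopfmx = x.
Proof.
move=> xP xQ; exists (x *m (map_mx Num.conj (trmx hopfmx))); last first.
  by rewrite mulmxKtV // hopfmx_unitary.
have ii (s : R) y : 'i *: (s%:C *: y) = s%:C *: ('i *: y) by rewrite !scalerA mulrC.
apply/clifford_torusP; rewrite /c0 /c1 /c2 /c3 !mul_adj_herm row_id row_hopfmx0 row_hopfmx1.
rewrite !herm2E /herm2 !ii !innerZr !exprMn -!mulrDr -/(herm2 x P) -/(herm2 x Q) xP xQ !mulr1.
by rewrite expr2 r2.
Qed.

Lemma inner_hopfmx z w : inner (z *m hopfmx) (w *m hopfmx) = inner z w.
Proof.
have E (u v : 'rV[R[i]]_2) : inner u v = complex.Re ((u *m (map_mx Num.conj (trmx v))) 0 0).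
  by rewrite mul_adj_herm !row_id.
rewrite !E trmx_mul map_mxM mulmxA -[z *m _ *m _]mulmxA.
by rewrite (unitarymxP hopfmx_unitary) mulmx1.
Qed.

Lemma herm2_hopfmx z : clifford_torus z ->
  [/\ herm2 (z *m hopfmx) P = 1, herm2 (z *m hopfmx) Q = 1 & inner (z *m hopfmx) (z *m hopfmx) = 1].
Proof.
move=> /clifford_torusP [z0 z1].
have E x (zx : x = z *m hopfmx) : z = x *m (map_mx Num.conj (trmx hopfmx)).
  by rewrite zx mulmxtVK // hopfmx_unitary.
have ii (s : R) y : 'i *: (s%:C *: y) = s%:C *: ('i *: y) by rewrite !scalerA mulrC.
have [x zx] : exists x, x = z *m hopfmx by exists (z *m hopfmx).
rewrite -zx; have zE := E x zx.
have half (t : R) : r ^+ 2 * t = 2^-1 -> t = 1.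
  rewrite expr2 r2 => h; have := congr1 (fun s => 2 * s) h.
  by rewrite mulrA divff // mul1r.
split.
- apply: half; move: z0; rewrite /c0 /c1 zE mul_adj_herm row_id row_hopfmx0 herm2E.
  by rewrite /herm2 ii !innerZr !exprMn -mulrDr.
- apply: half; move: z1; rewrite /c2 /c3 zE mul_adj_herm row_id row_hopfmx1 herm2E.
  by rewrite /herm2 ii !innerZr !exprMn -mulrDr.
- rewrite zx inner_hopfmx innerE -!expr2 z0 -addrA z1.
  lra.
Qed.
End Matrix.

(* A quarter turn of one coordinate followed by a turn of at most a quarter. *)
Lemma clifford_torus_reach (A : set 'rV[R[i]]_2) :
  (forall z w, A z -> clifford_torus z -> clifford_torus w -> 0 < inner z w -> A w) ->
  forall z w, A z -> clifford_torus z -> clifford_torus w -> A w.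
Proof.
move=> step z w Az /clifford_torusP[z0 z1] /clifford_torusP[w0 w1].
have turn (p q s t : R) : p ^+ 2 + q ^+ 2 = 2^-1 -> s ^+ 2 + t ^+ 2 = 2^-1 ->
  exists u v : R, [/\ u ^+ 2 + v ^+ 2 = 2^-1, p * u + q * v = 0 & 0 <= u * s + v * t].
  move=> pq st; have [h|h] := leP 0 (- q * s + p * t).
    exists (- q), p; split => //; [by rewrite sqrrN addrC|by ring].
  exists q, (- p); split; [by rewrite sqrrN addrC|by ring|].
  by move: h; lra.
have h2 : (0 : R) < 2^-1 by rewrite invr_gt0.
have [u [v [uv1 uv2 uv3]]] := turn _ _ _ _ z0 w0.
have [s [t [st1 st2 st3]]] := turn _ _ _ _ z1 w1.
(* Each of the four steps moves one complex coordinate by at most a quarter turn and keeps the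
   other, which alone contributes 1/2 to the inner product; it therefore stays positive. *)
have A1 : A (vec4 u v (c2 z) (c3 z)).
  apply: (step z) => //; [exact/clifford_torusP|by apply/clifford_torusP; rewrite !coE|].
  by rewrite innerE !coE -!expr2 uv2 add0r z1.
have A2 : A (vec4 (c0 w) (c1 w) (c2 z) (c3 z)).
  apply: (step _ _ A1); try (by apply/clifford_torusP; rewrite !coE).
  by rewrite innerE !coE -!expr2 -addrA z1 ltr_wpDl.
have A3 : A (vec4 (c0 w) (c1 w) s t).
  apply: (step _ _ A2); try (by apply/clifford_torusP; rewrite !coE).
  by rewrite innerE !coE -!expr2 w0 -addrA st2 addr0.
apply: (step _ _ A3); first (by apply/clifford_torusP; rewrite !coE).
  exact/clifford_torusP.
by rewrite innerE !coE -!expr2 w0 -addrA ltr_pwDl.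
Qed.
End TorusAlgebra.

(** * The image is a full torus *)

Section Image.
Context {R : realType}.
Variables (S : immersed_surface R) (beta : S -> R) (tau : R).
Hypotheses (hmin : minimal S) (hca : contact_angle beta).
Hypothesis (tau2 : tau ^+ 2 = 1).
Hypothesis (hcl : closed_surface S).
Hypothesis (g0 : forall p, 0 <= tau * sin (beta p)).

Local Notation cod c := (coord c @` chart_dom c).
Local Notation X c := (@local_immersion R S c).
Local Notation imm := (@immersion R S).

Lemma inner_imm_continuous y : continuous (fun p : S => inner (imm p) y).
Proof.
move=> p; have [c ac cp] := atlas_cover p.
have kX := smooth_Vk 0 (X_smooth ac).
have fc := Ck_inner (@chart_cod_open R S c) kX (Vk_cst 0 (cod c) y).
have near_f : \forall p' \near p, inner (X c (coord c p')) y = inner (imm p') y.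
  have := open_nbhs_nbhs (conj (@chart_dom_open R S c) cp).
  by apply: filterS => p' cp'; rewrite local_immersion_coord.
have h : (fun p' => inner (X c (coord c p')) y) @ p --> inner (imm p) y.
  rewrite -(local_immersion_coord cp).
  apply: (@continuous_comp _ _ _ (coord c) (fun q => inner (X c q) y)); first exact: (coord_continuous cp).
  exact: (fc _ (cod_coord cp)).
by apply: cvg_trans h; apply: near_eq_cvg; exact: near_f.
Qed.

(** At a maximum x of <X, y> the vector y is orthogonal to the tangent plane, so y = a x + g n with
    a > 0. By [splits_alg], y being on the torus means (a + g)^2 = (a - g)^2 = 1, which leaves only
    a = 1 and g = 0. *)
Lemma image_step P Q y p : (forall p : S, splits P Q p) ->
  herm2 y P = 1 -> herm2 y Q = 1 -> inner y y = 1 -> 0 < inner (imm p) y ->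
  range imm y.
Proof.
move=> sp yP yQ yy py; have [S0 cS _] := hcl.
have [p1 _ p1max] := compact_EVT_max S0 cS (continuous_subspaceT (inner_imm_continuous (y := y))).
have a0 : 0 < inner (imm p1) y by apply: lt_le_trans py (p1max p _); rewrite inE.
have [c [n [ac cp un [h1 h2 h3 h4]]]] := sp p1.
have [xn un2 vn nn] := un.
have Uq := cod_coord cp; have oU := @chart_cod_open R S c.
have kX := smooth_Vk 1 (X_smooth ac).
have gy q (Uq' : cod c q) := has_grad_inner oU kX (Vk_cst 1 _ y) Uq'.
have [e e0 eU] := open_box oU Uq.
have gN q (Uq' : cod c q) : has_grad (fun q => -1 * inner (X c q) y) q
    (- inner (Du (X c) q) y) (- inner (Dv (X c) q) y).
  apply: (has_grad_eq (has_gradM (has_grad_cst (-1) q) (gy q Uq'))).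
    by rewrite Du_cst inner0r addr0 mul0r add0r mulN1r.
  by rewrite Dv_cst inner0r addr0 mul0r add0r mulN1r.
have lm : local_min (fun q => -1 * inner (X c q) y) (coord c p1).
  exists e => // q /eU [p' cp' <-]; rewrite !local_immersion_coord // !mulN1r lerN2.
  by apply: p1max; rewrite inE.
have [_ _ eu ev] := gN _ Uq.
have du0 : inner (Du (X c) (coord c p1)) y = 0.
  have H : 'D_((1 : R), (0 : R)) (fun q => -1 * inner (X c q) y) (coord c p1) = 0.
    apply: (local_min_derive lm); exists e; first exact: e0.
    by move=> q /eU Uq'; have [d _ _ _] := gN q Uq'; exact: d.
  by apply/eqP; rewrite -oppr_eq0; apply/eqP; rewrite -eu; exact: H.
have dv0 : inner (Dv (X c) (coord c p1)) y = 0.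
  have H : 'D_((0 : R), (1 : R)) (fun q => -1 * inner (X c q) y) (coord c p1) = 0.
    apply: (local_min_derive lm); exists e; first exact: e0.
    by move=> q /eU Uq'; have [_ d _ _] := gN q Uq'; exact: d.
  by apply/eqP; rewrite -oppr_eq0; apply/eqP; rewrite -ev; exact: H.
pose x := X c (coord c p1); have xE : x = imm p1 by exact: local_immersion_coord.
have xx : inner x x = 1 by exact: X1.
have nx : inner n x = 0 by rewrite innerC.
have xu := sphere_Du oU (X_smooth ac) (@X1 R S c) Uq.
have xv := sphere_Dv oU (X_smooth ac) (@X1 R S c) Uq.
have nu : inner n (Du (X c) (coord c p1)) = 0 := etrans (innerC _ _) un2.
have nv : inner n (Dv (X c) (coord c p1)) = 0 := etrans (innerC _ _) vn.
have yE : y = (inner x y)%:C *: x + (inner n y)%:C *: n.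
  have [_ W] := gram_gt0 (X_independent ac Uq).
  apply/eqP; rewrite -subr_eq0; apply/eqP.
  apply: (orth_basis_eq0 (cross_gt0 xx xu xv W) nn nx nu nv).
  - by rewrite !lin_inner xx nx (innerC y) mulr1 mulr0 addr0 subrr.
  - by rewrite !lin_inner xu (innerC y) du0 nu !mulr0 addr0 subrr.
  - by rewrite !lin_inner xv (innerC y) dv0 nv !mulr0 addr0 subrr.
  - by rewrite !lin_inner xn nn (innerC y) mulr1 mulr0 add0r subrr.
rewrite -xE in h1 h2 h3 h4 a0.
move: yE a0; move: (inner x y) (inner n y) => a g yE a0.
have [_ _ eP eQ] := splits_alg a g xx nn nx h1 h2 h3 h4.
rewrite -yE yP in eP; rewrite -yE yQ in eQ.
have [a1 gg0] := torus_critical a0 (esym eP) (esym eQ).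
exists p1 => //; rewrite -xE yE a1 gg0.
by apply: coP; rewrite !coE; ring.
Qed.

Lemma image_hopf_torus : exists2 U : 'M[R[i]]_2, U \is unitarymx &
  range imm = (fun z => z *m U) @` @clifford_torus R.
Proof.
have [[p0 _] _ _] := hcl.
have [c ac cp] := atlas_cover p0.
have [N aN] := adapted_normal_exists hmin hca tau2 ac.
have ss := splits_self hmin hca tau2 hcl g0 ac aN cp.
pose P := imm p0 + N (coord c p0); pose Q := imm p0 - N (coord c p0).
have sp : forall p, splits P Q p := splits_everywhere hmin hca tau2 hcl g0 ss.
have [_ Np _ fE] := aN; have Uq := cod_coord cp; have [nx _ _ nn] := Np _ Uq.
have ixn : inner ('i *: imm p0) (N (coord c p0)) = 0.
  rewrite -(local_immersion_coord cp).
  exact: (etrans (fE _ Uq) (sin_contact_angle0 hmin hca tau2 hcl g0 _)).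
rewrite (local_immersion_coord cp) in nx.
have xx := imm_unit p0.
have [PP QQ PQ PiQ] : [/\ inner P P = 2, inner Q Q = 2, inner P Q = 0 & inner P ('i *: Q) = 0].
  rewrite /P /Q; move: (N (coord c p0)) nx nn ixn xx => n nx nn ixn xx.
  have xn : inner (imm p0) n = 0 by rewrite innerC.
  have xin : inner (imm p0) ('i *: n) = 0 by rewrite inneriN ixn oppr0.
  have nix : inner n ('i *: imm p0) = 0 by rewrite innerC.
  have xix : inner (imm p0) ('i *: imm p0) = 0 by rewrite innerC inneriz.
  have nin : inner n ('i *: n) = 0 by rewrite innerC inneriz.
  by rewrite !scalerDr !scalerN !lin_inner xx nn xn nx xin nix xix nin; split; ring.
have UU := hopfmx_unitary PP QQ PQ PiQ.
have sub p : exists2 z, clifford_torus z & z *m hopfmx P Q = imm p.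
  have [d [n [_ dp [xn _ _ n1] [h1 h2 h3 h4]]]] := sp p.
  have nx' : inner n (imm p) = 0 by rewrite innerC -(local_immersion_coord dp).
  have [e1 e2 _ _] := splits_alg 0 0 (imm_unit p) n1 nx' h1 h2 h3 h4.
  exact: (clifford_hopfmx PP QQ PQ PiQ e1 e2).
exists (hopfmx P Q) => //; apply/seteqP; split.
  by move=> _ [p _ <-]; have [z cz zE] := sub p; exists z.
move=> _ [w cw <-]; have [z cz zE] := sub p0.
apply: (@clifford_torus_reach R [set z | range imm (z *m hopfmx P Q)] _ z w) => //; last first.
  by rewrite /= zE; exists p0.
move=> {cz zE cw} {}z {}w /= [p _ pE] cz cw zw.
have [wP wQ ww] := herm2_hopfmx PP QQ PQ PiQ cw.
apply: (image_step (p := p) sp wP wQ ww).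
by rewrite pE inner_hopfmx.
Qed.
End Image.

(** The sign [tau] is 1 on the first interval and -1 on the second, which makes [tau * sin beta]
    nonnegative. *)
Lemma range_eq_unitary_clifford (R : realType) (I : interval R) (S : immersed_surface R) (beta : S -> R) :
  (I = `[0, pi / 2[) \/ (I = `]-(pi / 2), 0]) ->
  closed_surface S -> minimal S -> contact_angle beta -> (forall p, beta p \in I) ->
  exists2 U : 'M[R[i]]_2, U \is unitarymx &
    range (@immersion R S) = (fun z => z *m U) @` @clifford_torus R.
Proof.
have pi2 : pi / 2 <= pi :> R by rewrite ler_pdivrMr // ler_peMr ?pi_ge0 // ler1n.
move=> [->|->] hcl hmin hca bI.
  apply: (@image_hopf_torus R S beta 1) => //; first by rewrite expr1n.
  move=> p; have := bI p; rewrite in_itv /= => /andP[b0 b1].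
  by rewrite mul1r sin_ge0_pi // b0 (le_trans (ltW b1)).
apply: (@image_hopf_torus R S beta (-1)) => //; first by rewrite sqrrN expr1n.
move=> p; have := bI p; rewrite in_itv /= => /andP[b0 b1].
rewrite mulN1r -sinN sin_ge0_pi // oppr_ge0 b1 /=.
by apply: le_trans pi2; rewrite lerNl ltW.
Qed.

(** * The Clifford torus as a surface *)

Section TorusParam.
Context {R : realType}.
Implicit Types (q : R * R) (a b c d : R).

(* The map (s, t) |-> ((a + ib) e^(is), (c + id) e^(it)). *)
Definition rot4 a b c d q : 'rV[R[i]]_2 :=
  vec4 (a * cos q.1 - b * sin q.1) (a * sin q.1 + b * cos q.1)
       (c * cos q.2 - d * sin q.2) (c * sin q.2 + d * cos q.2).

Lemma inner_rot4 a b c d a' b' c' d' q :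
  inner (rot4 a b c d q) (rot4 a' b' c' d' q) = a * a' + b * b' + c * c' + d * d'.
Proof.
rewrite innerE /rot4 !coE.
have e1 := cos2Dsin2 q.1; have e2 := cos2Dsin2 q.2.
transitivity ((a * a' + b * b') * (cos q.1 ^+ 2 + sin q.1 ^+ 2) +
  (c * c' + d * d') * (cos q.2 ^+ 2 + sin q.2 ^+ 2)).
  move: (cos q.1) (sin q.1) (cos q.2) (sin q.2) => *; ring.
by rewrite e1 e2 !mulr1 addrA.
Qed.

Lemma i_rot4 a b c d q : 'i *: rot4 a b c d q = rot4 (- b) a (- d) c q.
Proof. by apply: coP; rewrite /rot4 !coE; ring. Qed.

Lemma rcomb_rot4 s t a b c d a' b' c' d' q :
  rcomb s t (rot4 a b c d q) (rot4 a' b' c' d' q) =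
  rot4 (s * a + t * a') (s * b + t * b') (s * c + t * c') (s * d + t * d') q.
Proof. by apply: coP; rewrite !rcombE /rot4 !coE; ring. Qed.

Lemma has_grad_comp_lin2 (h : R -> R) (dh u v : R) q :
  is_derive (lin2 u v q) 1 h dh -> has_grad (h \o lin2 u v) q (dh * u) (dh * v).
Proof.
move=> hd; have df : differentiable (lin2 u v) q by exact/linear_differentiable/lin2_continuous.
have [d1 e1] := derive_comp1 (1, 0) df hd; have [d2 e2] := derive_comp1 (0, 1) df hd.
split; [exact: d1|exact: d2| |].
- by apply: etrans e1 _; rewrite -/(du _ _) du_lin2.
- by apply: etrans e2 _; rewrite -/(dv _ _) dv_lin2.
Qed.

(** The real part of (a + ib) e^(i theta) with theta linear. Differentiation replaces (a, b) by a
    multiple of (-b, a), so the family is stable under [du] and [dv] and its smoothness follows by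
    induction. *)
Definition trig_lin u v a b q : R := a * cos (lin2 u v q) - b * sin (lin2 u v q).

Lemma has_grad_trig u v a b q : has_grad (trig_lin u v a b) q
  (u * trig_lin u v (- b) a q) (v * trig_lin u v (- b) a q).
Proof.
have gc := has_grad_comp_lin2 (is_derive_cos (lin2 u v q)).
have gs := has_grad_comp_lin2 (is_derive_sin (lin2 u v q)).
have E : (fun q => a * (@cos R \o lin2 u v) q + - b * (@sin R \o lin2 u v) q) = trig_lin u v a b.
  by apply/funext => x; rewrite /trig_lin mulNr.
have G := has_gradD (has_gradM (has_grad_cst a q) gc) (has_gradM (has_grad_cst (- b) q) gs).
rewrite E in G; apply: (has_grad_eq G); rewrite /trig_lin /=;
  move: (cos (lin2 u v q)) (sin (lin2 u v q)) => *; ring.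
Qed.

Lemma Ck_on_trig k U u v a b : Ck_on k U (trig_lin u v a b).
Proof.
have Z t c d : (fun q => t * trig_lin u v c d q) = trig_lin u v (t * c) (t * d).
  by apply/funext => q; rewrite /trig_lin; ring.
elim: k a b => [|k IH] a b.
  move=> q _; have [d1 d2 _ _] := has_grad_trig u v a b q.
  have oT : open [set: R * R] by exact: openT.
  rewrite /trig_lin; apply: (@continuousD _ R^o).
    apply: continuousM; first exact: cst_continuous.
    by apply: continuous_comp; [exact: lin2_continuous|exact: continuous_cos].
  apply: (@continuousN _ R^o); apply: continuousM; first exact: cst_continuous.
  by apply: continuous_comp; [exact: lin2_continuous|exact: continuous_sin].
split.
- by move=> q _; have [d1 d2 _ _] := has_grad_trig u v a b q; split; [exact: d1|exact: d2].
- have -> : du (trig_lin u v a b) = trig_lin u v (u * - b) (u * a).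
    by rewrite -Z; apply/funext => q; have [_ _ e _] := has_grad_trig u v a b q.
  exact: IH.
- have -> : dv (trig_lin u v a b) = trig_lin u v (v * - b) (v * a).
    by rewrite -Z; apply/funext => q; have [_ _ _ e] := has_grad_trig u v a b q.
  exact: IH.
Qed.

Let rot4_coord a b c d : [/\ (fun q => c0 (rot4 a b c d q)) = trig_lin 1 0 a b,
  (fun q => c1 (rot4 a b c d q)) = trig_lin 1 0 b (- a),
  (fun q => c2 (rot4 a b c d q)) = trig_lin 0 1 c d &
  (fun q => c3 (rot4 a b c d q)) = trig_lin 0 1 d (- c)].
Proof.
by split; apply/funext => q; rewrite /rot4 /trig_lin /lin2 !coE !(mul1r, mul0r, addr0, add0r); ring.
Qed.

Lemma rot4_smooth U a b c d : smooth_map_on U (rot4 a b c d).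
Proof.
have [e0 e1 e2 e3] := rot4_coord a b c d.
move=> j; case: (ord2P j) => ->; split => k.
- by move: (Ck_on_trig k U 1 0 a b); rewrite -e0.
- by move: (Ck_on_trig k U 1 0 b (- a)); rewrite -e1.
- by move: (Ck_on_trig k U 0 1 c d); rewrite -e2.
- by move: (Ck_on_trig k U 0 1 d (- c)); rewrite -e3.
Qed.

Lemma Du_rot4 a b c d : Du (rot4 a b c d) = rot4 (- b) a 0 0.
Proof.
have [e0 e1 e2 e3] := rot4_coord a b c d.
have [f0 f1 f2 f3] := rot4_coord (- b) a 0 0.
apply/funext => q; apply: coP.
- rewrite Du_c0 e0 -[RHS]/((fun q => c0 (rot4 (- b) a 0 0 q)) q) f0.
  by have [_ _ -> _] := has_grad_trig 1 0 a b q; rewrite mul1r.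
- rewrite Du_c1 e1 -[RHS]/((fun q => c1 (rot4 (- b) a 0 0 q)) q) f1.
  by have [_ _ -> _] := has_grad_trig 1 0 b (- a) q; rewrite mul1r !opprK.
- rewrite Du_c2 e2; have [_ _ -> _] := has_grad_trig 0 1 c d q.
  by rewrite /rot4 !coE; ring.
- rewrite Du_c3 e3; have [_ _ -> _] := has_grad_trig 0 1 d (- c) q.
  by rewrite /rot4 !coE; ring.
Qed.

Lemma Dv_rot4 a b c d : Dv (rot4 a b c d) = rot4 0 0 (- d) c.
Proof.
have [e0 e1 e2 e3] := rot4_coord a b c d.
have [f0 f1 f2 f3] := rot4_coord 0 0 (- d) c.
apply/funext => q; apply: coP.
- rewrite Dv_c0 e0; have [_ _ _ ->] := has_grad_trig 1 0 a b q.
  by rewrite /rot4 !coE; ring.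
- rewrite Dv_c1 e1; have [_ _ _ ->] := has_grad_trig 1 0 b (- a) q.
  by rewrite /rot4 !coE; ring.
- rewrite Dv_c2 e2 -[RHS]/((fun q => c2 (rot4 0 0 (- d) c q)) q) f2.
  by have [_ _ _ ->] := has_grad_trig 0 1 c d q; rewrite mul1r.
- rewrite Dv_c3 e3 -[RHS]/((fun q => c3 (rot4 0 0 (- d) c q)) q) f3.
  by have [_ _ _ ->] := has_grad_trig 0 1 d (- c) q; rewrite mul1r !opprK.
Qed.

Let r : R := (Num.sqrt 2)^-1.
Let r2 : r * r = 2^-1. Proof. by rewrite /r -invfM -expr2 sqr_sqrtr. Qed.
Let r0 : 0 < r. Proof. by rewrite invr_gt0 sqrtr_gt0. Qed.

Definition torus_map : R * R -> 'rV[R[i]]_2 := rot4 r 0 r 0.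

Lemma torus_map_clifford q : clifford_torus (torus_map q).
Proof.
apply/clifford_torusP; rewrite /torus_map /rot4 !coE !mul0r !subr0 !addr0 !exprMn -!mulrDr.
by rewrite !cos2Dsin2 !mulr1 expr2 r2.
Qed.

Lemma angle_exists (x y : R) : x ^+ 2 + y ^+ 2 = 2^-1 ->
  exists2 s, `|s| <= pi & x = r * cos s /\ y = r * sin s.
Proof.
move=> xy; pose u := x / r; pose v := y / r.
have rn0 : r != 0 by rewrite gt_eqF.
have uv : u ^+ 2 + v ^+ 2 = 1.
  by rewrite /u /v !exprMn -mulrDl xy exprVn expr2 r2 divff // invr_eq0.
have u1 : -1 <= u <= 1.
  rewrite -ler_norml -(ler_pXn2r (n := 2)) ?nnegrE // expr1n real_normK ?num_real //.
  by rewrite -uv lerDl sqr_ge0.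
have uI : u \in `[(-1), 1] by rewrite in_itv.
have xE : x = r * u by rewrite /u mulrC divfK.
have yE : y = r * v by rewrite /v mulrC divfK.
have sa : sin (acos u) = `|v|.
  by rewrite sin_acos // -uv addrC addKr sqrtr_sqr.
have ap : `|acos u| <= pi by rewrite ger0_norm ?acos_ge0 // acos_lepi.
have [v0|v0] := leP 0 v.
  by exists (acos u); rewrite // acosK // sa ger0_norm.
exists (- acos u); first by rewrite normrN.
by rewrite cosN sinN acosK // sa ltr0_norm // opprK.
Qed.

Lemma torus_map_surj z : clifford_torus z ->
  exists2 q, `|q.1| <= pi /\ `|q.2| <= pi & torus_map q = z.
Proof.
move=> /clifford_torusP[/angle_exists[s sp [x0 x1]] /angle_exists[t tp [x2 x3]]].
exists (s, t) => //; apply: coP; rewrite /torus_map /rot4 !coE /= !mul0r ?subr0 ?addr0 //.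
Qed.

(** Membership in 2 pi Z, expressed by trigonometric values so that no integer has to be
    extracted. *)
Definition period (k : R) := cos k = 1 /\ sin k = 0.

Lemma torus_map_period q q' : torus_map q = torus_map q' ->
  period (q'.1 - q.1) /\ period (q'.2 - q.2).
Proof.
have aux (s t : R) : cos s = cos t -> sin s = sin t -> period (t - s).
  move=> c e; split; [rewrite cosB|rewrite sinB]; rewrite c e; last by ring.
  by rewrite -!expr2 cos2Dsin2.
have rI := mulfI (lt0r_neq0 r0).
move=> e; have [h0 h1 h2 h3] : [/\ cos q.1 = cos q'.1, sin q.1 = sin q'.1, cos q.2 = cos q'.2 & sin q.2 = sin q'.2].
  split; apply: rI.
  - by have := congr1 (@c0 R) e; rewrite /torus_map /rot4 !coE !mul0r !subr0.
  - by have := congr1 (@c1 R) e; rewrite /torus_map /rot4 !coE !mul0r !addr0.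
  - by have := congr1 (@c2 R) e; rewrite /torus_map /rot4 !coE !mul0r !subr0.
  - by have := congr1 (@c3 R) e; rewrite /torus_map /rot4 !coE !mul0r !addr0.
by split; exact: aux.
Qed.

Lemma torus_mapD q k : period k.1 -> period k.2 -> torus_map (q + k) = torus_map q.
Proof.
move=> [c1 s1] [c2 s2]; have e (s t : R) : cos t = 1 -> sin t = 0 -> cos (s + t) = cos s /\ sin (s + t) = sin s.
  by move=> c e; rewrite cosD sinD c e !mulr1 !mulr0 subr0 addr0.
have [a1 b1] := e q.1 k.1 c1 s1; have [a2 b2] := e q.2 k.2 c2 s2.
by rewrite /torus_map /rot4 /= a1 b1 a2 b2.
Qed.

Lemma period_small k : period k -> `|k| < pi -> k = 0.
Proof.
move=> [ck _] kp; apply/eqP; rewrite -normr_eq0; apply/eqP.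
apply: cos_inj; rewrite ?in_itv /= ?lexx ?pi_ge0 ?normr_ge0 ?(ltW kp) //.
by rewrite cos0; case: (ler0P k) => _; rewrite ?cosN.
Qed.

End TorusParam.

(** Membership is made Boolean so that a point is determined by its underlying vector. *)
Definition clifford_point (R : realType) := {z : 'rV[R[i]]_2 | `[< clifford_torus z >]}.

(** * The quotient topology, the atlas and the immersion of the torus *)

Section CliffordSpace.
Context {R : realType}.
Implicit Types (q k : R * R) (p : clifford_point R).

Definition torus_proj q : clifford_point R :=
  exist _ (torus_map q) (asboolT (torus_map_clifford q)).

HB.instance Definition _ := Choice.on (clifford_point R).

(** The quotient topology for [torus_proj], which makes continuity of the projection, hence of the
    inverses of the charts, immediate. *)
Definition clifford_open (A : set (clifford_point R)) : Prop := open (torus_proj @^-1` A).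

Let clifford_openT : clifford_open setT. Proof. exact: openT. Qed.
Let clifford_openI : setI_closed clifford_open.
Proof. by move=> A B oA oB; exact: openI. Qed.
Let clifford_open_bigU (I : Type) (f : I -> set (clifford_point R)) :
  (forall i, clifford_open (f i)) -> clifford_open (\bigcup_i f i).
Proof. by move=> fo; rewrite /clifford_open preimage_bigcup; apply: bigcup_open => i _; exact: fo. Qed.

HB.instance Definition _ := isOpenTopological.Build (clifford_point R)
  clifford_openT clifford_openI clifford_open_bigU.

Lemma open_cliffordE (A : set (clifford_point R)) : open A = open (torus_proj @^-1` A).
Proof. by []. Qed.

Lemma torus_proj_eq q q' : torus_proj q = torus_proj q' <-> torus_map q = torus_map q'.
Proof. by split=> [/(congr1 val) //|e]; apply/val_inj. Qed.

Lemma torus_proj_surj p : exists2 q, `|q.1| <= pi /\ `|q.2| <= pi & torus_proj q = p.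
Proof.
case: p => z zc; have [q qp qz] := torus_map_surj (asboolW zc).
by exists q => //; apply/val_inj.
Qed.

Lemma torus_proj_continuous : continuous torus_proj.
Proof.
move=> q A; rewrite nbhsE => -[B [oB Bq] BA]; rewrite nbhs_filterE nbhsE.
by exists (torus_proj @^-1` B); [split|move=> x /BA].
Qed.

Let translation_continuous k : continuous (fun q => q + k).
Proof. by move=> q; apply: cvgD; [exact: cvg_id|exact: cvg_cst]. Qed.

(** A point with the same image as some q0 in O differs from it by a pair of periods, and
    translating by these periods carries a neighbourhood of the point into O without changing the
    image. *)
Lemma torus_proj_open (O : set (R * R)) : open O -> open (torus_proj @` O).
Proof.
move=> oO; rewrite open_cliffordE openE => q [q0 Oq0 /torus_proj_eq e].
have [k1 k2] := torus_map_period (esym e); pose k := q0 - q.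
have Ok : nbhs (q + k) O by rewrite /k addrC subrK; exact: open_nbhs_nbhs.
have H : nbhs q [set x | O (x + k)] := translation_continuous Ok.
apply: filterS H => x Ox; exists (x + k); first exact: Ox.
by apply/torus_proj_eq; exact: torus_mapD.
Qed.

(** The half-width pi / 2 keeps differences of coordinates below pi in absolute value, the range in
    which [period_small] leaves only 0. *)
Lemma torus_proj_inj (t : R * R) q q' : box t (pi / 2) q -> box t (pi / 2) q' ->
  torus_proj q = torus_proj q' -> q = q'.
Proof.
have near (a b c : R) : `|a - c| < pi / 2 -> `|b - c| < pi / 2 -> `|b - a| < pi.
  move=> ac bc; rewrite -[b](subrK c) -addrA; apply: le_lt_trans (ler_normD _ _) _.
  by rewrite [pi]splitr ltrD // distrC.
move=> [a1 a2] [b1 b2] /torus_proj_eq /torus_map_period [p1 p2].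
have := period_small p1 (near _ _ _ a1 b1); have := period_small p2 (near _ _ _ a2 b2).
case: q q' {a1 a2 b1 b2 p1 p2} => x y [x' y'] /= /eqP + /eqP.
by rewrite !subr_eq0 => /eqP -> /eqP ->.
Qed.

Let pi2 : 0 < pi / 2 :> R. Proof. by rewrite divr_gt0 ?pi_gt0. Qed.

Section chart.
Variable t : R * R.

Definition torus_dom : set (clifford_point R) := torus_proj @` box t (pi / 2).

Definition torus_coord p : R * R := xget 0 [set q | box t (pi / 2) q /\ torus_proj q = p].

Lemma torus_coordK q : box t (pi / 2) q -> torus_coord (torus_proj q) = q.
Proof.
move=> bq; rewrite /torus_coord.
case: xgetP => [x _ [bx e]|/(_ q)]; first exact: torus_proj_inj bx bq e.
by move=> /not_andP[].
Qed.

Lemma torus_cod : torus_coord @` torus_dom = box t (pi / 2).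
Proof.
apply/seteqP; split=> [_ [_ [q bq <-] <-]|q bq]; first by rewrite torus_coordK.
by exists (torus_proj q); [exists q|rewrite torus_coordK].
Qed.

Let dom_open : open torus_dom. Proof. exact/torus_proj_open/box_open. Qed.
Let cod_open : open (torus_coord @` torus_dom). Proof. by rewrite torus_cod; exact: box_open. Qed.
Let coord_projK p : torus_dom p -> torus_proj (torus_coord p) = p.
Proof. by move=> [q bq <-]; rewrite torus_coordK. Qed.
Let coord_cont p : torus_dom p -> {for p, continuous torus_coord}.
Proof.
move=> [q bq <-] A; rewrite torus_coordK // nbhsE => -[B [oB Bq] BA].
rewrite nbhs_filterE nbhsE; exists (torus_proj @` (B `&` box t (pi / 2))).
  split; last by exists q.
  by apply: torus_proj_open; apply: openI => //; exact: box_open.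
by move=> _ [x [Bx bx] <-]; rewrite /= torus_coordK //; exact: BA.
Qed.
Let proj_cont q : (torus_coord @` torus_dom) q -> {for q, continuous torus_proj}.
Proof. by move=> _; exact: torus_proj_continuous. Qed.

Definition torus_chart : chart R (clifford_point R) :=
  Chart dom_open cod_open coord_projK coord_cont proj_cont.
End chart.

Definition torus_atlas : set (chart R (clifford_point R)) := range torus_chart.

Let torus_cover p : exists2 c, torus_atlas c & chart_dom c p.
Proof.
have [q _ <-] := torus_proj_surj p; exists (torus_chart q); first by exists q.
by exists q => //; exact: box_center.
Qed.

Lemma Ck_on_local m (U : set (R * R)) (f : R * R -> R) :
  (forall q, U q -> exists V, [/\ open V, V q & Ck_on m V f]) -> Ck_on m U f.
Proof.
elim: m f => [|m IH] f H; first by move=> q /H[V [_ Vq]]; apply.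
split.
- by move=> q /H[V [_ Vq [df _ _]]]; exact: df.
- by apply: IH => q /H[V [oV Vq [_ fu _]]]; exists V.
- by apply: IH => q /H[V [oV Vq [_ _ fv]]]; exists V.
Qed.

(** Transition maps are translations by periods, but only locally: the vector may change from one
    component of the overlap to another, which is why smoothness is checked through
    [Ck_on_local]. *)
Lemma torus_transition t t' q : (torus_coord t @` (torus_dom t `&` torus_dom t')) q ->
  exists k V, [/\ open V, V q & forall x, V x -> torus_coord t' (torus_proj x) = x + k].
Proof.
move=> [_ [[q1 b1 <-] [q2 b2 /torus_proj_eq e]] <-]; rewrite torus_coordK //.
have [k1 k2] := torus_map_period (esym e); pose k := q2 - q1.
exists k, ((fun x => x + k) @^-1` box t' (pi / 2)); split.
- by apply: open_comp; [move=> x _; exact: translation_continuous|exact: box_open].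
- by rewrite /preimage /= /k addrC subrK.
- move=> x bx; rewrite -(torus_coordK bx); congr (torus_coord t' _).
  by apply/torus_proj_eq; rewrite torus_mapD.
Qed.

Let shift_grad (u v c : R) q : has_grad (fun x => lin2 u v x + c) q u v.
Proof. by apply: has_grad_eq (has_gradD (has_grad_lin2 u v q) (has_grad_cst c q)) _ _; rewrite addr0. Qed.

Let shift_Ck m U (u v c : R) : open U -> Ck_on m U (fun x => lin2 u v x + c).
Proof. by move=> oU; exact: (Ck_on_add oU (Ck_on_lin2 m U u v) (Ck_on_cst m U c)). Qed.

Let shiftE1 q k : (q + k).1 = lin2 1 0 q + k.1.
Proof. by rewrite /lin2 mul1r mul0r addr0. Qed.
Let shiftE2 q k : (q + k).2 = lin2 0 1 q + k.2.
Proof. by rewrite /lin2 mul1r mul0r add0r. Qed.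

Let torus_smooth c d : torus_atlas c -> torus_atlas d ->
  smooth_pair_on (coord c @` (chart_dom c `&` chart_dom d)) (fun q => coord d (param c q)).
Proof.
move=> [t _ <-] [t' _ <-]; split => m; apply: Ck_on_local => q /torus_transition[k [V [oV Vq H]]];
  exists V; split => //.
- by apply: (Ck_on_ext oV _ (shift_Ck m 1 0 k.1 oV)) => x Vx; rewrite /= H // shiftE1.
- by apply: (Ck_on_ext oV _ (shift_Ck m 0 1 k.2 oV)) => x Vx; rewrite /= H // shiftE2.
Qed.

Let torus_oriented c d : torus_atlas c -> torus_atlas d ->
  forall q, (coord c @` (chart_dom c `&` chart_dom d)) q ->
    0 < Defs.jacobian (fun q => coord d (param c q)) q.
Proof.
move=> [t _ <-] [t' _ <-] q /torus_transition[k [V [oV Vq H]]].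
have e1 x : V x -> lin2 1 0 x + k.1 = (coord (torus_chart t') (param (torus_chart t) x)).1.
  by move=> Vx; rewrite /= H // shiftE1.
have e2 x : V x -> lin2 0 1 x + k.2 = (coord (torus_chart t') (param (torus_chart t) x)).2.
  by move=> Vx; rewrite /= H // shiftE2.
have [_ _ a b] := has_grad_ext oV Vq e1 (shift_grad 1 0 k.1 q).
have [_ _ a' b'] := has_grad_ext oV Vq e2 (shift_grad 0 1 k.2 q).
by rewrite /Defs.jacobian a b a' b' mulr1 mulr0 subr0.
Qed.

(** A quotient need not be Hausdorff; here functions continuous after composition with the
    projection separate points. They will be the four real coordinates of the underlying vector. *)
Lemma clifford_separated (F : clifford_point R -> R) p p' : continuous (F \o torus_proj) ->
  F p != F p' -> exists2 AB, (p \in AB.1 /\ p' \in AB.2) &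
    [/\ open AB.1, open AB.2 & AB.1 `&` AB.2 == set0].
Proof.
move=> cF; have := @Rhausdorff R; rewrite open_hausdorff => H /H[[A B] /= [pA pB] [oA oB AB]].
exists (F @^-1` A, F @^-1` B) => /=; first by split; rewrite inE; apply/set_mem.
split.
- by rewrite open_cliffordE -comp_preimage; apply: open_comp => // x _; exact: cF.
- by rewrite open_cliffordE -comp_preimage; apply: open_comp => // x _; exact: cF.
- by rewrite -preimage_setI (eqP AB) preimage_set0.
Qed.

Lemma clifford_hausdorff : hausdorff_space (clifford_point R).
Proof.
rewrite open_hausdorff => p p' /eqP pp'.
have sm := smooth_Vk 0 (rot4_smooth [set: R * R] (Num.sqrt 2)^-1 0 (Num.sqrt 2)^-1 0).
have [k0 k1 k2 k3] : Vk 0 [set: R * R] torus_map := sm.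
have [e0|n0] := eqVneq (c0 (val p)) (c0 (val p')); last first.
  by apply: (@clifford_separated (fun p => c0 (val p))) n0 => q; exact: k0.
have [e1|n1] := eqVneq (c1 (val p)) (c1 (val p')); last first.
  by apply: (@clifford_separated (fun p => c1 (val p))) n1 => q; exact: k1.
have [e2|n2] := eqVneq (c2 (val p)) (c2 (val p')); last first.
  by apply: (@clifford_separated (fun p => c2 (val p))) n2 => q; exact: k2.
have [e3|n3] := eqVneq (c3 (val p)) (c3 (val p')); last first.
  by apply: (@clifford_separated (fun p => c3 (val p))) n3 => q; exact: k3.
by case: pp'; apply/val_inj/coP.
Qed.

(** The projection is open, so the images of small boxes with rational centres form a countable
    base. *)
Lemma clifford_second_countable : @second_countable (clifford_point R).
Proof.
pose Bx (i : rat * rat * nat) := torus_proj @` box (ratr i.1.1, ratr i.1.2) (i.2.+1%:R^-1).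
exists (range Bx).
  by apply: sub_countable (countableP [set: rat * rat * nat]); exact: card_image_le.
split.
  by move=> _ [i _ <-]; apply: torus_proj_open; exact: box_open.
move=> p A; have [q _ <-] := torus_proj_surj p.
rewrite nbhsE => -[B [oB Bq] BA].
have [e e0 eB] := open_box oB Bq.
have [n ne] : exists n : nat, n.+1%:R^-1 < e / 2.
  have e2 : 0 < e / 2 by rewrite divr_gt0.
  have h : 0 <= (e / 2)^-1 by rewrite invr_ge0 ltW.
  exists (Num.bound (e / 2)^-1).
  rewrite -[e / 2]invrK ltf_pV2 ?posrE ?invr_gt0 //.
  apply: (lt_trans (archi_boundP h)).
  by rewrite invrK ltr_nat.
have dr (x : R) : exists a : rat, `|x - ratr a| < n.+1%:R^-1.
  have xlt : x < x + n.+1%:R^-1 by rewrite ltrDl invr_gt0.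
  have [a] := rat_in_itvoo xlt; rewrite in_itv /= => /andP[a1 a2].
  by exists a; rewrite distrC ger0_norm ?subr_ge0 ?ltW // ltrBlDl.
have [a1 h1] := dr q.1; have [a2 h2] := dr q.2.
exists (Bx (a1, a2, n)).
  by split; [exists (a1, a2, n)|exists q].
move=> _ [x [x1 x2] <-] /=; apply: BA; apply: eB.
have tri (s t u d : R) : `|s - u| < d -> `|t - u| < d -> d < e / 2 -> `|s - t| < e.
  move=> su tu de; rewrite -[s](subrK u) -addrA; apply: le_lt_trans (ler_normD _ _) _.
  by rewrite [ltRHS]splitr distrC [`|u - t|]distrC ltrD // (lt_trans _ de) // distrC.
by split; [exact: tri x1 h1 ne|exact: tri x2 h2 ne].
Qed.

Lemma clifford_compact : compact [set: clifford_point R].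
Proof.
have -> : [set: clifford_point R] = torus_proj @` [set x | `|x.1 - 0| <= pi /\ `|x.2 - 0| <= pi].
  apply/seteqP; split => // p _; have [q [q1 q2] <-] := torus_proj_surj p.
  by exists q => //=; rewrite !subr0.
apply: continuous_compact; first by apply: continuous_subspaceT; exact: torus_proj_continuous.
exact: (@closed_box_compact R (0, 0) pi).
Qed.

(** The torus is the union of the images of the lines through the origin of the plane, which share a
    point. *)
Lemma clifford_connected : connected [set: clifford_point R].
Proof.
have -> : [set: clifford_point R] = \bigcup_(q in [set: R * R]) ((fun t : R => torus_proj (t *: q)) @` [set: R]).
  apply/seteqP; split => // p _; have [q _ <-] := torus_proj_surj p.
  by exists q => //; exists 1 => //; rewrite scale1r.
apply: bigcup_connected.
  by exists (torus_proj 0) => q _; exists 0 => //; rewrite scale0r.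
move=> q _; apply: connected_continuous_connected.
  by apply/connected_intervalP => x y _ _ z _.
apply: continuous_subspaceT => t.
apply: (@continuous_comp _ _ _ (fun t : R => t *: q) torus_proj); last exact: torus_proj_continuous.
exact: scalel_continuous.
Qed.

Definition clifford_oriented : oriented_surface R :=
  OrientedSurface clifford_hausdorff clifford_second_countable torus_cover torus_smooth torus_oriented.

Let torus_imm (p : clifford_oriented) : 'rV[R[i]]_2 := val (p : clifford_point R).

Let torus_sphere p : sphere3 (torus_imm p).
Proof.
case: p => z /= zc; have /clifford_torusP [z0 z1] := asboolW zc.
rewrite /sphere3 /torus_imm /= hermE [inner z ('i *: z)]innerC inneriz innerE -!expr2 z0 -addrA z1.
have -> : 2^-1 + 2^-1 = 1 :> R by lra.
by [].
Qed.

Let torus_immE c : torus_atlas c -> (fun q => torus_imm (param c q)) = torus_map.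
Proof. by move=> [t _ <-]. Qed.

Let torus_imm_smooth c : atlas c ->
  smooth_map_on (coord c @` chart_dom c) (fun q => torus_imm (param c q)).
Proof. by move=> /torus_immE ->; exact: rot4_smooth. Qed.

Let r : R := (Num.sqrt 2)^-1.
Let torus_mapE : torus_map = @rot4 R r 0 r 0. Proof. by []. Qed.
Let r2 : r * r = 2^-1. Proof. by rewrite /r -invfM -expr2 sqr_sqrtr. Qed.

Let torus_Du : Du torus_map = @rot4 R 0 r 0 0.
Proof. by rewrite /torus_map Du_rot4 oppr0. Qed.
Let torus_Dv : Dv torus_map = @rot4 R 0 0 0 r.
Proof. by rewrite /torus_map Dv_rot4 oppr0. Qed.

Let torus_rank c : atlas c -> forall q, (coord c @` chart_dom c) q ->
  immersion_at (fun q => torus_imm (param c q)) q.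
Proof.
move=> /torus_immE -> q _ a b; rewrite torus_Du torus_Dv rcomb_rot4 => e.
have h x y z w : inner (rot4 x y z w q) (rot4 x y z w q) = x * x + y * y + z * z + w * w.
  exact: inner_rot4.
have rn0 : r != 0 by rewrite invr_eq0 sqrtr_eq0 -ltNge.
split; apply: (mulIf rn0); rewrite mul0r.
  have := inner_rot4 (a * 0 + b * 0) (a * r + b * 0) (a * 0 + b * 0) (a * 0 + b * r) 0 r 0 0 q.
  rewrite e inner0l => e1; apply: (mulIf rn0); rewrite mul0r; lra.
have := inner_rot4 (a * 0 + b * 0) (a * r + b * 0) (a * 0 + b * 0) (a * 0 + b * r) 0 0 0 r q.
rewrite e inner0l => e1; apply: (mulIf rn0); rewrite mul0r; lra.
Qed.

Definition clifford_surface : immersed_surface R :=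
  @ImmersedSurface R clifford_oriented torus_imm torus_sphere torus_imm_smooth torus_rank.

Lemma clifford_closed : closed_surface clifford_surface.
Proof.
split; [by exists (torus_proj 0)|exact: clifford_compact|exact: clifford_connected].
Qed.

(** In the charts E = G = 1/2 and F = 0, and X_uu + X_vv = -X is orthogonal to every normal tangent
    to the sphere. *)
Lemma clifford_minimal : minimal clifford_surface.
Proof.
move=> c /torus_immE cE q _ N; rewrite /local_immersion /= cE => -[xN _ _ _].
have e0 : -%R 0 = 0 :> R by exact: oppr0.
rewrite /mean_curvature torus_Du torus_Dv !Du_rot4 !Dv_rot4 !inner_rot4 !e0.
have NE : inner (rot4 0 0 (- r) 0 q) N + inner (rot4 (- r) 0 0 0 q) N = - inner (torus_map q) N.
  rewrite -innerDl -innerNl; congr (inner _ N).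
  by apply: coP; rewrite torus_mapE /rot4 !coE; ring.
have -> : (0 * 0 + r * r + 0 * 0 + 0 * 0) * inner (rot4 0 0 (- r) 0 q) N -
  2 * (0 * 0 + r * 0 + 0 * 0 + 0 * r) * inner (rot4 0 0 0 0 q) N +
  (0 * 0 + 0 * 0 + 0 * 0 + r * r) * inner (rot4 (- r) 0 0 0 q) N =
  r * r * (inner (rot4 0 0 (- r) 0 q) N + inner (rot4 (- r) 0 0 0 q) N) by ring.
by rewrite NE xN oppr0 mulr0 mul0r.
Qed.

Lemma clifford_contact_angle : contact_angle (fun _ : clifford_surface => 0 : R).
Proof.
move=> p; have pi20 : 0 <= pi / 2 :> R by exact: ltW.
split; rewrite ?oppr_le0 //.
move=> c /torus_immE cE cp; set q := coord c p.
have pE : @immersion R clifford_surface p = torus_map q.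
  by rewrite -cE /q /= coordK.
(* The frame is e1 = X_u - X_v and e2 = X_u + X_v. The latter is iX, the Reeb vector itself, so that
   the angle is 0. *)
exists (rot4 0 r 0 (- r) q), (rot4 0 r 0 r q); split; last first.
  by rewrite sin0 cos0 pE /reeb torus_mapE !i_rot4 rcomb_rot4; congr (rot4 _ _ _ _ _); ring.
rewrite /local_immersion /= cE /characteristic_frame torus_Du torus_Dv; split.
  exists 1, (-1), 1, 1; rewrite !rcomb_rot4; split; last lra.
  - by congr (rot4 _ _ _ _ _); ring.
  - by congr (rot4 _ _ _ _ _); ring.
rewrite !inner_rot4; split.
- transitivity (2 * (r * r)); [ring|by rewrite r2 mulfV].
- transitivity (2 * (r * r)); [ring|by rewrite r2 mulfV].
- ring.
- rewrite /contact /tangent3 /reeb torus_mapE /= i_rot4 !inner_rot4; split; ring.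
Qed.

Lemma clifford_injective : injective (@immersion R clifford_surface).
Proof. by move=> p p' /val_inj. Qed.

Lemma clifford_range : range (@immersion R clifford_surface) = @clifford_torus R.
Proof.
apply/seteqP; split=> [_ [[z zc] _ <-]|z zc]; first exact: (asboolW zc).
by exists (exist _ z (asboolT zc)).
Qed.

End CliffordSpace.

Theorem theorem2 (R : realType) (I : interval R)
    (hI : I = (`[0, pi / 2[) \/ I = (`]-(pi / 2), 0])) :
  (exists (S : immersed_surface R) (beta : S -> R),
     [/\ injective (@immersion R S),
         range (@immersion R S) = clifford_torus,
         closed_surface S, minimal S &
         contact_angle beta /\ forall p, beta p \in I]) /\
  (forall (S : immersed_surface R) (beta : S -> R),
     closed_surface S -> minimal S -> contact_angle beta ->
     (forall p, beta p \in I) ->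
     exists2 U : 'M[R[i]]_2, U \is unitarymx &
       range (@immersion R S) = (fun z => z *m U) @` clifford_torus).
Proof.
split; last by move=> S beta; exact: range_eq_unitary_clifford hI.
exists (@clifford_surface R), (fun=> 0); split;
  [exact: clifford_injective|exact: clifford_range|exact: clifford_closed|exact: clifford_minimal|].
split=> [|_]; first exact: clifford_contact_angle.
have pi2 : 0 < pi / 2 :> R by rewrite divr_gt0 ?pi_gt0.
by case: hI => ->; rewrite in_itv /= ?oppr_lt0 lexx pi2.
Qed.
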